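(* Let $\boldsymbol{k}\in\mathbb{Z}_+^m$ be a partition of $n$ with $m\geq 2$ and let $j\in\{1,\dots,m\}$ be given. Let $a\in L^\infty(\mathbb{B}^n)$ be a $(\boldsymbol{k},j)$-quasi-radial quasi-homogeneous symbol, and let $g\in L^\infty(\tau(\mathbb{B}^m)\times S_+^{k_j-1}\times\mathbb{T}^{k_j})$ be the corresponding function, i.e. $g(r,s,\eta t)=g(r,s,t)$ for every $r\in\tau(\mathbb{B}^m)$, $s\in S_+^{k_j-1}$, $t\in\mathbb{T}^{k_j}$, $\eta\in\mathbb{T}$, and $a(z)=g(|z_{(1)}|,\dots,|z_{(m)}|,s_{(j)},t_{(j)})$ for almost every $z\in\mathbb{B}^n$. Then for every $\lambda>-1$ and $\boldsymbol{\kappa}\in\mathbb{N}^m$ we have \[ \begin{aligned} \langle T_a^{(\lambda)}(z^\alpha),z^\beta\rangle_\lambda = {}& \frac{2^{m-1}\,\Gamma(n+\lambda+1)\,\alpha_{\widehat{(j)}}!}{\pi^{k_j}\,\Gamma(\lambda+1)\prod_{l\neq j}(k_l+\kappa_l-1)!} \\ &\times\int_{\tau(\mathbb{B}^m)\times S_+^{k_j-1}\times\mathbb{T}^{k_j}} g(r,s_{(j)},t_{(j)})\,{s_{(j)}}^{\alpha_{(j)}+\beta_{(j)}+1_{k_j}}\,{t_{(j)}}^{\alpha_{(j)}-\beta_{(j)}} \\ &\qquad\times(1-|r|^2)^\lambda\prod_{l=1}^m r_l^{2k_l+2\kappa_l-1}\,dr_l\,ds_{(j)}\,dt_{(j)}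 \end{aligned} \] for every $\alpha,\beta\in\mathbb{N}^n$ such that $|\alpha_{(l)}|=|\beta_{(l)}|=\kappa_l$ for all $l=1,\dots,m$ and that satisfy $\alpha_{\widehat{(j)}}=\beta_{\widehat{(j)}}$.
   Context: Here $\mathbb{N}=\{0,1,2,\dots\}$, $\mathbb{Z}_+$ is the set of positive integers, $\mathbb{R}_+=[0,\infty)$, and $\tau(\mathbb{B}^m)=\{r\in\mathbb{R}_+^m : |r|<1\}$ with $|r|$ the Euclidean norm. $\mathbb{B}^n$ is the open unit ball of $\mathbb{C}^n$ with Lebesgue measure $v$. For $\lambda>-1$, $dv_\lambda(z) = c_\lambda (1-|z|^2)^\lambda dv(z)$ with $c_\lambda = \frac{\Gamma(n+\lambda+1)}{\pi^n\Gamma(\lambda+1)}$, and $\mathcal{A}^2_\lambda(\mathbb{B}^n)$ is the closed subspace of holomorphic functions in $L^2(\mathbb{B}^n,v_\lambda)$, with inner product $\langle\cdot,\cdot\rangle_\lambda$ and orthogonal projection $B_\lambda$. For $a\in L^\infty(\mathbb{B}^n)$ the Toeplitz operator is $T_a^{(\lambda)}(f)=B_\lambda(af)$ on $\mathcal{A}^2_\lambda(\mathbb{B}^n)$. A partition of $n$ is $\boldsymbol{k}=(k_1,\dots,k_m)\in\mathbb{Z}_+^m$ with $k_1+\dots+k_m=n$. It gives $\mathbb{C}^n=\mathbb{C}^{k_1}\times\dots\times\mathbb{C}^{k_m}$, $z=(z_{(1)},\dots,z_{(m)})$ and, for multi-indices, $\alpha=(\alpha_{(1)},\dots,\alpha_{(m)})\in\mathbb{N}^n$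 with $\alpha_{(l)}\in\mathbb{N}^{k_l}$. Also $\alpha_{\widehat{(j)}}=(\alpha_{(1)},\dots,\alpha_{(j-1)},\alpha_{(j+1)},\dots,\alpha_{(m)})\in\mathbb{N}^{n-k_j}$, and $1_{k_j}=(1,\dots,1)\in\mathbb{N}^{k_j}$. $S_+^{k_j-1}$ is the set of points of $\mathbb{R}_+^{k_j}$ in the unit sphere of $\mathbb{C}^{k_j}$; $ds_{(j)}$ is the measure on it coming from the Riemannian structure inherited from $\mathbb{R}^{k_j}$, and $dt_{(j)}$ is the Haar measure on $\mathbb{T}^{k_j}$ with total mass $(2\pi)^{k_j}$. One writes $z_{(j)}=|z_{(j)}|\,t_{(j)}\cdot s_{(j)}$ with $t_{(j)}\in\mathbb{T}^{k_j}$, $s_{(j)}\in S_+^{k_j-1}$, where $t\cdot s$ is the componentwise product. A symbol $a\in L^\infty(\mathbb{B}^n)$ is $(\boldsymbol{k},j)$-quasi-radial quasi-homogeneous if $a\circ A=a$ for all $A$ in the block diagonal subgroup $\mathrm{U}(\boldsymbol{k},j,\mathbb{T})=\mathrm{U}(k_1)\times\dots\times\mathrm{U}(k_{j-1})\times\mathbb{T}I_{(j)}\times\mathrm{U}(k_{j+1})\times\dots\times\mathrm{U}(k_m)$ of $\mathrm{U}(n)$, $I_{(j)}$ being the identity of $\mathbb{C}^{k_j}$; this is equivalent to the existence of a function $g$ as in the claim. *)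

(* Defs.v *)
From HB Require Import structures.
From mathcomp Require Import all_boot all_order all_algebra.
From mathcomp Require Import spectral complex.
From mathcomp Require Import all_classical all_reals all_analysis.
From mathcomp Require Import measurable_realfun.

Set Implicit Arguments.
Unset Strict Implicit.
Unset Printing Implicit Defensive.

Import Order.TTheory GRing.Theory Num.Theory numFieldNormedType.Exports.

Local Open Scope classical_set_scope.
Local Open Scope ring_scope.
Local Open Scope complex_scope.

(* The library equips neither [R[i]] nor column vectors with a sigma-algebra. *)

Section complex_measurable.
Context {R : realType}.

HB.instance Definition _ := isPointed.Build R[i] 0.

Definition cpair (z : R[i]) : measurableTypeR R * measurableTypeR R :=
  (complex.Re z, complex.Im z).
Definition pairc (p : measurableTypeR R * measurableTypeR R) : R[i] :=
  p.1 +i* p.2.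

Definition measurableC : set (set R[i]) :=
  preimage_set_system setT cpair measurable.

Let measurableC_sigma : sigma_algebra setT measurableC.
Proof. exact/sigma_algebra_preimage/sigma_algebra_measurable. Qed.

Let measurableC0 : measurableC set0.
Proof. by have [] := measurableC_sigma. Qed.

Let measurableCC A : measurableC A -> measurableC (~` A).
Proof. by have [_ + _] := measurableC_sigma; rewrite -setTD; apply. Qed.

Let measurableC_bigcup (F : (set R[i])^nat) :
  (forall i, measurableC (F i)) -> measurableC (\bigcup_i F i).
Proof. by have [_ _] := measurableC_sigma; apply. Qed.

HB.instance Definition _ := isMeasurable.Build default_measure_display R[i]
  measurableC0 measurableCC measurableC_bigcup.

Lemma measurable_cpair : measurable_fun setT cpair.
Proof. by move=> _ A mA; rewrite setTI; exists A => //; rewrite setTI. Qed.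

Lemma measurable_pairc : measurable_fun setT pairc.
Proof.
move=> _ A [B mB <-]; rewrite !setTI.
by rewrite (_ : _ @^-1` _ = B)//; apply/seteqP; split => -[].
Qed.

End complex_measurable.

(* [vec T n] is ['cV[T]_n] with the product sigma-algebra. *)
Definition vec (T : Type) (n : nat) := 'cV[T]_n.

Section vec_measurable.
Context {d} {T : measurableType d} (n : nat).

HB.instance Definition _ := Choice.on (vec T n).
HB.instance Definition _ := isPointed.Build (vec T n) (const_mx point).

Let coord (i : 'I_n) (x : vec T n) : T := (x : 'cV[T]_n) i ord0.

Let vec_set0 : g_sigma_preimage coord set0.
Proof. exact: sigma_algebra0. Qed.

Let vec_setC A : g_sigma_preimage coord A -> g_sigma_preimage coord (~` A).
Proof. exact: sigma_algebraC. Qed.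

Let vec_bigcup (F : _^nat) : (forall i, g_sigma_preimage coord (F i)) ->
  g_sigma_preimage coord (\bigcup_i (F i)).
Proof. exact: sigma_algebra_bigcup. Qed.

HB.instance Definition _ := @isMeasurable.Build (measure_tuple_display d)
  (vec T n) (g_sigma_preimage coord) vec_set0 vec_setC vec_bigcup.

Lemma measurable_coord (i : 'I_n) :
  measurable_fun setT (fun x : vec T n => (x : 'cV[T]_n) i ord0).
Proof.
move=> _ Y mY; rewrite setTI; apply: sub_sigma_algebra => /=.
rewrite -bigcup_seq/=; exists i => /=; first by rewrite mem_index_enum.
by exists Y => //; rewrite setTI.
Qed.

Lemma measurable_vecP d' (T' : measurableType d') (f : T' -> vec T n) :
  (forall i, measurable_fun setT (fun x => (f x : 'cV[T]_n) i ord0)) ->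
  measurable_fun setT f.
Proof.
move=> mf; have : g_sigma_preimage (fun i => coord i \o f) `<=` measurable.
  apply: smallest_sub; first exact: sigma_algebra_measurable.
  move=> A; rewrite -bigcup_seq/= => -[i _] [B mB <-].
  exact: mf.
rewrite g_sigma_preimage_comp => H _ A mA; apply: H.
by exists A.
Qed.

End vec_measurable.

(* [image_measure mu mf sf] is [pushforward mu f], bundled as a sigma-finite
   measure, which the products [\x] of the library require. *)
Section image_measure.
Context d d' (T : measurableType d) (T' : measurableType d') (R : realType).
Variables (mu : {measure set T -> \bar R}) (f : T -> T').

Definition image_measure (mf : measurable_fun setT f)
    (sf : sigma_finite setT (pushforward mu f)) : set T' -> \bar R :=
  pushforward mu f.

Variables (mf : measurable_fun setT f).
Variables (sf : sigma_finite setT (pushforward mu f)).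

Let image_measure0 : image_measure mf sf set0 = 0%E.
Proof. by rewrite /image_measure /pushforward preimage_set0 measure0. Qed.

Let image_measure_ge0 A : (0 <= image_measure mf sf A)%E.
Proof. exact: measure_ge0. Qed.

Let image_measure_sigma_additive : semi_sigma_additive (image_measure mf sf).
Proof. exact: measure_semi_sigma_additive. Qed.

HB.instance Definition _ := isMeasure.Build _ _ _ (image_measure mf sf)
  image_measure0 image_measure_ge0 image_measure_sigma_additive.

HB.instance Definition _ := @Measure_isSigmaFinite.Build _ _ _
  (image_measure mf sf) sf.

End image_measure.

Lemma pushforward_sigma_finite d d' (T : measurableType d)
    (T' : measurableType d') (R : realType)
    (mu : {measure set T -> \bar R}) (f : T -> T') (g : T' -> T) :
  sigma_finite setT mu ->
  measurable_fun setT f -> measurable_fun setT g -> cancel f g ->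
  sigma_finite setT (pushforward mu f).
Proof.
move=> [F UF mF] mf mg fK.
exists (fun i => g @^-1` F i).
  by rewrite -preimage_bigcup -UF preimage_setT.
move=> i; split.
  by rewrite -[X in measurable X]setTI; apply: mg => //; exact: (mF i).1.
rewrite /pushforward -comp_preimage (_ : g \o f = id); last exact/funext.
by rewrite preimage_id; exact: (mF i).2.
Qed.

Lemma pushforward_fin_sigma_finite d d' (T : measurableType d)
    (T' : measurableType d') (R : realType)
    (mu : {measure set T -> \bar R}) (f : T -> T') :
  (mu setT < +oo)%E ->
  measurable_fun setT f -> sigma_finite setT (pushforward mu f).
Proof.
move=> muT mf; exists (fun=> setT); first by rewrite bigcup_const.
by move=> _; split=> //; rewrite /pushforward preimage_setT.
Qed.

Section product_sigma_finite.
Context d d' (T : measurableType d) (T' : measurableType d') (R : realType).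
Variables (mu : {sigma_finite_measure set T -> \bar R}).
Variables (nu : {sigma_finite_measure set T' -> \bar R}).

Lemma product_measure1_sigma_finite : sigma_finite setT (mu \x nu)%E.
Proof.
have /sigma_finiteP[F [UF ndF mF]] := sigma_finiteT mu.
have /sigma_finiteP[G [UG ndG mG]] := sigma_finiteT nu.
exists (fun i => F i `*` G i).
  apply/seteqP; split => // -[x y] _.
  have [i _ Fix] : (\bigcup_i F i) x by rewrite -UF.
  have [k _ Gky] : (\bigcup_i G i) y by rewrite -UG.
  exists (maxn i k) => //; split => /=.
    by have /subsetPset := ndF _ _ (leq_maxl i k); apply.
  by have /subsetPset := ndG _ _ (leq_maxr i k); apply.
move=> i; have [mFi Fioo] := mF i; have [mGi Gioo] := mG i.
split; first exact: measurableX.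
by rewrite product_measure1E// lte_mul_pinfty ?ge0_fin_numE.
Qed.

End product_sigma_finite.

(* [vec_measure mu n] is the n-fold product measure of mu on [vec T n]. *)
Section vec_measure.
Context d (T : measurableType d) (R : realType).
Variable mu : {sigma_finite_measure set T -> \bar R}.

Definition vec_cons n (p : T * vec T n) : vec T n.+1 :=
  \col_i (if unlift ord0 i is Some i' then (p.2 : 'cV[T]_n) i' ord0 else p.1).

Definition vec_uncons n (x : vec T n.+1) : T * vec T n :=
  ((x : 'cV[T]_n.+1) ord0 ord0,
   \col_(i < n) (x : 'cV[T]_n.+1) (lift ord0 i) ord0).

Lemma vec_consK n : cancel (@vec_cons n) (@vec_uncons n).
Proof.
move=> [t x]; rewrite /vec_uncons /vec_cons !mxE unlift_none/=; congr pair.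
by apply/matrixP => i j; rewrite !mxE liftK (ord1 j).
Qed.

Lemma measurable_vec_cons n : measurable_fun setT (@vec_cons n).
Proof.
apply: measurable_vecP => i.
case: (unliftP ord0 i) => [i' ->|->].
  rewrite (_ : (fun x => _) = fun x : T * vec T n =>
    (x.2 : 'cV[T]_n) i' ord0); last first.
    by apply/funext => x; rewrite mxE liftK.
  exact: (measurableT_comp (measurable_coord i') measurable_snd).
rewrite (_ : (fun x => _) = fst)//.
by apply/funext => x; rewrite mxE unlift_none.
Qed.

Lemma measurable_vec_uncons n : measurable_fun setT (@vec_uncons n).
Proof.
apply/measurable_fun_pairP; split.
  exact: (measurable_coord ord0).
apply: measurable_vecP => i.
rewrite (_ : (fun x => _) = fun x : vec T n.+1 =>
    (x : 'cV[T]_n.+1) (lift ord0 i) ord0); last first.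
  by apply/funext => x; rewrite /= mxE.
exact: measurable_coord.
Qed.

Fixpoint vec_measure n : {sigma_finite_measure set (vec T n) -> \bar R} :=
  if n is n'.+1 then
    image_measure (measurable_vec_cons (n := n'))
      (pushforward_sigma_finite (product_measure1_sigma_finite mu (vec_measure n'))
         (measurable_vec_cons (n := n')) (measurable_vec_uncons (n := n'))
         (@vec_consK n'))
  else \d_(const_mx point : vec T 0).

End vec_measure.

Section density_measure.
Context d (T : measurableType d) (R : realType).
Variables (mu : {sigma_finite_measure set T -> \bar R}) (f : T -> R).

Definition density_measure (mf : measurable_fun setT f)
    (f0 : forall x, 0 <= f x) : set T -> \bar R :=
  fun A => (\int[mu]_(x in A) (f x)%:E)%E.

Variables (mf : measurable_fun setT f) (f0 : forall x, 0 <= f x).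

Let density_measure0 : density_measure mf f0 set0 = 0%E.
Proof. by rewrite /density_measure integral_set0. Qed.

Let density_measure_ge0 A : (0 <= density_measure mf f0 A)%E.
Proof. by apply: integral_ge0 => x _; rewrite lee_fin. Qed.

Let density_measure_sigma_additive :
  semi_sigma_additive (density_measure mf f0).
Proof.
move=> F mF tF mUF; rewrite /density_measure ge0_integral_bigcup//.
- apply: is_cvg_ereal_nneg_natsum => n _.
  by apply: integral_ge0 => x _; rewrite lee_fin.
- by apply/measurable_EFinP; exact: measurable_funS mf.
- by move=> x _; rewrite lee_fin.
Qed.

HB.instance Definition _ := isMeasure.Build _ _ _ (density_measure mf f0)
  density_measure0 density_measure_ge0 density_measure_sigma_additive.

Let density_measure_sigma_finite : sigma_finite setT (density_measure mf f0).
Proof.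
have /sigma_finiteP[F [UF ndF mF]] := sigma_finiteT mu.
have mE (i : nat) : measurable (f @^-1` `]-oo, i%:R]).
  by rewrite -[X in measurable X]setTI; exact: mf.
exists (fun i => F i `&` f @^-1` `]-oo, i%:R]).
  apply/seteqP; split => // x _.
  have [i _ Fix] : (\bigcup_i F i) x by rewrite -UF.
  exists (maxn i (Num.truncn (f x)).+1) => //; split => /=.
    by have /subsetPset := ndF _ _ (leq_maxl i (Num.truncn (f x)).+1); apply.
  rewrite in_itv/= (le_trans (ltW (truncnS_gt (f x))))// ler_nat.
  exact: leq_maxr.
move=> i; have [mFi Fioo] := mF i; split; first exact: measurableI.
apply: (@le_lt_trans _ _ (\int[mu]_(x in F i `&` f @^-1` `]-oo, i%:R])
    (cst i%:R%:E x))%E).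
  apply: ge0_le_integral => //.
  - exact: measurableI.
  - by move=> x _; rewrite lee_fin.
  - by apply/measurable_EFinP; exact: measurable_funS mf.
  - by move=> x [_ /=]; rewrite in_itv/= lee_fin.
rewrite integral_cst; last exact: measurableI.
rewrite lte_mul_pinfty ?lee_fin//.
apply: le_lt_trans Fioo; apply: le_measure; rewrite ?inE//.
exact: measurableI.
Qed.

HB.instance Definition _ := @Measure_isSigmaFinite.Build _ _ _
  (density_measure mf f0) density_measure_sigma_finite.

End density_measure.

Section real_and_complex_spaces.
Context {R : realType}.

Definition rnorm n (x : 'cV[R]_n) : R := Num.sqrt (\sum_i x i ord0 ^+ 2).

Definition cnorm n (z : 'cV[R[i]]_n) : R :=
  Num.sqrt (\sum_i Normc.normc (z i ord0) ^+ 2).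

Definition unit_ball n : set (vec R[i] n) := [set z | cnorm z < 1].

Definition tau_ball m : set (vec (measurableTypeR R) m) :=
  [set r | (forall l, 0 <= (r : 'cV[R]_m) l ord0) /\ rnorm r < 1].

Definition pos_sphere k : set (vec (measurableTypeR R) k) :=
  [set s | (forall i, 0 <= (s : 'cV[R]_k) i ord0) /\ rnorm s = 1].

Definition torus k : set (vec R[i] k) :=
  [set t | forall i, `|(t : 'cV[R[i]]_k) i ord0| = 1].

Arguments unit_ball : clear implicits.
Arguments tau_ball : clear implicits.
Arguments pos_sphere : clear implicits.
Arguments torus : clear implicits.

Definition lebesgueR n := vec_measure (@lebesgue_measure R) n.

Lemma pairc_sigma_finite : sigma_finite setT
  (pushforward (@lebesgue_measure R \x @lebesgue_measure R)%E pairc).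
Proof.
apply: (pushforward_sigma_finite (g := cpair)).
- exact: product_measure1_sigma_finite.
- exact: measurable_pairc.
- exact: measurable_cpair.
- by case.
Qed.

Definition lebesgueC n :=
  vec_measure (image_measure measurable_pairc pairc_sigma_finite) n.

Definition expi (theta : measurableTypeR R) : R[i] := cos theta +i* sin theta.

Lemma measurable_expi : measurable_fun setT expi.
Proof.
have mc : measurable_fun setT (@cos R).
  by apply: continuous_measurable_fun => x; exact: continuous_cos.
have ms : measurable_fun setT (@sin R).
  by apply: continuous_measurable_fun => x; exact: continuous_sin.
have m : measurable_fun setT (fun theta : measurableTypeR R =>
    (cos theta, sin theta) : measurableTypeR R * measurableTypeR R).
  apply/measurable_fun_pairP; split.
  - exact: mc.
  - exact: ms.
exact: (measurableT_comp measurable_pairc m).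
Qed.

Definition arc_length :=
  mrestr (@lebesgue_measure R) (measurable_itv `[0, 2 * pi[).

Lemma expi_sigma_finite : sigma_finite setT (pushforward arc_length expi).
Proof.
apply: pushforward_fin_sigma_finite measurable_expi.
rewrite /= /arc_length /mrestr /= setTI lebesgue_measure_itv/=.
by case: ifP => _; rewrite ltry.
Qed.

(* Haar measure of the k-torus, of total mass [(2 * pi) ^+ k] *)
Definition torus_haar k :=
  vec_measure (image_measure measurable_expi expi_sigma_finite) k.

(* The Riemannian measure of the part of the unit sphere of [R^k] with
   nonnegative coordinates is computed in the chart
   [x |-> (x, sqrt (1 - |x|^2))] over [tau_ball k.-1]: this chart covers all of
   it but the points with last coordinate 0, and the density is the square root
   of the Gram determinant of the partial derivatives of the chart.  For k = 1
   this is the Dirac measure at 1. *)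
Definition sphere_chart k (x : vec (measurableTypeR R) k.-1) :
    vec (measurableTypeR R) k :=
  \col_(i < k) (if insub (val i) is Some i' then (x : 'cV[R]_k.-1) i' ord0
                else Num.sqrt (1 - rnorm x ^+ 2)).

Definition sphere_tangent k (x : 'cV[R]_k.-1) (p : 'I_k.-1) : 'cV[R]_k :=
  \col_(i < k) (if insub (val i) is Some i' then (i' == p)%:R
                else - x p ord0 / Num.sqrt (1 - rnorm x ^+ 2)).

Definition sphere_gram k (x : 'cV[R]_k.-1) : 'M[R]_k.-1 :=
  \matrix_(p, q)
    \sum_i sphere_tangent x p i ord0 * sphere_tangent x q i ord0.

Definition sphere_density k (x : vec (measurableTypeR R) k.-1) : R :=
  \1_(tau_ball k.-1) x * Num.sqrt (\det (sphere_gram x)).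

Lemma measurable_sqrt : measurable_fun setT (@Num.sqrt R).
Proof. by apply: continuous_measurable_fun => x; exact: sqrt_continuous. Qed.

Lemma measurable_rnorm n :
  measurable_fun setT (fun x : vec (measurableTypeR R) n => rnorm x).
Proof.
apply: (measurableT_comp measurable_sqrt).
apply: measurable_sum => i; apply: measurable_funX.
exact: measurable_coord.
Qed.

Lemma measurable_tau_ball n : measurable (tau_ball n).
Proof.
rewrite (_ : tau_ball n =
  (\bigcap_(i in [set: 'I_n])
    ((fun x : vec (measurableTypeR R) n => (x : 'cV[R]_n) i ord0)
      @^-1` `[0, +oo[%classic)) `&`
  ((fun x : vec (measurableTypeR R) n => rnorm x) @^-1` `]-oo, 1[%classic));
  last first.
  apply/seteqP; split => x /=.
    by move=> [x0 x1]; split; [move=> i _ /=; rewrite in_itv/= x0|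
      rewrite in_itv].
  move=> [x0 x1]; split; last by move: x1; rewrite in_itv.
  by move=> i; have := x0 i I; rewrite /= in_itv/= andbT.
apply: measurableI.
  apply: fin_bigcap_measurable => // i _.
  by rewrite -[X in measurable X]setTI; exact: measurable_coord.
by rewrite -[X in measurable X]setTI; exact: measurable_rnorm.
Qed.

Lemma measurable_sphere_tangent k p i : measurable_fun setT
  (fun x : vec (measurableTypeR R) k.-1 => sphere_tangent x p i ord0).
Proof.
under eq_fun do rewrite mxE.
case: insubP => [i' _ _|_]; first exact: measurable_cst.
under eq_fun do rewrite -powR_inv1 ?sqrtr_ge0//.
apply: measurable_funM.
  by apply: measurableT_comp => //; exact: measurable_coord.
apply: (measurableT_comp (measurable_powR _)).
apply: (measurableT_comp measurable_sqrt).
apply: measurable_funB => //; apply: measurable_funX.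
exact: measurable_rnorm.
Qed.

Lemma measurable_sphere_density k : measurable_fun setT (@sphere_density k).
Proof.
apply: measurable_funM.
  by apply: measurable_indic; exact: measurable_tau_ball.
apply: (measurableT_comp measurable_sqrt).
apply: measurable_sum => s; apply: measurable_funM => //.
apply: measurable_prod => p _.
under eq_fun do rewrite mxE.
apply: measurable_sum => i.
by apply: measurable_funM; exact: measurable_sphere_tangent.
Qed.

Lemma sphere_density_ge0 k (x : vec (measurableTypeR R) k.-1) :
  0 <= sphere_density x.
Proof. by rewrite mulr_ge0// sqrtr_ge0. Qed.

Lemma measurable_sphere_chart k : measurable_fun setT (@sphere_chart k).
Proof.
apply: measurable_vecP => i.
under eq_fun do rewrite mxE.
case: insubP => [i' _ _|_]; first exact: measurable_coord.
apply: (measurableT_comp measurable_sqrt).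
apply: measurable_funB => //; apply: measurable_funX.
exact: measurable_rnorm.
Qed.

Lemma sphere_chart_sigma_finite k : sigma_finite setT
  (pushforward (density_measure (lebesgueR k.-1)
    (@measurable_sphere_density k) (@sphere_density_ge0 k)) (@sphere_chart k)).
Proof.
pose proj (s : vec (measurableTypeR R) k) : vec (measurableTypeR R) k.-1 :=
  \col_i (s : 'cV[R]_k) (widen_ord (leq_pred k) i) ord0.
apply: (pushforward_sigma_finite (g := proj)).
- exact: sigma_finiteT.
- exact: measurable_sphere_chart.
- apply: measurable_vecP => i; under eq_fun do rewrite mxE.
  exact: measurable_coord.
- move=> x; apply/matrixP => i j; rewrite !mxE (ord1 j) /=.
  by rewrite insubT//= => ilt; congr (x _ _); exact: val_inj.
Qed.

Definition sphere_measure k :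
    {sigma_finite_measure set (vec (measurableTypeR R) k) -> \bar R} :=
  image_measure (@measurable_sphere_chart k) (@sphere_chart_sigma_finite k).

Definition complex_integral d (T : measurableType d)
    (mu : {measure set T -> \bar R}) (D : set T) (f : T -> R[i]) : R[i] :=
  (\int[mu]_(x in D) complex.Re (f x)) +i* (\int[mu]_(x in D) complex.Im (f x)).

(* membership in [L^oo(D, mu)] *)
Definition Linfty d (T : measurableType d)
    (mu : {measure set T -> \bar R}) (D : set T) (f : T -> R[i]) :=
  measurable_fun D f /\
  exists M : R, {ae mu, forall x, D x -> Normc.normc (f x) <= M}.

End real_and_complex_spaces.
Arguments unit_ball {R} n _.
Arguments tau_ball {R} m _.
Arguments pos_sphere {R} k _.
Arguments torus {R} k _.

Section bergman.
Context {R : realType}.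

Definition Gamma (x : R) : R :=
  \int[lebesgue_measure]_(t in `]0, +oo[) (t `^ (x - 1) * expR (- t)).

Definition bergman_weight n (lambda : R) (z : 'cV[R[i]]_n) : R :=
  Gamma (n%:R + lambda + 1) / (pi ^+ n * Gamma (lambda + 1)) *
  (1 - cnorm z ^+ 2) `^ lambda.

Definition bergman_inner n (lambda : R) (f g : 'cV[R[i]]_n -> R[i]) : R[i] :=
  complex_integral (lebesgueC n) (unit_ball n)
    (fun z => f z * (g z)^* * (bergman_weight lambda z)%:C).

Definition bergman_L2 n (lambda : R) (f : 'cV[R[i]]_n -> R[i]) :=
  measurable_fun (unit_ball n) (f : vec R[i] n -> R[i]) /\
  (\int[lebesgueC n]_(z in unit_ball n)
    (Normc.normc (f z) ^+ 2 * bergman_weight lambda z)%:E < +oo)%E.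

(* functions on the ball are represented by total functions *)
Definition holomorphic_on_ball n (f : 'cV[R[i]]_n -> R[i]) :=
  forall z : [the normedModType R[i] of 'cV[R[i]]_n], unit_ball n z ->
    differentiable (f : _ -> R[i]^o) z.

Definition bergman_space n (lambda : R) (f : 'cV[R[i]]_n -> R[i]) :=
  bergman_L2 lambda f /\ holomorphic_on_ball f.

(* [B] is the orthogonal projection of [L^2] onto the Bergman space; it is
   determined on the ball by this property. *)
Definition bergman_projection n (lambda : R)
    (B : ('cV[R[i]]_n -> R[i]) -> 'cV[R[i]]_n -> R[i]) :=
  forall h, bergman_L2 lambda h ->
    bergman_space lambda (B h) /\
    forall f, bergman_space lambda f ->
      bergman_inner lambda (fun z => h z - B h z) f = 0.

Definition toeplitz n (B : ('cV[R[i]]_n -> R[i]) -> 'cV[R[i]]_n -> R[i])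
    (a f : 'cV[R[i]]_n -> R[i]) : 'cV[R[i]]_n -> R[i] :=
  B (fun z => a z * f z).

Definition monomial n (alpha : 'cV[nat]_n) (z : 'cV[R[i]]_n) : R[i] :=
  \prod_i z i ord0 ^+ alpha i ord0.

End bergman.

(* The blocks [z_(l)] of [z : 'cV_(\sum_l k l)] are [submxcol z l]. *)
Section quasi_radial.
Context {R : realType} {m : nat}.
Variables (k : 'I_m -> nat) (j : 'I_m).

Definition block_unitary : set 'M[R[i]]_(\sum_l k l) :=
  [set A | exists B : forall l, 'M[R[i]]_(k l),
    [/\ forall l, B l \is unitarymx,
        exists2 t : R[i], `|t| = 1 & B j = t%:M &
        A = \mxdiag_l B l]].

Definition quasi_radial_quasi_homogeneous
    (a : 'cV[R[i]]_(\sum_l k l) -> R[i]) :=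
  forall A, block_unitary A ->
    {ae lebesgueC (\sum_l k l), forall z, unit_ball _ z -> a (A *m z) = a z}.

Definition block_norms (z : 'cV[R[i]]_(\sum_l k l)) : 'cV[R]_m :=
  \col_l cnorm (submxcol z l).

Definition polar_domain : set (vec (measurableTypeR R) m *
    vec (measurableTypeR R) (k j) * vec R[i] (k j)) :=
  tau_ball m `*` pos_sphere (k j) `*` torus (k j).

Definition polar_measure : set (vec (measurableTypeR R) m *
    vec (measurableTypeR R) (k j) * vec R[i] (k j)) -> \bar R :=
  ((lebesgueR m \x sphere_measure (k j)) \x torus_haar (k j))%E.

HB.instance Definition _ := Measure.on polar_measure.

End quasi_radial.
Arguments block_unitary {R m} k j _.
Arguments quasi_radial_quasi_homogeneous {R m} k j a.
Arguments polar_domain {R m} k j _.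
Arguments polar_measure {R m} k j _.

(* Main.v *)
From HB Require Import structures.
Require Import Defs.
From mathcomp Require Import all_boot all_order all_algebra.
From mathcomp Require Import spectral complex.
From mathcomp Require Import all_classical all_reals all_analysis.
From mathcomp Require Import measurable_realfun ring lra.

(* Since [B] is orthogonal to the Bergman space, the left-hand side is the
   integral over the ball of [a z^alpha conj(z^beta)] against the weight.  On
   each block other than [j] the integrand depends on [z_(l)] only through
   [|z_(l)|] and the moduli [|z_(l)i| ^ (2 alpha_(l)i)], while on block [j] it is
   a function of the polar coordinates [|z_(j)|], [s_(j)], [t_(j)]; so it suffices
   to compute the image of [|z^alpha|^2]-weighted Lebesgue measure under
   [z |-> (|z_(1)|, ..., |z_(m)|, s_(j), t_(j))].  After multiplication by a
   Gaussian this image is finite, hence determined by its values on boxes, which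
   factor over the blocks.  On one block, polar coordinates in each complex
   variable and then in the positive orthant produce the radial and angular
   densities, and the angular constants
   [2 pi^k alpha! / (k + |alpha| - 1)!] are read off by comparing the Gaussian
   integral computed in Cartesian and in polar coordinates. *)

Set Implicit Arguments.
Unset Strict Implicit.
Unset Printing Implicit Defensive.

Import Order.TTheory GRing.Theory Num.Theory numFieldNormedType.Exports.

Local Open Scope classical_set_scope.
Local Open Scope ring_scope.

(** No change of variables in several dimensions is invoked: everything reduces to monotone
    substitutions on the line, Tonelli and scaling. Since [sphere_measure] is given in a chart that
    solves for the last coordinate, polar coordinates in the orthant come from trading that
    coordinate for the radius; the factor left over is exactly the density of the chart. The same
    half-space formula over the real line with the absolute value gives the upper half-plane.

    The formulas are proved for nonnegative extended-real integrands, where Tonelli needs no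
    integrability, and the indicators of positive radii, unit vectors and unimodular phases stay
    inside the weights, so that the coordinates can be inverted pointwise. Signs return only at the
    end, through positive and negative parts of real and imaginary parts.

    Origin of the constant: each of the [m - 1] blocks other than [j] is integrated over its angles
    and gives a factor 2, a power [pi ^+ k l] and factorials; these powers of [pi] cancel all but
    [pi ^+ k j] of the [pi ^+ n] in the normalisation of the weight. Block [j] gives no constant,
    its angles being still under the integral. *)

Section density.
Context d (T : measurableType d) (R : realType).
Variables (mu : {sigma_finite_measure set T -> \bar R}) (w : T -> R).
Variables (mw : measurable_fun setT w) (w0 : forall x, 0 <= w x).
Import HBNNSimple.
Local Open Scope ereal_scope.

Let integral_density_indic (A : set T) : measurable A ->
  \int[density_measure mu mw w0]_x (\1_A x)%:E = \int[mu]_x (\1_A x * w x)%:E.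
Proof.
move=> mA; rewrite integral_indic// setIT.
rewrite -[LHS]/(\int[mu]_(x in A) (w x)%:E) integral_mkcond.
apply: eq_integral => x _; rewrite patchE indicE.
by case: ifP => _; rewrite ?mul1r ?mul0r.
Qed.

Let integral_density_nnsfun (g : {nnsfun T >-> R}) :
  \int[density_measure mu mw w0]_x (g x)%:E = \int[mu]_x (g x * w x)%:E.
Proof.
transitivity (\sum_(k \in range g)
    \int[density_measure mu mw w0]_x (k * \1_(g @^-1` [set k]) x)%:E).
  under eq_integral do rewrite fimfunE -fsumEFin//.
  rewrite ge0_integral_fsum//.
  - by move=> y; exact/measurable_EFinP/measurable_funM.
  - by move=> y x _; rewrite nnfun_muleindic_ge0.
transitivity (\sum_(k \in range g)
    \int[mu]_x ((k * \1_(g @^-1` [set k]) x) * w x)%:E); last first.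
  rewrite -ge0_integral_fsum//.
  - apply: eq_integral => x _; rewrite [in RHS]fimfunE EFinM.
    rewrite -fsumEFin// ge0_mule_fsuml//.
    by move=> k; rewrite nnfun_muleindic_ge0.
  - by move=> y; apply/measurable_EFinP/measurable_funM => //; exact: measurable_funM.
  - by move=> y x _; rewrite EFinM mule_ge0 ?nnfun_muleindic_ge0// lee_fin.
apply: eq_fsbigr => r _.
(* A nonnegative simple function has empty preimage over a negative value, so both terms vanish
   there; only [0 <= r] can be pulled out of the integrals. *)
have [r0|r0] := leP 0%R r; last first.
  rewrite preimage_nnfun0//.
  rewrite !integral0_eq// => x _; rewrite indic0 ?mulr0 ?mul0r//.
under eq_integral do rewrite EFinM.
rewrite ge0_integralZl_EFin//; last first.
  exact/measurable_EFinP.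
rewrite integral_density_indic//.
rewrite -ge0_integralZl_EFin//.
- by apply: eq_integral => x _; rewrite -EFinM mulrA.
- by move=> x _; rewrite lee_fin mulr_ge0.
- by apply/measurable_EFinP/measurable_funM.
Qed.

(** Monotone convergence along simple approximations. Multiplying by [w x] preserves the limits
    because [w x] is a finite real. *)
Lemma ge0_integral_density (F : T -> \bar R) : measurable_fun setT F ->
  (forall x, 0 <= F x) ->
  \int[density_measure mu mw w0]_x F x = \int[mu]_x (F x * (w x)%:E).
Proof.
move=> mF F0; pose f_ := nnsfun_approx measurableT mF.
have FE x : F x = limn (EFin \o f_^~ x).
  by apply/esym/cvg_lim => //; exact: cvg_nnsfun_approx.
transitivity (limn (fun n => \int[density_measure mu mw w0]_x (f_ n x)%:E)).
  rewrite -monotone_convergence//.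
  - by apply: eq_integral => x _; exact: FE.
  - by move=> n; exact/measurable_EFinP.
  - by move=> n x _; rewrite lee_fin.
  - by move=> x _ m n mn; rewrite lee_fin; exact/lefP/nd_nnsfun_approx.
under eq_fun do rewrite integral_density_nnsfun.
rewrite -monotone_convergence//.
- apply: eq_integral => x _; apply/cvg_lim => //.
  under eq_fun do rewrite EFinM.
  apply: cvgeZr => //; exact: cvg_nnsfun_approx.
- by move=> n; exact/measurable_EFinP/measurable_funM.
- by move=> n x _; rewrite lee_fin mulr_ge0.
- by move=> x _ m n mn; rewrite lee_fin ler_wpM2r//; exact/lefP/nd_nnsfun_approx.
Qed.

End density.

(** * Iterated integrals over finite product measures *)

Section vec_integral.
Context d (T : measurableType d) (R : realType).
Variable mu : {sigma_finite_measure set T -> \bar R}.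
Local Open Scope ereal_scope.

Lemma vec_integral0 (F : vec T 0 -> \bar R) (x : vec T 0) :
  measurable_fun setT F -> \int[vec_measure mu 0]_v F v = F x.
Proof.
move=> mF; rewrite integral_dirac//= diracT mul1e; congr F.
by apply/matrixP => -[].
Qed.

Lemma vec_integralS n (F : vec T n.+1 -> \bar R) :
  measurable_fun setT F -> (forall x, 0 <= F x) ->
  \int[vec_measure mu n.+1]_v F v =
  \int[mu]_t \int[vec_measure mu n]_v F (vec_cons (t, v)).
Proof.
move=> mF F0.
rewrite (_ : \int[_]_v _ = \int[pushforward (mu \x vec_measure mu n)
    (@vec_cons _ T n)]_v F v)//.
have mc := measurable_vec_cons (T := T) (n := n).
rewrite ge0_integral_pushforward//= preimage_setT fubini_tonelli1//.
exact: measurableT_comp.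
Qed.

(** [vec_measure] peels off the first coordinate whereas [sphere_chart] appends its dependent
    coordinate at the end. The same [insub] test as in [sphere_chart] makes the chart a [vec_snoc]
    by conversion. *)
Definition vec_snoc n (x : vec T n) (y : T) : vec T n.+1 :=
  \col_(i < n.+1) (if insub (val i) is Some i' then (x : 'cV[T]_n) i' ord0
                   else y).

Lemma measurable_vec_snoc n :
  measurable_fun setT (fun p : vec T n * T => vec_snoc p.1 p.2).
Proof.
apply: measurable_vecP => i; under eq_fun do rewrite mxE.
case: insubP => [i' _ _|_]; last exact: measurable_snd.
exact: (measurableT_comp (measurable_coord i') measurable_fst).
Qed.

Lemma vec_cons_snoc n (t : T) (x : vec T n) (y : T) :
  vec_cons (t, vec_snoc x y) = vec_snoc (vec_cons (t, x)) y.
Proof.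
apply/matrixP => i j; rewrite !mxE.
case: (unliftP ord0 i) => [i' ->|->].
  rewrite !mxE /=; case: insubP => [i1 i1n i1E|].
    have H : (bump 0 i' < n.+1)%N by rewrite /bump/= add1n ltnS.
    rewrite (insubT (fun x => x < n.+1)%N H)/= mxE; case: unliftP => [i2|]; last by move/(congr1 val).
    move=> /(congr1 val)/=; rewrite /bump/= !add1n => -[i2E].
    by congr (x _ _); apply: val_inj; rewrite i1E.
  rewrite -leqNgt => i'n; rewrite insubF//= /bump/= add1n ltnS.
  by apply/negbTE; rewrite -leqNgt.
rewrite (insubT (fun x => x < n.+1)%N (ltn0Sn n))/= mxE; by case: unliftP.
Qed.

(** Peeling the first coordinate and appending the last one commute, so induction on [n] suffices
    and no exchange of integrals is needed. *)
Lemma vec_integral_snoc n (F : vec T n.+1 -> \bar R) :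
  measurable_fun setT F -> (forall x, 0 <= F x) ->
  \int[vec_measure mu n.+1]_v F v =
  \int[vec_measure mu n]_x \int[mu]_y F (vec_snoc x y).
Proof.
elim: n F => [|n IH] F mF F0.
  rewrite vec_integralS// (vec_integral0 (const_mx point)).
    apply: eq_integral => t _; rewrite (vec_integral0 (const_mx point)).
      congr F; apply/matrixP => i j; rewrite !mxE (ord1 i) unlift_none.
      by rewrite insubF.
    exact: (measurableT_comp mF (measurableT_comp (measurable_vec_cons (n := 0)) (pair1_measurable t))).
  have mG : measurable_fun setT (fun p : vec T 0 * T => F (vec_snoc p.1 p.2)).
    by apply: measurableT_comp => //; exact: measurable_vec_snoc.
  exact: (measurable_fun_fubini_tonelli_F (m2 := mu) _ mG).
rewrite vec_integralS//.
have mFc : measurable_fun setT (F \o @vec_cons _ T n.+1).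
  by apply: measurableT_comp => //; exact: measurable_vec_cons.
transitivity (\int[mu]_t \int[vec_measure mu n]_x \int[mu]_y
    F (vec_snoc (vec_cons (t, x)) y)).
  apply: eq_integral => t _; rewrite IH//.
    by apply: eq_integral => x _; apply: eq_integral => y _; rewrite vec_cons_snoc.
  exact: (measurableT_comp mFc (pair1_measurable t)).
have mG : measurable_fun setT (fun p : vec T n.+1 * T => F (vec_snoc p.1 p.2)).
  by apply: measurableT_comp => //; exact: measurable_vec_snoc.
rewrite [RHS]vec_integralS//.
- exact: (measurable_fun_fubini_tonelli_F (m2 := mu) _ mG).
- by move=> x; apply: integral_ge0.
Qed.

Lemma measurable_col_mx p q : measurable_fun setT
  (fun x : vec T p * vec T q => col_mx x.1 x.2 : vec T (p + q)).
Proof.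
apply: measurable_vecP => i; under eq_fun do rewrite mxE.
case: fintype.split => i'.
  exact: (measurableT_comp (measurable_coord i') measurable_fst).
exact: (measurableT_comp (measurable_coord i') measurable_snd).
Qed.

Lemma vec_cons_col_mx p q (t : T) (x : vec T p) (y : vec T q) :
  vec_cons (t, col_mx x y : vec T (p + q)) = col_mx (vec_cons (t, x)) y.
Proof.
apply/matrixP => i j; rewrite (ord1 j).
case: (@split_ordP p.+1 q i) => i' ->.
  rewrite [RHS]col_mxEu [LHS]mxE [RHS]mxE.
  case: (unliftP ord0 i') => [i1 ->|->].
    rewrite (_ : @lshift p.+1 q _ = @lift (p + q).+1 ord0 (@lshift p q i1)); last exact: val_inj.
    by rewrite liftK/= col_mxEu.
  rewrite (_ : @lshift p.+1 q _ = @ord0 (p + q)); last exact: val_inj.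
  by rewrite unlift_none.
rewrite [RHS]col_mxEd [LHS]mxE.
rewrite (_ : @rshift p.+1 q _ = @lift (p + q).+1 ord0 (@rshift p q i')); last exact: val_inj.
by rewrite liftK/= col_mxEd.
Qed.

Lemma col_mx_0 q (x : vec T 0) (y : vec T q) :
  col_mx x y = (y : 'cV[T]_(0 + q)).
Proof.
apply/matrixP => i j; rewrite (ord1 j).
rewrite (_ : i = rshift 0 i) ?col_mxEd; last exact: val_inj.
by congr (y _ _); exact: val_inj.
Qed.

Lemma vec_integral_col_mx p q (F : vec T (p + q) -> \bar R) :
  measurable_fun setT F -> (forall x, 0 <= F x) ->
  \int[vec_measure mu (p + q)]_v F v =
  \int[vec_measure mu p]_x \int[vec_measure mu q]_y F (col_mx x y).
Proof.
elim: p F => [|p IH] F mF F0.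
  rewrite (vec_integral0 (const_mx point)).
    by apply: eq_integral => y _; congr F; rewrite col_mx_0.
  have mG : measurable_fun setT
      (fun z : vec T 0 * vec T q => F (col_mx z.1 z.2)).
    exact: (measurableT_comp mF (@measurable_col_mx _ _)).
  exact: (measurable_fun_fubini_tonelli_F (m2 := vec_measure mu q) _ mG).
rewrite [LHS](@vec_integralS (p + q)%N)//.
have mFc : measurable_fun setT (F \o @vec_cons _ T (p + q)%N).
  by apply: measurableT_comp => //; exact: measurable_vec_cons.
transitivity (\int[mu]_t \int[vec_measure mu p]_x \int[vec_measure mu q]_y
    F (col_mx (vec_cons (t, x)) y)).
  apply: eq_integral => t _; rewrite IH//.
    apply: eq_integral => x _; apply: eq_integral => y _.
    by rewrite vec_cons_col_mx.
  exact: (measurableT_comp mFc (pair1_measurable t)).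
have mG : measurable_fun setT
    (fun z : vec T p.+1 * vec T q => F (col_mx z.1 z.2)).
  exact: (measurableT_comp mF (@measurable_col_mx _ _)).
rewrite [RHS]vec_integralS//.
- exact: (measurable_fun_fubini_tonelli_F (m2 := vec_measure mu q) _ mG).
- by move=> x; apply: integral_ge0.
Qed.

End vec_integral.

(** * Change of variables in one real variable *)

Section substitution.
Context {R : realType}.
Notation leb := (@lebesgue_measure R).
Variables (phi dphi : R -> R) (a b : R).
Hypothesis ab : (a < b)%R.
Hypothesis phi_derive : forall x : R, is_derive x (1%R : R) phi (dphi x).
Hypothesis cdphi : continuous dphi.
Hypothesis dphi0 : forall x, a < x <= b -> (0 <= dphi x)%R.
Hypothesis phi_incr : {in `[a, b] &, {homo phi : x y / (x < y)%R}}.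

Let cphi : continuous phi.
Proof.
move=> x; apply: differentiable_continuous; apply/derivable1_diffP.
exact: (@ex_derive _ _ _ _ _ _ _ (phi_derive x)).
Qed.

Let mphi : measurable_fun setT (phi : measurableTypeR R -> measurableTypeR R).
Proof. exact: continuous_measurable_fun. Qed.

Let w (x : measurableTypeR R) : R := (\1_(`]a, b]%classic) x * dphi x)%R.

Let mw : measurable_fun setT w.
Proof.
apply: measurable_funM; first exact: measurable_indic.
exact: continuous_measurable_fun.
Qed.

Let w0 x : (0 <= w x)%R.
Proof.
rewrite /w indicE; case: (boolP (x \in _)) => [|_]; last by rewrite mul0r.
by rewrite inE/= in_itv/= => /dphi0; rewrite mul1r.
Qed.

Let phi_le x y : a <= x -> x <= y -> y <= b -> (phi x <= phi y)%R.
Proof.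
move=> ax; rewrite le_eqVlt => /predU1P[->//|xy] yb.
apply/ltW/phi_incr => //; rewrite in_itv/=.
  by rewrite ax (ltW (lt_le_trans xy yb)).
by rewrite yb (ltW (le_lt_trans ax xy)).
Qed.

Let phi_lt_inv x y : a <= x <= b -> a <= y <= b ->
  (phi x < phi y)%R = (x < y)%R.
Proof.
move=> /andP[ax xb] /andP[ay yb]; apply/idP/idP.
  by apply: contraTT; rewrite -!leNgt => yx; exact: phi_le.
by move=> xy; apply: phi_incr => //; rewrite in_itv/= ?ax ?xb ?ay ?yb.
Qed.

Let integral_dphi c e : a <= c -> c <= e -> e <= b ->
  (\int[leb]_(x in `]c, e]) (dphi x)%:E = (phi e - phi c)%:E)%E.
Proof.
move=> ac; rewrite le_eqVlt => /predU1P[<-|ce] eb.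
  by rewrite subrr set_itvoc0 integral_set0.
rewrite integral_itv_obnd_cbnd; last first.
  apply/measurable_EFinP; apply: measurable_funTS.
  exact: continuous_measurable_fun.
rewrite EFinB; apply: continuous_FTC2 => //.
- exact: continuous_subspaceT.
- split => //.
  + exact/cvg_at_right_filter/cphi.
  + exact/cvg_at_left_filter/cphi.
- by move=> x _; rewrite derive1E derive_val.
Qed.

(** The endpoints of a test interval may lie outside the range of [phi]. Clamped to [[phi a, phi b]]
    they have preimages by the intermediate value theorem, and the part of the test interval inside
    the range becomes []phi c, phi e]]. *)
Let clamp u : exists2 c, a <= c <= b &
  phi c = Num.min (phi b) (Num.max (phi a) u).
Proof.
have pab := phi_le (lexx a) (ltW ab) (lexx b).
have [|c] := IVT (v := Num.min (phi b) (Num.max (phi a) u)) (ltW ab)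
  (continuous_subspaceT cphi).
  by rewrite (min_idPl pab) (max_idPr pab) le_min pab le_max lexx/= ge_min lexx.
by rewrite in_itv/= => cab cE; exists c.
Qed.

Let clamp_lt u y : phi a < y <= phi b ->
  (Num.min (phi b) (Num.max (phi a) u) < y)%R = (u < y).
Proof. by move=> /andP[ay yb]; rewrite gt_min gt_max ltNge yb ay. Qed.

(** Image under [phi] of the measure with density [dphi] on []a, b]]. The substitution formula
    amounts to saying that it is Lebesgue measure on []phi a, phi b]]. *)
Let nu : {measure set (measurableTypeR R) -> \bar R}.
Proof.
unshelve refine (pushforward (density_measure leb mw w0)
  (phi : measurableTypeR R -> measurableTypeR R)
  : {measure set (measurableTypeR R) -> \bar R}).
exact: mphi.
Defined.

Let mE : measurable (`]phi a, phi b]%classic : set (measurableTypeR R)).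
Proof. exact: measurable_itv. Qed.

Let nuE (u v : R) : u <= v -> leb (`]u, v] `&` `]phi a, phi b]) = nu `]u, v]%classic.
Proof.
move=> uv; have [c cab cE] := clamp u; have [e eab eE] := clamp v.
have/andP[ac cb] := cab; have/andP[ae eb] := eab.
have inab x : a < x <= b -> a <= x <= b by case/andP => /ltW-> ->.
have phi_ab x : a < x <= b -> phi a < phi x <= phi b.
  move=> /[dup] xab /andP[ax xb]; rewrite phi_lt_inv ?lexx ?(ltW ab) ?inab// ax.
  by rewrite phi_le// ltW.
have cltE x : a < x <= b -> (u < phi x) = (c < x).
  by move=> xab; rewrite -(clamp_lt u (phi_ab _ xab)) -cE phi_lt_inv// inab.
have eltE x : a < x <= b -> (v < phi x) = (e < x).
  by move=> xab; rewrite -(clamp_lt v (phi_ab _ xab)) -eE phi_lt_inv// inab.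
have ce : c <= e.
  rewrite leNgt -phi_lt_inv// -leNgt cE eE.
  by rewrite le_min ge_min lexx/= ge_min ge_max !le_max lexx uv /= !orbT.
transitivity (leb `]phi c, phi e]%classic).
  congr (leb _); apply/seteqP; split => y /=; rewrite !in_itv/=.
    move=> [/andP[uy yv] yab]; rewrite cE eE clamp_lt// uy leNgt clamp_lt//.
    by rewrite -leNgt.
  rewrite cE eE => /andP[+ yv].
  rewrite gt_min => /orP[/lt_le_trans/(_ yv)|].
    by rewrite lt_min ltxx.
  rewrite gt_max => /andP[ay uy]; rewrite ay uy/=.
  by move: yv; rewrite le_min => /andP[-> +]; rewrite le_max leNgt ay.
transitivity ((phi e - phi c)%:E : \bar R).
  rewrite lebesgue_measure_itv/= lte_fin; case: ltP => // ec.
  by congr (_%:E); apply/eqP; rewrite eq_sym subr_eq0 eq_le ec /= phi_le.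
rewrite /nu /pushforward /density_measure -integral_dphi//.
rewrite integral_mkcond [RHS]integral_mkcond; apply: eq_integral => x _.
rewrite !patchE /w indicE.
have [xab|xab] := boolP (x \in `]a, b]%classic).
  rewrite mul1r; congr (if _ then _ else _).
  move: xab; rewrite inE/= in_itv/= => xab.
  have xE : (u < phi x <= v) = (c < x <= e) by rewrite cltE// !leNgt eltE.
  by apply/idP/idP; rewrite !inE/= !in_itv/= xE.
rewrite mul0r if_same ifF//; apply/negbTE; apply: contra xab.
rewrite !inE/= !in_itv/= => /andP[cx xe].
by rewrite (le_lt_trans ac cx) (le_trans xe eb).
Qed.

(** Lebesgue measure is characterised among measures on the whole line by its values on half-open
    intervals, so [nu] is completed by Lebesgue measure outside []phi a, phi b]] before the
    comparison. *)
Let rest := mrestr leb (measurableC mE).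
Let total : {measure set (measurableTypeR R) -> \bar R} := measure_add rest nu.

Let totalE A : measurable A -> leb A = total A.
Proof.
have H := (lebesgue_measure_unique (mu:=total)). move: H A. apply => _ [[u v] _ <-] /=.
rewrite [RHS]measure_addE /rest /mrestr.
have [vu|uv] := ltP v u.
  by rewrite set_itv_ge ?set0I ?measure0 ?adde0// bnd_simp -leNgt ltW.
rewrite -nuE//.
have := measureDI leb (measurable_itv `]u, v] : measurable (`]u, v]%classic : set (measurableTypeR R))) mE.
by rewrite setDE.
Qed.

(** On []phi a, phi b]] the summand [rest] vanishes, so [nu] and Lebesgue measure agree there.
    Arguing with measures allows a merely measurable [F]. *)
Lemma ge0_integration_by_substitution (F : R -> \bar R) :
  measurable_fun setT F -> (forall x, 0 <= F x)%E ->
  (\int[leb]_(y in `]phi a, phi b]) F y =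
   \int[leb]_(x in `]a, b]) (F (phi x) * (dphi x)%:E))%E.
Proof.
move=> mF F0.
transitivity (\int[nu]_(y in `]phi a, phi b]) F y)%E.
  apply: eq_measure_integral => A mA AE.
  have nuA : total A = nu A.
    have rA : rest A = 0%E.
      rewrite -(measure0 leb); congr (leb _).
      by apply/disjoints_subset; rewrite setCK.
    rewrite [LHS]measure_addE -[RHS]add0e; congr (_ + _)%E; exact: rA.
  exact: etrans (totalE mA) nuA.
rewrite ge0_integral_pushforward//=; last exact: measurable_funTS.
rewrite integral_mkcond ge0_integral_density.
- rewrite [RHS]integral_mkcond; apply: eq_integral => x _.
  rewrite !patchE /w indicE.
  have [xab|xab] := boolP (x \in `]a, b]%classic); last by rewrite mul0r mule0.
  rewrite mul1r mem_set//=; move: xab; rewrite inE/= !in_itv/= => /andP[ax xb].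
  by rewrite phi_lt_inv ?lexx ?(ltW ab) ?(ltW ax)// ax phi_le// ltW.
- apply/(measurable_restrictT _ _).1.
    by rewrite -[X in measurable X]setTI; exact: mphi.
  by apply: measurable_funTS; exact: (measurableT_comp mF mphi).
- by move=> x; rewrite patchE; case: ifP.
Qed.
End substitution.

Lemma integral_set_natr d (T : measurableType d) (R : realType)
    (mu : {measure set T -> \bar R}) (P : pred T) (F : T -> \bar R) :
  (\int[mu]_(x in [set x | P x]) F x = \int[mu]_x (F x * (P x)%:R%:E))%E.
Proof.
rewrite integral_mkcond; apply: eq_integral => x _; rewrite patchE.
case: ifPn => [|/negP]; rewrite inE/=; first by move=> ->; rewrite mule1.
by move=> /negP/negbTE ->; rewrite mule0.
Qed.

Lemma measurable_natr_bool d (T : measurableType d) (R : realType)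
    (f : T -> bool) :
  measurable_fun setT f -> measurable_fun setT (fun x => (f x)%:R : R).
Proof.
move=> mf; rewrite (_ : (fun x => _) = fun x => if f x then 1 else 0 : R).
  by apply: measurable_fun_ifT => //; exact: measurable_cst.
by apply/funext => x; case: (f x).
Qed.

Section substitution_bigcup.
Context {R : realType}.
Notation leb := (@lebesgue_measure R).

(** Exhaustion by increasing intervals and monotone convergence on both sides; this reaches the
    line, half-lines, and bounded images of half-lines. *)
Lemma ge0_integration_by_substitution_bigcup (phi dphi : R -> R)
    (a b : R ^nat) (F : R -> \bar R) :
  (forall x : R, is_derive x (1%R : R) phi (dphi x)) -> continuous dphi ->
  (forall n, a n < b n) -> nonincreasing_seq a -> nondecreasing_seq b ->
  (forall n x, a n < x <= b n -> 0 <= dphi x) ->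
  (forall n, {in `[a n, b n] &, {homo phi : x y / (x < y)%R}}) ->
  measurable_fun setT F -> (forall x, 0 <= F x)%E ->
  (\int[leb]_(y in \bigcup_n `]phi (a n), phi (b n)]%classic) F y =
   \int[leb]_(x in \bigcup_n `]a n, b n]%classic) (F (phi x) * (dphi x)%:E))%E.
Proof.
move=> dp cdp ab na nb dp0 pin mF F0.
have cphi : continuous phi.
  move=> x; apply: differentiable_continuous; apply/derivable1_diffP.
  exact: (@ex_derive _ _ _ _ _ _ _ (dp x)).
have le_phi n x y : a n <= x -> x <= y -> y <= b n -> phi x <= phi y.
  move=> ax; rewrite le_eqVlt => /predU1P[->//|xy] yb.
  apply/ltW/(pin n) => //; rewrite in_itv/=.
    by rewrite ax (ltW (lt_le_trans xy yb)).
  by rewrite yb (ltW (le_lt_trans ax xy)).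
have mFp : measurable_fun setT (fun x => F (phi x) * (dphi x)%:E)%E.
  apply: emeasurable_funM.
    by apply: measurableT_comp => //; exact: continuous_measurable_fun.
  by apply/measurable_EFinP; exact: continuous_measurable_fun.
have cvg1 : (\int[leb]_(y in `]phi (a n), phi (b n)]) F y @[n --> \oo] -->
    \int[leb]_(y in \bigcup_n `]phi (a n), phi (b n)]%classic) F y)%E.
  apply: ge0_nondecreasing_set_cvg_integral => //.
  - move=> n m nm; rewrite subsetEset => y /=; rewrite !in_itv/= => /andP[ay yb].
    have am : a m <= a n by exact: na.
    have bm : b n <= b m by exact: nb.
    rewrite (le_lt_trans _ ay)/=; last first.
      by apply: (le_phi m) => //; exact: le_trans (ltW (ab n)) bm.
    rewrite (le_trans yb)//; apply: (le_phi m) => //.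
    exact: le_trans am (ltW (ab n)).
  - by move=> n; exact: measurable_funTS.
have cvg2 : (\int[leb]_(x in `]a n, b n]) (F (phi x) * (dphi x)%:E)
      @[n --> \oo] -->
    \int[leb]_(x in \bigcup_n `]a n, b n]%classic) (F (phi x) * (dphi x)%:E))%E.
  apply: ge0_nondecreasing_set_cvg_integral => //.
  - move=> n m nm; rewrite subsetEset => y /=; rewrite !in_itv/= => /andP[ay yb].
    by rewrite (le_lt_trans (na _ _ nm) ay) (le_trans yb (nb _ _ nm)).
  - by move=> n; exact: measurable_funTS.
  - move=> n x /=; rewrite in_itv/= => xab.
    by rewrite mule_ge0// lee_fin (dp0 n).
rewrite -(cvg_lim _ cvg1)// -(cvg_lim _ cvg2)//; congr (lim (_ @ \oo)).
apply/funext => n; apply: ge0_integration_by_substitution => //.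
exact: dp0.
Qed.

Lemma ge0_integral_affine (r c : R) (F : R -> \bar R) : 0 < r ->
  measurable_fun setT F -> (forall x, 0 <= F x)%E ->
  (\int[leb]_y F y = r%:E * \int[leb]_x F (r * x + c)%R)%E.
Proof.
move=> r0 mF F0.
have r0' : r != 0 by rewrite gt_eqF.
(* Preimages of [- n.+1] and [n.+1], so that the image intervals exhaust the line. *)
pose a n : R := (- n.+1%:R - c) / r; pose b n : R := (n.+1%:R - c) / r.
have aE n : r * a n + c = - n.+1%:R by rewrite /a; field.
have bE n : r * b n + c = n.+1%:R by rewrite /b; field.
have UT : \bigcup_n `](- n.+1%:R : R), n.+1%:R]%classic = setT.
  apply/seteqP; split => // x _.
  exists (Num.truncn `|x|) => //=; rewrite in_itv/=.
  have xn : `|x| < (Num.truncn `|x|).+1%:R by exact: truncnS_gt.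
  rewrite (le_trans (ler_norm x) (ltW xn)) andbT.
  by rewrite ltrNl; apply: le_lt_trans xn; rewrite -normrN ler_norm.
have dp (x : R) : is_derive x (1%R : R) (fun x => r * x + c) r.
  rewrite (_ : (fun x => _) = (r \*: id + cst c : R -> R))//.
  by apply: is_derive_eq; rewrite addr0 [_ *: _]mulr1.
have := @ge0_integration_by_substitution_bigcup (fun x => r * x + c)
  (fun=> r) a b F dp.
under eq_bigcupr do rewrite aE bE.
rewrite UT (_ : \bigcup_n `]a n, b n]%classic = setT) => [->//|].
- rewrite -ge0_integralZl_EFin ?(ltW r0)//.
  + by apply: eq_integral => x _; rewrite muleC.
  + apply: measurableT_comp => //; apply: measurable_funD => //.
- by move=> x; exact: cvg_cst.
- move=> n; rewrite /a /b ltr_pM2r ?invr_gt0// ltrD2r.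
  by rewrite (@lt_trans _ _ 0)// ?oppr_lt0 ltr0n.
- move=> n m nm; rewrite /a ler_pM2r ?invr_gt0// lerD2r lerN2 ler_nat ltnS.
  exact: nm.
- by move=> n m nm; rewrite /b ler_pM2r ?invr_gt0// lerD2r ler_nat ltnS.
- by move=> *; exact: ltW.
- by move=> n x y _ _ xy; rewrite ltrD2r ltr_pM2l.
- rewrite -subTset -UT => x _; have : (\bigcup_n `](- n.+1%:R : R), n.+1%:R]%classic) (r * x + c) by rewrite UT.
  move=> [n _ /=]; rewrite !in_itv/= -aE -bE ltrD2r lerD2r ltr_pM2l// ler_pM2l//.
  by exists n.
Qed.

Lemma ge0_integral_sqr (F : R -> \bar R) :
  measurable_fun setT F -> (forall x, 0 <= F x)%E ->
  (\int[leb]_y (F y * (0 < y)%R%:R%:E) =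
   \int[leb]_x (F (x ^+ 2)%R * ((0 < x)%R%:R * (2 * x))%:E))%E.
Proof.
move=> mF F0.
have dp (x : R) : is_derive x (1%R : R) (fun x => x ^+ 2) (2 * x).
  rewrite (_ : (fun x => _) = (id ^+ 2 : R -> R))//.
  by apply: is_derive_eq; rewrite expr1 [_ *: _]mulr1.
have := @ge0_integration_by_substitution_bigcup (fun x => x ^+ 2)
  (fun x => 2 * x) (fun=> 0) (fun n => n.+1%:R) F dp.
have U (b : R ^nat) : (forall n, n%:R <= b n) ->
    \bigcup_n `]0, b n]%classic = [set x | 0 < x].
  move=> nb; apply/seteqP; split => x /=.
    by move=> [n _]/=; rewrite in_itv/= => /andP[].
  move=> x0; exists (Num.truncn x).+1 => //=; rewrite in_itv/= x0/=.
  by rewrite (le_trans _ (nb _))// ltW// truncnS_gt.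
rewrite expr0n/= !U.
- rewrite !integral_set_natr => ->//.
  + by apply: eq_integral => x _; rewrite -muleA -EFinM [_ * (0 < x)%R%:R]mulrC.
  + by move=> x; apply: cvgM; [exact: cvg_cst|exact: cvg_id].
  + by move=> n m nm; rewrite ler_nat.
  + by move=> n x /andP[x0 _]; rewrite mulr_ge0// ltW.
  + move=> n x y; rewrite !in_itv/= => /andP[x0 _] /andP[y0 _] xy.
    by rewrite ltrXn2r.
- by move=> n; rewrite ler_nat.
- by move=> n; rewrite -natrX ler_nat (leq_trans (leqnSn _))// leq_pmulr.
Qed.

End substitution_bigcup.

(** [powR] inverts nonnegative reals only, hence the detour through [x * (x ^+ 2)^-1], which is also
    right at 0 because [0^-1 = 0]. *)
Lemma measurable_funV d (T : measurableType d) (R : realType) (f : T -> R) :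
  measurable_fun setT f -> measurable_fun setT (fun x => (f x)^-1).
Proof.
move=> mf; rewrite (_ : (fun x => _) = fun x => f x * (f x ^+ 2) `^ (-1)).
  apply: measurable_funM => //.
  exact: (measurableT_comp (measurable_powR _) (measurable_funX 2 mf)).
apply/funext => x; rewrite powR_inv1 ?sqr_ge0//.
have [->|fx0] := eqVneq (f x) 0; first by rewrite invr0 mul0r.
by field.
Qed.

Section substitution_instances.
Context {R : realType}.
Notation leb := (@lebesgue_measure R).

(** The substitution [y = sqrt (r^2 - c^2)] is not differentiable at [r = c]. It is therefore
    composed of three harmless ones: [u = y^2], a translation by [c^2], and [v = r^2]. *)
Lemma ge0_integral_sqrt_shift (c : R) (F : R -> \bar R) : 0 <= c ->
  measurable_fun setT F -> (forall x, 0 <= F x)%E ->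
  (\int[leb]_y (F y * (0 < y)%R%:R%:E) =
   \int[leb]_r (F (Num.sqrt (r ^+ 2 - c ^+ 2))%R *
     ((c < r)%R%:R * (r / Num.sqrt (r ^+ 2 - c ^+ 2)))%:E))%E.
Proof.
move=> c0 mF F0.
(* Chosen so that [H (x ^+ 2)] times the Jacobian [2 * x] is [F x] for positive [x]. *)
pose H (u : R) := (F (Num.sqrt u) * ((0 < u)%R%:R * (2 * Num.sqrt u)^-1)%:E)%E.
have mH : measurable_fun setT H.
  apply: emeasurable_funM; first exact: measurableT_comp measurable_sqrt.
  apply/measurable_EFinP/measurable_funM.
    by apply: measurable_natr_bool; exact: measurable_fun_ltr.
  by apply: measurable_funV; apply: measurable_funM => //; exact: measurable_sqrt.
have H0 u : (0 <= H u)%E by rewrite mule_ge0// lee_fin mulr_ge0// invr_ge0 mulr_ge0 ?sqrtr_ge0.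
have HE u : (H u * (0 < u)%R%:R%:E = H u)%E.
  by rewrite /H -muleA -EFinM; case: (0 < u)%R; rewrite /= ?mulr1 // !mul0r.
transitivity (\int[leb]_u H u)%E.
  under [RHS]eq_integral do rewrite -HE.
  rewrite [RHS]ge0_integral_sqr//; apply: eq_integral => x _.
  rewrite /H -muleA -EFinM.
  have [x0|x0] := ltP 0 x; last by rewrite /= mul0r mulr0 !mule0.
  rewrite /= sqrtr_sqr gtr0_norm// exprn_gt0// !mul1r mulVf//.
  by rewrite mulf_neq0 ?pnatr_eq0 ?gt_eqF.
rewrite (@ge0_integral_affine _ 1 (- c ^+ 2))// mul1e.
have mK : measurable_fun setT (fun v : R => H (1 * v - c ^+ 2)).
  by apply: measurableT_comp => //; exact: measurable_funB.
(* [H] vanishes at nonpositive arguments, and [v <= 0] forces [v - c ^+ 2 <= 0]. The indicator of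
   [0 < v] can thus be inserted freely, which makes [v = r ^+ 2] applicable. *)
transitivity (\int[leb]_v (H (1 * v - c ^+ 2)%R * (0 < v)%R%:R%:E))%E.
  apply: eq_integral => v _; have [v0|v0] := ltP 0 v; first by rewrite mule1.
  rewrite -HE mul1r (_ : (0 < v - c ^+ 2) = false) ?mule0//.
  by apply/negbTE; rewrite -leNgt subr_le0 (le_trans v0)// sqr_ge0.
rewrite [LHS]ge0_integral_sqr//; apply: eq_integral => r _.
rewrite mul1r /H -muleA -EFinM; congr (_ * _%:E)%E.
have [r0|r0] := ltP 0 r; last first.
  by rewrite /= mul0r mulr0 ltNge (le_trans r0 c0) mul0r.
rewrite mul1r subr_gt0 ltr_pXn2r ?nnegrE ?(ltW r0)//.
rewrite -mulrA; congr (_ * _).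
have [s0|s0] := eqVneq (Num.sqrt (r ^+ 2 - c ^+ 2)) 0.
  by rewrite s0 mulr0 !invr0 mul0r mulr0.
by field.
Qed.

(** The sign makes the substitution increasing on [[0, pi]]; its Jacobian [sin t] cancels the square
    root of [1 - cos t ^+ 2]. *)
Lemma ge0_integral_Ncos (F : R -> \bar R) :
  measurable_fun setT F -> (forall x, 0 <= F x)%E ->
  (\int[leb]_x (F x * ((`|x| < 1)%R%:R / Num.sqrt (1 - x ^+ 2))%:E) =
   \int[leb]_t (F (- cos t)%R * (0 < t < pi)%R%:R%:E))%E.
Proof.
move=> mF F0.
pose G x := (F x * ((Num.sqrt (1 - x ^+ 2))^-1)%:E)%E.
have mG : measurable_fun setT G.
  apply: emeasurable_funM => //; apply/measurable_EFinP.
  apply: measurable_funV; apply: (measurableT_comp measurable_sqrt).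
  by apply: measurable_funB => //; exact: measurable_funX.
have G0 x : (0 <= G x)%E by rewrite mule_ge0// lee_fin invr_ge0 sqrtr_ge0.
have dp (x : R) : is_derive x (1%R : R) (fun x => - cos x) (sin x).
  by apply: is_derive_eq; rewrite opprK.
have := @ge0_integration_by_substitution _ (fun x => - cos x) (@sin R) 0 pi
  (pi_gt0 R) dp (@continuous_sin R).
have sin0pi (x : R) : 0 < x <= pi -> 0 <= sin x.
  by move=> /andP[x0 xp]; apply: sin_ge0_pi; rewrite (ltW x0).
have incr : {in `[0, pi] &, {homo (fun x : R => - cos x) : x y / x < y}}.
  move=> x y; rewrite !in_itv/= => xI yI xy; rewrite ltrN2.
  by rewrite ltr_cos// in_itv.
move=> /(_ sin0pi incr G mG G0); rewrite cos0 cospi opprK.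
move=> H; transitivity (\int[leb]_(x in `](- 1)%R, 1%R]) G x)%E.
  rewrite [RHS]integral_mkcond; apply: eq_integral => x _; rewrite patchE /G.
  have [xI|] := boolP (x \in `](-1), 1]%classic).
    move: xI; rewrite inE/= in_itv/= => /andP[x0 x1].
    (* The only point of []-1, 1]] with modulus at least 1 is [x = 1], where the inverse of [sqrt 0]
       is 0 by convention. *)
    have [x1'|x1'] := ltP `|x| 1; first by rewrite mul1r.
    have -> : x = 1.
      apply/eqP; rewrite eq_le x1/=; move: x1'; rewrite ler_normr => /orP[//|].
      by rewrite lerNr leNgt x0.
    by rewrite expr1n subrr sqrtr0 invr0 mulr0 .
  rewrite notin_setE/= in_itv/= => /negP xI.
  rewrite (_ : (`|x| < 1) = false) ?mul0r ?mule0//.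
  apply/negbTE; apply: contra xI; rewrite ltr_norml => /andP[-> /ltW->]//.
rewrite H [LHS]integral_mkcond; apply: eq_integral => t _; rewrite patchE.
have [tI|] := boolP (t \in `]0, pi]%classic).
  move: tI; rewrite inE/= in_itv/= => /andP[t0 tp].
  rewrite t0/= /G; move: tp; rewrite le_eqVlt => /predU1P[->|tp].
    by rewrite ltxx sinpi mule0 mule0.
  have st : 0 < sin t by apply: sin_gt0_pi; rewrite t0.
  rewrite tp sqrrN -sin2cos2 sqrtr_sqr gtr0_norm// -muleA -EFinM.
  by rewrite mulVf// gt_eqF.
rewrite notin_setE/= in_itv/= => /negP tI.
rewrite (_ : (0 < t < pi) = false) ?mule0//.
by apply/negbTE; apply: contra tI => /andP[-> /ltW->].
Qed.

End substitution_instances.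

(** * Polar coordinates over a half-space, for an abstract base with a norm and dilations *)

Section polar_half_space.
Context d (X : measurableType d) (R : realType).
Notation leb := (@lebesgue_measure R).
Variables (mu : {sigma_finite_measure set X -> \bar R}) (n : nat).
Variables (N : X -> R) (scale : R -> X -> X).
Hypothesis mN : measurable_fun setT N.
Hypothesis N0 : forall x, 0 <= N x.
Hypothesis mscale : measurable_fun setT
  (fun p : measurableTypeR R * X => scale p.1 p.2).
Hypothesis N_scale : forall r x, 0 < r -> N (scale r x) = r * N x.
Hypothesis integral_scale : forall r (F : X -> \bar R), 0 < r ->
  measurable_fun setT F -> (forall x, 0 <= F x)%E ->
  (\int[mu]_x F x = (r ^+ n)%:E * \int[mu]_x F (scale r x))%E.

(* The last coordinate [y] is traded for the radius [r = sqrt (y^2 + |x|^2)],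
   then [x] is rescaled by [r]. *)
Lemma ge0_integral_polar_half (F : X * measurableTypeR R -> \bar R) :
  measurable_fun setT F -> (forall x, 0 <= F x)%E ->
  (\int[mu]_x \int[leb]_y (F (x, y) * (0 < y)%R%:R%:E) =
   \int[leb]_r \int[mu]_x (F (scale r x, r * Num.sqrt (1 - N x ^+ 2))%R *
     ((0 < r)%R%:R * r ^+ n *
       ((N x < 1)%R%:R / Num.sqrt (1 - N x ^+ 2)))%:E))%E.
Proof.
(* For fixed [x] the height is replaced by the radius; Tonelli then puts the radius outside, and for
   a fixed positive radius the dilation of the base applies. Both sides vanish for [r <= 0] since
   [N] is nonnegative. *)
move=> mF F0.
pose G (p : X * measurableTypeR R) :=
  (F (p.1, Num.sqrt (p.2 ^+ 2 - N p.1 ^+ 2)) *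
     ((N p.1 < p.2)%R%:R * (p.2 / Num.sqrt (p.2 ^+ 2 - N p.1 ^+ 2)))%:E)%E.
have mN1 : measurable_fun setT (fun p : X * measurableTypeR R => N p.1).
  exact: measurableT_comp measurable_fst.
have ms : measurable_fun setT
    (fun p : X * measurableTypeR R => Num.sqrt (p.2 ^+ 2 - N p.1 ^+ 2)).
  apply: (measurableT_comp measurable_sqrt).
  by apply: measurable_funB; apply: measurable_funX.
have mG : measurable_fun setT G.
  apply: emeasurable_funM.
    apply: (measurableT_comp mF).
    by apply/measurable_fun_pairP; split; [exact: measurable_fst|exact: ms].
  apply/measurable_EFinP/measurable_funM.
    by apply: measurable_natr_bool; exact: measurable_fun_ltr.
  by apply: measurable_funM => //; exact: measurable_funV.
have G0 p : (0 <= G p)%E.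
  rewrite /G mule_ge0// lee_fin; have [Np|_] := ltP; last by rewrite mul0r.
  by rewrite mulr_ge0// divr_ge0 ?sqrtr_ge0// (le_trans (N0 p.1))// ltW.
transitivity (\int[mu]_x \int[leb]_r G (x, r))%E.
  apply: eq_integral => x _.
  rewrite (ge0_integral_sqrt_shift (N0 x) (F := fun y => F (x, y)))//.
  exact: (measurableT_comp mF (pair1_measurable x)).
rewrite (fubini_tonelli G mG G0); apply: eq_integral => r _.
have [r0|r0] := ltP 0 r; last first.
  rewrite !integral0_eq// => x _; first by rewrite /= !mul0r mule0.
  by rewrite /G/= ltNge (le_trans r0)//= mul0r mule0.
rewrite (integral_scale r0)//; last first.
  exact: (measurableT_comp mG (pair2_measurable r)).
rewrite -ge0_integralZl_EFin ?exprn_ge0 ?(ltW r0)//; last first.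
  apply: (measurableT_comp mG).
  apply/measurable_fun_pairP; split; last exact: measurable_cst.
  exact: (measurableT_comp mscale (pair1_measurable r)).
apply: eq_integral => x _; rewrite /G/= N_scale//.
have -> : r ^+ 2 - (r * N x) ^+ 2 = r ^+ 2 * (1 - N x ^+ 2) by ring.
rewrite sqrtrM ?sqr_ge0// sqrtr_sqr gtr0_norm//.
rewrite muleCA -EFinM; congr (_ * _%:E)%E.
rewrite mul1r; congr (_ * _).
rewrite -[X in _ < X]mulr1 ltr_pM2l//; congr (_ * _).
by rewrite invfM mulrA divff ?gt_eqF// mul1r.
Qed.

End polar_half_space.

Section vec_scale.
Context {R : realType}.

Lemma vec_integral_scale n (r : R) (F : vec (measurableTypeR R) n -> \bar R) :
  0 < r -> measurable_fun setT F -> (forall x, 0 <= F x)%E ->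
  (\int[lebesgueR n]_x F x = (r ^+ n)%:E *
   \int[lebesgueR n]_x F (r *: (x : 'cV[R]_n)))%E.
Proof.
have mZ k : measurable_fun setT (fun x : vec (measurableTypeR R) k =>
    r *: (x : 'cV[R]_k) : vec (measurableTypeR R) k).
  apply: measurable_vecP => i; under eq_fun do rewrite mxE.
  by apply: measurable_funM => //; exact: measurable_coord.
move=> r0; elim: n F => [|n IH] F mF F0.
  rewrite expr0 mul1e !(@vec_integral0 _ _ _ _ _ (const_mx point))//.
    by congr F; apply/matrixP => -[].
  exact: (measurableT_comp mF (mZ 0)).
have mFZ := measurableT_comp mF (mZ n.+1).
have mc := measurable_vec_cons (T := measurableTypeR R) (n := n).
rewrite /lebesgueR !vec_integralS//.
have consZ (t : R) (v : 'cV[R]_n) :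
    r *: (vec_cons (t, v : vec (measurableTypeR R) n) : 'cV[R]_n.+1) =
    vec_cons (r * t, r *: v : vec (measurableTypeR R) n) :> 'cV[R]_n.+1.
  by apply/matrixP => i i1; rewrite !mxE; case: unliftP => [i'|]; rewrite //= mxE.
transitivity (\int[lebesgue_measure]_t ((r ^+ n)%:E *
    \int[vec_measure lebesgue_measure n]_v
      F (vec_cons (t, r *: (v : 'cV[R]_n) : vec (measurableTypeR R) n))))%E.
  apply: eq_integral => t _; apply: IH => //.
  exact: (measurableT_comp mF (measurableT_comp mc (pair1_measurable t))).
pose H (p : measurableTypeR R * vec (measurableTypeR R) n) :=
  F (vec_cons (p.1, r *: (p.2 : 'cV[R]_n) : vec (measurableTypeR R) n)).
have mH : measurable_fun setT H.
  apply: (measurableT_comp mF); apply: (measurableT_comp mc).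
  apply/measurable_fun_pairP; split; first exact: measurable_fst.
  exact: (measurableT_comp (mZ n) measurable_snd).
have mI := measurable_fun_fubini_tonelli_F (m2 := vec_measure lebesgue_measure n) H mH (fun=> F0 _).
have I0 x : (0 <= \int[vec_measure lebesgue_measure n]_v H (x, v))%E.
  by apply: integral_ge0 => v _; exact: F0.
rewrite ge0_integralZl_EFin ?exprn_ge0 ?(ltW r0)//; last by move=> t _; exact: I0.
rewrite (@ge0_integral_affine _ r 0 _ r0 mI)//.
rewrite muleA -EFinM -exprSr; congr (_ * _)%E.
apply: eq_integral => t _; apply: eq_integral => v _.
rewrite addr0; congr F; exact: (esym (consZ t v)).
Qed.

End vec_scale.

Local Open Scope complex_scope.

(** * Polar coordinates in the complex plane *)

Section complex_measurable_fun.
Context {R : realType}.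

Lemma measurable_Re :
  measurable_fun setT (@complex.Re R : R[i] -> measurableTypeR R).
Proof. exact: (measurableT_comp measurable_fst measurable_cpair). Qed.

Lemma measurable_Im :
  measurable_fun setT (@complex.Im R : R[i] -> measurableTypeR R).
Proof. exact: (measurableT_comp measurable_snd measurable_cpair). Qed.

Context d (T : measurableType d).
Implicit Types (D : set T) (f g : T -> R[i]).

Lemma measurable_ReT D f : measurable_fun D f ->
  measurable_fun D (fun x => complex.Re (f x)).
Proof. exact: measurableT_comp measurable_Re. Qed.

Lemma measurable_ImT D f : measurable_fun D f ->
  measurable_fun D (fun x => complex.Im (f x)).
Proof. exact: measurableT_comp measurable_Im. Qed.

Lemma measurable_funC D f :
  measurable_fun D (fun x => complex.Re (f x)) ->
  measurable_fun D (fun x => complex.Im (f x)) -> measurable_fun D f.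
Proof.
have mT f' : measurable_fun setT (fun x => complex.Re (f' x)) ->
    measurable_fun setT (fun x => complex.Im (f' x)) -> measurable_fun setT f'.
  move=> mr mi.
  rewrite (_ : f' = fun x => pairc (complex.Re (f' x), complex.Im (f' x))).
    apply: (measurableT_comp measurable_pairc).
    exact: (measurable_fun_pair (T1 := measurableTypeR R)
      (T2 := measurableTypeR R)).
  by apply/funext => x; case: (f' x).
move=> mr mi mD; suff: measurable_fun D f by exact.
apply/(measurable_restrictT _ mD)/mT.
- rewrite (_ : (fun x => _) = (fun x => complex.Re (f x)) \_ D).
    exact/(measurable_restrictT _ mD).
  by apply/funext => x; rewrite !patchE; case: ifP.
- rewrite (_ : (fun x => _) = (fun x => complex.Im (f x)) \_ D).
    exact/(measurable_restrictT _ mD).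
  by apply/funext => x; rewrite !patchE; case: ifP.
Qed.

Lemma measurable_funM_complex D f g : measurable_fun D f ->
  measurable_fun D g -> measurable_fun D (fun x => f x * g x).
Proof.
move=> mf mg; have [mfr mfi mgr mgi] := And4 (measurable_ReT mf)
  (measurable_ImT mf) (measurable_ReT mg) (measurable_ImT mg).
apply: measurable_funC.
- rewrite (_ : (fun x => _) = fun x => complex.Re (f x) * complex.Re (g x) -
      complex.Im (f x) * complex.Im (g x)).
    by apply: measurable_funB; exact: measurable_funM.
  by apply/funext => x; case: (f x); case: (g x).
- rewrite (_ : (fun x => _) = fun x => complex.Re (f x) * complex.Im (g x) +
      complex.Im (f x) * complex.Re (g x)).
    by apply: measurable_funD; exact: measurable_funM.
  by apply/funext => x; case: (f x); case: (g x).
Qed.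

Lemma measurable_conj D f : measurable_fun D f ->
  measurable_fun D (fun x => (f x)^*).
Proof.
move=> mf; apply: measurable_funC.
- rewrite (_ : (fun x => _) = fun x => complex.Re (f x)).
    exact: measurable_ReT.
  by apply/funext => x; case: (f x).
- rewrite (_ : (fun x => _) = fun x => - complex.Im (f x)).
    exact/measurable_funN/measurable_ImT.
  by apply/funext => x; case: (f x).
Qed.

Lemma measurable_real_complex D (f : T -> R) : measurable_fun D f ->
  measurable_fun D (fun x => (f x)%:C).
Proof.
move=> mf; apply: measurable_funC; first exact: mf.
exact: measurable_cst.
Qed.

Lemma measurable_funX_complex D f n : measurable_fun D f ->
  measurable_fun D (fun x => f x ^+ n).
Proof.
move=> mf; elim: n => [|n IH].
  by under eq_fun do rewrite expr0; exact: measurable_cst.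
by under eq_fun do rewrite exprS; exact: measurable_funM_complex.
Qed.

Lemma measurable_prod_complex D (I : Type) (s : seq I) (f : I -> T -> R[i]) :
  (forall i, measurable_fun D (f i)) ->
  measurable_fun D (fun x => \prod_(i <- s) f i x).
Proof.
move=> mf; elim: s => [|i s IH].
  by under eq_fun do rewrite big_nil; exact: measurable_cst.
by under eq_fun do rewrite big_cons; exact: measurable_funM_complex.
Qed.

Lemma measurable_normc f : measurable_fun setT f ->
  measurable_fun setT (fun x => Normc.normc (f x)).
Proof.
move=> mf; rewrite (_ : (fun x => _) = fun x =>
    Num.sqrt (complex.Re (f x) ^+ 2 + complex.Im (f x) ^+ 2)).
  apply: (measurableT_comp measurable_sqrt).
  by apply: measurable_funD; apply: measurable_funX;
    [exact: measurable_ReT|exact: measurable_ImT].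
by apply/funext => x; case: (f x).
Qed.

End complex_measurable_fun.

Lemma ge0_integral_mrestr d (T : measurableType d) (R : realType)
    (mu : {sigma_finite_measure set T -> \bar R}) (P : pred T)
    (mP : measurable [set x | P x]) (F : T -> \bar R) :
  measurable_fun setT F -> (forall x, 0 <= F x)%E ->
  (\int[mrestr mu mP]_x F x = \int[mu]_x (F x * (P x)%:R%:E))%E.
Proof.
move=> mF F0.
have mw : measurable_fun setT (fun x => (P x)%:R : R).
  apply: measurable_natr_bool; apply: (measurable_fun_bool true).
  by rewrite setTI (_ : _ @^-1` _ = [set x | P x]).
have w0 x : 0 <= (P x)%:R :> R by [].
rewrite -(ge0_integral_density mu mw w0)//.
apply: eq_measure_integral => A mA _.
rewrite /density_measure.
transitivity (\int[mu]_(x in A) (\1_[set x | P x] x)%:E)%E.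
  by rewrite integral_indic// setIC.
apply: eq_integral => x _; rewrite indicE (_ : x \in _ = P x)//.
by apply/idP/idP; rewrite inE.
Qed.

Lemma integral_itv_natr (R : realType) (mu : {measure set (measurableTypeR R) -> \bar R})
    (i : interval R) (F : R -> \bar R) :
  (\int[mu]_(t in [set` i]) F t = \int[mu]_t (F t * (t \in i)%:R%:E))%E.
Proof. exact: integral_set_natr. Qed.

Lemma measurable_in_itv (R : realType) (i : interval R) :
  measurable_fun setT (fun t : measurableTypeR R => (t \in i)%:R : R).
Proof.
apply: measurable_natr_bool; apply: (measurable_fun_bool true).
rewrite setTI (_ : _ @^-1` _ = [set` i]); first exact: measurable_itv.
by [].
Qed.

Section circle.
Context {R : realType}.
Notation leb := (@lebesgue_measure R).

Definition circle_measure : {sigma_finite_measure set R[i] -> \bar R} :=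
  image_measure (@measurable_expi R) (@expi_sigma_finite R).

Lemma expiDpi (t : R) : expi (t + pi) = - expi t.
Proof. by rewrite /expi cosDpi sinDpi. Qed.

(** Cutting [[0, 2 * pi[] at [pi] and translating the second half pairs each point with its
    antipode. This is the shape in which the half-plane formula, with angles in []0, pi[], can be
    matched. *)
Lemma ge0_integral_circle (F : R[i] -> \bar R) :
  measurable_fun setT F -> (forall x, 0 <= F x)%E ->
  (\int[circle_measure]_t F t =
   \int[leb]_t ((F (expi t) + F (- expi t)%R) * (0 < t < pi)%R%:R%:E))%E.
Proof.
move=> mF F0.
have me := @measurable_expi R.
have mFe : measurable_fun setT (fun t : R => F (expi t)).
  exact: (measurableT_comp mF me).
have mFN : measurable_fun setT (fun t : R => F (- expi t)%R).
  under eq_fun do rewrite -expiDpi.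
  by apply: (measurableT_comp mFe); exact: measurable_funD.
rewrite (_ : \int[_]_t _ = \int[pushforward (@arc_length R) (@expi R)]_t F t)%E//.
rewrite ge0_integral_pushforward//= preimage_setT.
rewrite (_ : \int[_]_t _ = \int[leb]_(t in `[0%R, (2 * pi)%R[) F (expi t))%E; last first.
  have mP : measurable [set t : measurableTypeR R | t \in `[0, 2 * pi[].
    exact: measurable_itv.
  rewrite integral_itv_natr.
  by rewrite -(@ge0_integral_mrestr _ _ _ _ _ mP).
have pi0 := pi_gt0 R.
have pi2 : pi <= 2 * pi :> R by rewrite ler_peMl ?(ltW pi0)// ler1n.
rewrite (_ : `[0, 2 * pi[%classic = `[0, pi[ `|` `[pi, 2 * pi[); last first.
  apply/seteqP; split => t /=; rewrite !in_itv/=.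
    move=> /andP[t0 tp]; have [t1|t1] := ltP t pi; first by left; rewrite t0.
    by right; rewrite tp.
  move=> [/andP[-> /lt_le_trans->//]|/andP[pt ->]].
  by rewrite (le_trans _ pt) ?ltW.
rewrite ge0_integral_setU//=; last 2 first.
- exact: measurable_funTS.
- rewrite disj_set2E; apply/eqP/seteqP; split => // t /=; rewrite !in_itv/=.
  by move=> [/andP[_ t1] /andP[]]; rewrite leNgt t1.
(* Left endpoints are null. With both intervals open, translation by [pi] carries []0, pi[] onto
   []pi, 2 * pi[]. *)
rewrite -!integral_itv_obnd_cbnd; try exact: measurable_funTS.
rewrite !integral_itv_natr.
have mA (H : R -> \bar R) (i : interval R) : measurable_fun setT H ->
    measurable_fun setT (fun t => H t * (t \in i)%:R%:E)%E.
  move=> mH; apply: emeasurable_funM; first exact: mH.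
  apply/measurable_EFinP; exact: measurable_in_itv.
rewrite [X in (_ + X)%E](@ge0_integral_affine _ 1 pi)//; [|exact: mA|by move=> x; rewrite mule_ge0].
have shiftE (t : R) : (1 * t + pi \in `]pi, (2 * pi)%R[) = (t \in `]0, pi[).
  by rewrite !in_itv/= mul1r ltrDr (mulr_natl pi 2) mulr2n ltrD2r.
under [X in (_ + 1 * X)%E]eq_integral do rewrite mul1r expiDpi -[X in X + pi]mul1r shiftE.
rewrite mul1e -ge0_integralD//; try exact: mA; try by move=> x _; rewrite mule_ge0.
apply: eq_integral => t _; rewrite !in_itv/=.
by rewrite ge0_muleDl.
Qed.

End circle.

Section polar_complex.
Context {R : realType}.
Notation leb := (@lebesgue_measure R).

Definition lebesgue_complex : {sigma_finite_measure set R[i] -> \bar R} :=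
  image_measure (@measurable_pairc R) (@pairc_sigma_finite R).

Lemma ge0_integral_opp (F : R -> \bar R) :
  measurable_fun setT F -> (forall x, 0 <= F x)%E ->
  (\int[leb]_x F x = \int[leb]_x F (- x)%R)%E.
Proof.
move=> mF F0.
have mN : measurable_fun setT (-%R : _ -> measurableTypeR R).
  exact: (@oppr_measurable R setT).
have /= <- := @ge0_integral_pushforward _ _ _ _ R
  (-%R : measurableTypeR R -> measurableTypeR R) mN leb setT F measurableT mF
  (fun y _ => F0 y).
by apply: eq_measure_integral => A mA _; exact/esym/lebesgue_measureN.
Qed.

Lemma ge0_integral_half_lines (F : R -> \bar R) :
  measurable_fun setT F -> (forall x, 0 <= F x)%E ->
  (\int[leb]_y F y = \int[leb]_y ((F y + F (- y)%R) * (0 < y)%R%:R%:E))%E.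
Proof.
move=> mF F0.
have m0 : measurable_fun setT (fun y : measurableTypeR R => (0 < y)%R%:R%:E : \bar R).
  apply/measurable_EFinP/measurable_natr_bool.
  by apply: measurable_fun_ltr => //; exact: measurable_cst.
have m1 : measurable_fun setT (fun y : measurableTypeR R => (y < 0)%R%:R%:E : \bar R).
  apply/measurable_EFinP/measurable_natr_bool.
  by apply: measurable_fun_ltr => //; exact: measurable_cst.
have mFN : measurable_fun setT (fun y : measurableTypeR R => F (- y)%R).
  exact: (measurableT_comp mF (@oppr_measurable R setT)).
under [RHS]eq_integral do rewrite ge0_muleDl//.
rewrite [RHS]ge0_integralD//; try by [exact: emeasurable_funM|
  move=> ? _; rewrite mule_ge0].
have -> : (\int[leb]_x (F (- x)%R * (0 < x)%R%:R%:E) =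
    \int[leb]_x (F x * (x < 0)%R%:R%:E))%E.
  rewrite [RHS]ge0_integral_opp.
  - by apply: eq_integral => x _; rewrite oppr_lt0.
  - exact: emeasurable_funM.
  - by move=> x; rewrite mule_ge0.
rewrite -ge0_integralD//; try by [exact: emeasurable_funM|
  move=> ? _; rewrite mule_ge0].
apply: ge0_ae_eq_integral => //.
- by apply: emeasurable_funD; exact: emeasurable_funM.
- by move=> x _; rewrite adde_ge0// mule_ge0.
- exists [set 0]; split; [exact: measurable_set1|exact: lebesgue_measure_set1|].
  move=> y /= /not_implyP[_ Fy]; apply: contrapT => y0; apply: Fy.
  have [y1|y1|y1] := ltgtP 0 y; last by case: y0.
  + by rewrite mule1 mule0 adde0.
  + by rewrite mule1 mule0 add0e.
Qed.

(** The half-space formula with base the real line: [N] is the absolute value and the dilation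
    exponent is 1. The remaining chord variable in []-1, 1[] then becomes an angle through
    [ge0_integral_Ncos]. *)
Lemma ge0_integral_upper_half_plane (H : R[i] -> \bar R) :
  measurable_fun setT H -> (forall x, 0 <= H x)%E ->
  (\int[leb]_x \int[leb]_y (H (x +i* y) * (0 < y)%R%:R%:E) =
   \int[leb]_r \int[leb]_t (H (r%:C * expi t)%R *
     ((0 < r)%R%:R * r * (0 < t < pi)%R%:R)%:E))%E.
Proof.
move=> mH H0.
have mHp : measurable_fun setT (fun p : measurableTypeR R * measurableTypeR R =>
    H (p.1 +i* p.2)).
  exact: (measurableT_comp mH measurable_pairc).
have mpos : measurable_fun setT (fun p : measurableTypeR R * measurableTypeR R =>
    (0 < p.2)%R%:R%:E : \bar R).
  apply/measurable_EFinP/measurable_natr_bool.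
  by apply: measurable_fun_ltr => //; exact: measurable_cst.
pose G (p : measurableTypeR R * measurableTypeR R) :=
  (H (p.1 +i* p.2) * (0 < p.2)%R%:R%:E)%E.
have mG : measurable_fun setT G by exact: emeasurable_funM.
have G0 p : (0 <= G p)%E by rewrite mule_ge0.
have mI := measurable_fun_fubini_tonelli_F (m2 := leb) G mG G0.
have I0 x : (0 <= fubini_F leb G x)%E by apply: integral_ge0 => y _; exact: G0.
(* The substitution to come produces the abscissa [- r * cos t]; reflecting [x] beforehand turns it
   into [r * cos t]. *)
transitivity (\int[leb]_x \int[leb]_y (H (- x +i* y)%R * (0 < y)%R%:R%:E))%E.
  exact: (ge0_integral_opp mI I0).
pose K (p : measurableTypeR R * measurableTypeR R) := H (- p.1 +i* p.2).
have mK : measurable_fun setT K.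
  apply: (measurableT_comp mH); apply: measurable_funC => /=.
    by apply: measurable_funN.
  exact: measurable_snd.
have K0 p : (0 <= K p)%E by exact: H0.
have mM : measurable_fun setT
    (fun p : measurableTypeR R * measurableTypeR R => p.1 * p.2).
  exact: measurable_funM.
have normM (r x : R) : 0 < r -> `|r * x| = r * `|x|.
  by move=> r0; rewrite normrM gtr0_norm.
have scaleM (r : R) (F : R -> \bar R) : 0 < r -> measurable_fun setT F ->
    (forall x, 0 <= F x)%E ->
    (\int[leb]_x F x = (r ^+ 1)%:E * \int[leb]_x F (r * x)%R)%E.
  move=> r0 mF F0; rewrite expr1 (@ge0_integral_affine _ r 0)//.
  by congr (_ * _)%E; apply: eq_integral => x _; rewrite addr0.
apply: (etrans (@ge0_integral_polar_half _ _ R leb 1 (fun x => `|x|)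
  (fun r x => r * x) (@normr_measurable R setT) (fun x => normr_ge0 x) mM normM
  scaleM K mK K0)).
apply: eq_integral => r _.
pose L (x : R) := (K (r * x, r * Num.sqrt (1 - x ^+ 2))%R *
  ((0 < r)%R%:R * r)%:E)%E.
have mL : measurable_fun setT L.
  apply: emeasurable_funM; last exact: measurable_cst.
  apply: (measurableT_comp mK); apply/measurable_fun_pairP; split => /=.
    exact: measurable_funM.
  apply: measurable_funM => //; apply: (measurableT_comp measurable_sqrt).
  by apply: measurable_funB => //; exact: measurable_funX.
have L0 x : (0 <= L x)%E.
  by rewrite mule_ge0// lee_fin; case: ltP => /= [/ltW|]; rewrite ?mul1r ?mul0r.
transitivity (\int[leb]_x (L x * ((`|x| < 1)%R%:R / Num.sqrt (1 - x ^+ 2))%:E))%E.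
  apply: eq_integral => x _; rewrite /L real_normK ?num_real// -muleA -EFinM.
  by rewrite expr1.
rewrite (ge0_integral_Ncos mL L0); apply: eq_integral => t _.
rewrite /L -muleA -EFinM; have [/andP[t0 tp]|_] := boolP (0 < t < pi)%R; last first.
  by rewrite !mulr0 !mule0.
have st : 0 < sin t by apply: sin_gt0_pi; rewrite t0.
rewrite /K/= sqrrN -sin2cos2 sqrtr_sqr gtr0_norm//; congr (H _ * _)%E.
by rewrite /expi; simpc; rewrite ?mulrN ?opprK.
Qed.

(** The factor [Normc.normc t == 1] is identically 1 along [expi]. Keeping it in the integrand lets
    later pointwise computations use that [t] is unimodular. *)
Lemma ge0_integral_polar_complex (F : R[i] -> \bar R) :
  measurable_fun setT F -> (forall x, 0 <= F x)%E ->
  (\int[lebesgue_complex]_z F z =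
   \int[leb]_r \int[circle_measure]_t (F (t * r%:C)%R *
     ((0 < r)%R%:R * r * (Normc.normc t == 1)%:R)%:E))%E.
Proof.
move=> mF F0.
rewrite (_ : \int[_]_z _ = \int[pushforward (leb \x leb) pairc]_z F z)%E//.
have mp := @measurable_pairc R.
rewrite ge0_integral_pushforward//= preimage_setT.
have mFp : measurable_fun setT (F \o pairc) by exact: measurableT_comp.
rewrite (fubini_tonelli1 (F \o pairc) mFp (fun x => F0 _)).
have mN : measurable_fun setT (fun z : R[i] => - z).
  apply: measurable_funC.
    rewrite (_ : (fun x => _) = fun x => - complex.Re x).
      exact/measurable_funN/measurable_Re.
    by apply/funext => -[].
  rewrite (_ : (fun x => _) = fun x => - complex.Im x).
    exact/measurable_funN/measurable_Im.
  by apply/funext => -[].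
have mFN : measurable_fun setT (fun z : R[i] => F (- z)%R).
  exact: measurableT_comp.
pose H (z : R[i]) := (F z + F (- z)%R)%E.
have mH : measurable_fun setT H by exact: emeasurable_funD.
have H0 z : (0 <= H z)%E by rewrite adde_ge0.
have mpos : measurable_fun setT (fun p : measurableTypeR R * measurableTypeR R =>
    (0 < p.2)%R%:R%:E : \bar R).
  apply/measurable_EFinP/measurable_natr_bool.
  by apply: measurable_fun_ltr => //; exact: measurable_cst.
(* The lower half-plane is folded onto the upper one by [y] to [- y] and then [x] to [- x], that is
   by [z] to [- z], as required by the antipodal pairing of [ge0_integral_circle]. *)
transitivity (\int[leb]_x \int[leb]_y (H (x +i* y) * (0 < y)%R%:R%:E))%E.
  pose A (p : measurableTypeR R * measurableTypeR R) :=
    (F (p.1 +i* p.2) * (0 < p.2)%R%:R%:E)%E.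
  pose B (p : measurableTypeR R * measurableTypeR R) :=
    (F (p.1 -i* p.2)%C * (0 < p.2)%R%:R%:E)%E.
  pose C (p : measurableTypeR R * measurableTypeR R) :=
    (F (- (p.1 +i* p.2))%R * (0 < p.2)%R%:R%:E)%E.
  have mA : measurable_fun setT A by exact: emeasurable_funM.
  have mB : measurable_fun setT B.
    apply: emeasurable_funM => //; apply: (measurableT_comp mF).
    apply: measurable_funC => //=; first exact: measurable_fst.
    exact/measurable_funN.
  have mC : measurable_fun setT C.
    apply: emeasurable_funM => //; exact: (measurableT_comp mFN mp).
  have A0 p : (0 <= A p)%E by rewrite mule_ge0.
  have B0 p : (0 <= B p)%E by rewrite mule_ge0.
  have C0 p : (0 <= C p)%E by rewrite mule_ge0.
  have fF (P : measurableTypeR R * measurableTypeR R -> \bar R) :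
      measurable_fun setT P -> (forall p, 0 <= P p)%E ->
      measurable_fun setT (fun x => \int[leb]_y P (x, y))%E /\
      (forall x, 0 <= \int[leb]_y P (x, y))%E.
    move=> mP P0; split; first exact: (measurable_fun_fubini_tonelli_F (m2 := leb) P).
    by move=> x; apply: integral_ge0.
  have sec (P : measurableTypeR R * measurableTypeR R -> \bar R) x :
      measurable_fun setT P -> measurable_fun setT (fun y => P (x, y)).
    by move=> mP; exact: (measurableT_comp mP (pair1_measurable x)).
  have [mIA IA0] := fF A mA A0; have [mIB IB0] := fF B mB B0.
  have [mIC IC0] := fF C mC C0.
  transitivity (\int[leb]_x (\int[leb]_y A (x, y) + \int[leb]_y B (x, y)))%E.
    apply: eq_integral => x _.
    apply: (etrans (ge0_integral_half_lines (sec (F \o pairc) x mFp) (fun y => F0 _))).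
    rewrite -ge0_integralD//; try exact: sec.
    by apply: eq_integral => y _; rewrite /A /B /= ge0_muleDl.
  rewrite ge0_integralD// [X in (_ + X)%E](ge0_integral_opp mIB IB0).
  rewrite (_ : \int[leb]_x _ = \int[leb]_x \int[leb]_y C (x, y))%E; last first.
    by apply: eq_integral => x _; apply: eq_integral => y _; rewrite /B /C/=; simpc.
  rewrite -ge0_integralD//; apply: eq_integral => x _.
  rewrite -ge0_integralD//; try exact: sec.
  by apply: eq_integral => y _; rewrite /A /C/= -ge0_muleDl.
rewrite (ge0_integral_upper_half_plane mH H0); apply: eq_integral => r _.
rewrite ge0_integral_circle.
- apply: eq_integral => t _; rewrite /= !sqrrN cos2Dsin2 sqrtr1 eqxx mulr1 /H.
  rewrite mulNr [r%:C * _]mulrC -ge0_muleDl// -muleA -EFinM.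
  by congr (_ * _)%E; rewrite addeC.
- apply: emeasurable_funM.
    by apply: (measurableT_comp mF); exact: measurable_funM_complex.
  apply/measurable_EFinP; apply: measurable_funM => //; apply: measurable_natr_bool.
  by apply: measurable_fun_eqr; [exact: measurable_normc|exact: measurable_cst].
- move=> t; rewrite mule_ge0// lee_fin mulr_ge0//.
  by case: ltP => /= [/ltW|]; rewrite ?mul1r ?mul0r.
Qed.

End polar_complex.

(** * Polar coordinates on the torus and on the sphere *)

Lemma prod_natr_bool (R : comPzSemiRingType) (I : finType) (b : pred I) :
  \prod_i (b i)%:R = [forall i, b i]%:R :> R.
Proof.
have [/forallP bT|/forallPn[i bi]] := boolP [forall i, b i].
  by rewrite big1// => i _; rewrite bT.
by rewrite (bigD1 i)//= (negbTE bi) mul0r.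
Qed.

Lemma measurable_forall_ord d (T : measurableType d) n (b : 'I_n -> T -> bool) :
  (forall i, measurable_fun setT (b i)) ->
  measurable_fun setT (fun x => [forall i, b i x]).
Proof.
move=> mb; apply: (measurable_fun_bool true); rewrite setTI.
rewrite (_ : _ @^-1` _ = \bigcap_(i in [set: 'I_n]) (b i @^-1` [set true])).
  apply: fin_bigcap_measurable => // i _.
  by rewrite -[X in measurable X]setTI; exact: mb.
apply/seteqP; split => x /=.
  by move/forallP => bx i _; exact: bx.
by move=> bx; apply/forallP => i; exact: bx.
Qed.

Section polar_vec.
Context {R : realType}.
Notation leb := (@lebesgue_measure R).

Definition polar_point k (rho : vec (measurableTypeR R) k) (t : vec R[i] k) :
    vec R[i] k :=
  \col_i ((t : 'cV[R[i]]_k) i ord0 * ((rho : 'cV[R]_k) i ord0)%:C).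

Definition positive k (s : vec (measurableTypeR R) k) : bool :=
  [forall i, 0 < (s : 'cV[R]_k) i ord0].

Definition unimodular k (t : vec R[i] k) : bool :=
  [forall i, Normc.normc ((t : 'cV[R[i]]_k) i ord0) == 1].

Lemma measurable_positive k : measurable_fun setT (@positive k).
Proof.
apply: measurable_forall_ord => i.
by apply: measurable_fun_ltr; [exact: measurable_cst|exact: measurable_coord].
Qed.

Lemma measurable_unimodular k : measurable_fun setT (@unimodular k).
Proof.
apply: measurable_forall_ord => i; apply: measurable_fun_eqr => //.
by apply: measurable_normc; exact: measurable_coord.
Qed.

Lemma measurable_polar_point k : measurable_fun setT
  (fun p : vec (measurableTypeR R) k * vec R[i] k => polar_point p.1 p.2).
Proof.
apply: measurable_vecP => i; under eq_fun do rewrite mxE.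
apply: measurable_funM_complex.
  exact: (measurableT_comp (measurable_coord i) measurable_snd).
apply: measurable_real_complex.
exact: (measurableT_comp (measurable_coord i) measurable_fst).
Qed.

Lemma measurable_prod_coord k : measurable_fun setT
  (fun s : vec (measurableTypeR R) k => \prod_i (s : 'cV[R]_k) i ord0).
Proof. by apply: measurable_prod => i _; exact: measurable_coord. Qed.

Lemma vec_cons_polar_point k (r : R) rho (t : R[i]) tau :
  polar_point (vec_cons (r, rho)) (vec_cons (t, tau)) =
  vec_cons (t * r%:C, polar_point rho tau) :> vec R[i] k.+1.
Proof.
by apply/matrixP => i j; rewrite !mxE; case: unliftP => [i'|] _ //=; rewrite mxE.
Qed.

Lemma positive_vec_cons k (r : R) (rho : vec (measurableTypeR R) k) :
  positive (vec_cons (r, rho)) = (0 < r) && positive rho.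
Proof.
apply/forallP/andP => [H|[r0 /forallP H] i].
  split; first by have := H ord0; rewrite mxE unlift_none.
  by apply/forallP => i; have := H (lift ord0 i); rewrite mxE liftK.
by rewrite mxE; case: unliftP => [i'|] _.
Qed.

Lemma unimodular_vec_cons k (t : R[i]) (tau : vec R[i] k) :
  unimodular (vec_cons (t, tau)) = (Normc.normc t == 1) && unimodular tau.
Proof.
apply/forallP/andP => [H|[r0 /forallP H] i].
  split; first by have := H ord0; rewrite mxE unlift_none.
  by apply/forallP => i; have := H (lift ord0 i); rewrite mxE liftK.
by rewrite mxE; case: unliftP => [i'|] _.
Qed.

Lemma prod_vec_cons k (r : R) (rho : vec (measurableTypeR R) k) :
  \prod_i (vec_cons (r, rho) : 'cV[R]_k.+1) i ord0 =
  r * \prod_i (rho : 'cV[R]_k) i ord0.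
Proof.
rewrite big_ord_recl mxE unlift_none; congr (_ * _).
by apply: eq_bigr => i _; rewrite mxE liftK.
Qed.

(** Jacobian of polar coordinates taken in each complex coordinate, cut to the set on which moduli
    and phases can be read off from the point. *)
Definition torus_weight k (rho : vec (measurableTypeR R) k) (t : vec R[i] k) : R :=
  (positive rho)%:R * \prod_i (rho : 'cV[R]_k) i ord0 * (unimodular t)%:R.

Lemma torus_weight_ge0 k (rho : vec (measurableTypeR R) k) t :
  0 <= torus_weight rho t.
Proof.
rewrite /torus_weight; have [/forallP r0|_] := boolP (positive rho).
  by rewrite mulr_ge0// mul1r prodr_ge0// => i _; exact/ltW.
by rewrite !mul0r.
Qed.

Lemma measurable_torus_weight k : measurable_fun setT
  (fun p : vec (measurableTypeR R) k * vec R[i] k => torus_weight p.1 p.2).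
Proof.
apply: measurable_funM; first apply: measurable_funM.
- apply: measurable_natr_bool.
  exact: (measurableT_comp (@measurable_positive k) measurable_fst).
- exact: (measurableT_comp (@measurable_prod_coord k) measurable_fst).
- apply: measurable_natr_bool.
  exact: (measurableT_comp (@measurable_unimodular k) measurable_snd).
Qed.

Lemma emeasurable_torus_weight k : measurable_fun setT
  (fun p : vec (measurableTypeR R) k * vec R[i] k =>
    (torus_weight p.1 p.2)%:E : \bar R).
Proof. by apply/measurable_EFinP; exact: measurable_torus_weight. Qed.

Lemma torus_weight_vec_cons k (r : R) rho (t : R[i]) (tau : vec R[i] k) :
  torus_weight (vec_cons (r, rho)) (vec_cons (t, tau)) =
  torus_weight rho tau * ((0 < r)%R%:R * r * (Normc.normc t == 1)%:R).
Proof.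
rewrite /torus_weight positive_vec_cons unimodular_vec_cons prod_vec_cons.
by rewrite -!mulnb !natrM; ring.
Qed.

(** Induction on [k], with polar coordinates in the plane for the first coordinate and the induction
    hypothesis for the others. *)
Lemma ge0_integral_polar_torus k (F : vec R[i] k -> \bar R) :
  measurable_fun setT F -> (forall x, 0 <= F x)%E ->
  (\int[lebesgueC k]_z F z =
   \int[lebesgueR k]_rho \int[torus_haar k]_t
     (F (polar_point rho t) * (torus_weight rho t)%:E))%E.
Proof.
elim: k F => [|k IH] F mF F0.
  rewrite /lebesgueC /lebesgueR /torus_haar.
  have mG : measurable_fun setT
      (fun p : vec (measurableTypeR R) 0 * vec R[i] 0 =>
         F (polar_point p.1 p.2) * (torus_weight p.1 p.2)%:E)%E.
    apply: emeasurable_funM.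
      exact: (measurableT_comp mF (@measurable_polar_point 0)).
    exact: emeasurable_torus_weight.
  rewrite !(@vec_integral0 _ _ _ _ _ (const_mx point))//.
  - rewrite /torus_weight big_ord0 /positive /unimodular.
    do 2 (rewrite (_ : [forall i, _]); last by apply/forallP => -[]).
    by rewrite !mulr1 mule1; congr F; apply/matrixP => -[].
  - exact: (measurableT_comp mG (pair1_measurable _)).
  - apply: (measurable_fun_fubini_tonelli_F (m2 := vec_measure _ 0) _ mG).
    by move=> p; rewrite mule_ge0// lee_fin torus_weight_ge0.
have mcC := measurable_vec_cons (T := R[i]) (n := k).
have mcR := measurable_vec_cons (T := measurableTypeR R) (n := k).
pose G (p : vec (measurableTypeR R) k.+1 * vec R[i] k.+1) :=
  (F (polar_point p.1 p.2) * (torus_weight p.1 p.2)%:E)%E.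
have mG : measurable_fun setT G.
  apply: emeasurable_funM.
    exact: (measurableT_comp mF (@measurable_polar_point k.+1)).
  exact: emeasurable_torus_weight.
have G0 p : (0 <= G p)%E by rewrite mule_ge0// lee_fin torus_weight_ge0.
pose Fc (p : R[i] * vec R[i] k) := F (vec_cons p).
have mFc : measurable_fun setT Fc by exact: (measurableT_comp mF mcC).
have Fc0 p : (0 <= Fc p)%E by exact: F0.
apply: (etrans (@vec_integralS _ _ _ lebesgue_complex k F mF F0)).
have mI := measurable_fun_fubini_tonelli_F (m2 := lebesgueC k) Fc mFc Fc0.
have I0 z : (0 <= fubini_F (lebesgueC k) Fc z)%E.
  by apply: integral_ge0 => v _; exact: Fc0.
apply: (etrans (ge0_integral_polar_complex mI I0)).
have mJ := measurable_fun_fubini_tonelli_F (m2 := torus_haar k.+1) G mG G0.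
have J0 z : (0 <= fubini_F (torus_haar k.+1) G z)%E.
  by apply: integral_ge0 => v _; exact: G0.
apply/esym; apply: (etrans (@vec_integralS _ _ _ leb k _ mJ J0)).
apply: eq_integral => r _.
pose E (q : (vec (measurableTypeR R) k * R[i]) * vec R[i] k) :=
  G (vec_cons (r, q.1.1), vec_cons (q.1.2, q.2)).
have mE : measurable_fun setT E.
  apply: (measurableT_comp mG); apply/measurable_fun_pairP; split => /=.
    apply: (measurableT_comp mcR); apply/measurable_fun_pairP; split => /=.
      exact: measurable_cst.
    exact: (measurableT_comp measurable_fst measurable_fst).
  apply: (measurableT_comp mcC); apply/measurable_fun_pairP; split => /=.
    exact: (measurableT_comp measurable_snd measurable_fst).
  exact: measurable_snd.
have E0 q : (0 <= E q)%E by exact: G0.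
have mD := measurable_fun_fubini_tonelli_F (m2 := torus_haar k) E mE E0.
have D0 z : (0 <= fubini_F (torus_haar k) E z)%E.
  by apply: integral_ge0 => v _; exact: E0.
transitivity (\int[lebesgueR k]_rho \int[circle_measure]_t
    fubini_F (torus_haar k) E (rho, t))%E.
  apply: eq_integral => rho _.
  apply: (@vec_integralS _ _ _ circle_measure k (fun t => G (vec_cons (r, rho), t))) => //.
  exact: (measurableT_comp mG (pair1_measurable _)).
(* The two sides list the variables as [r, rho, t, tau] and [r, t, rho, tau]; this exchange
   reconciles them. *)
rewrite (fubini_tonelli (m1 := lebesgueR k) (m2 := circle_measure) _ mD D0).
apply: eq_integral => t _.
set w1 := (_ * _ * (_ == 1)%:R).
have w10 : 0 <= w1.
  by rewrite mulr_ge0//; case: ltP => /= [/ltW|]; rewrite ?mul1r ?mul0r.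
rewrite /fubini_F [in RHS]IH; last 2 first.
- exact: (measurableT_comp mFc (pair1_measurable _)).
- by move=> x; exact: Fc0.
have mfst : measurable_fun setT (fun p : vec (measurableTypeR R) k * vec R[i] k =>
    (Fc ((t * r%:C)%R, polar_point p.1 p.2) * (torus_weight p.1 p.2)%:E)%E).
  apply: emeasurable_funM; last exact: emeasurable_torus_weight.
  apply: (measurableT_comp mFc); apply/measurable_fun_pairP; split => /=.
    exact: measurable_cst.
  exact: measurable_polar_point.
have mfst0 p : (0 <= Fc ((t * r%:C)%R, polar_point p.1 p.2) * (torus_weight p.1 p.2)%:E)%E.
  by rewrite mule_ge0// lee_fin torus_weight_ge0.
have mK := measurable_fun_fubini_tonelli_F (m2 := torus_haar k) _ mfst mfst0.
rewrite -ge0_integralZr//; last first.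
  by move=> rho _; apply: integral_ge0 => tau _; exact: mfst0 (rho, tau).
apply: eq_integral => rho _.
rewrite -ge0_integralZr//; last 2 first.
- exact: (measurableT_comp mfst (pair1_measurable rho)).
- by move=> tau _; exact: mfst0 (rho, tau).
apply: eq_integral => tau _.
by rewrite /E /G/= vec_cons_polar_point torus_weight_vec_cons EFinM muleA.
Qed.

End polar_vec.

(** Sylvester's determinant identity: the block matrix with rows [(1, - A)] and [(B, 1)] has two
    block-triangular factorisations, one for each side. *)
Lemma det_1Dmulmx (R : comNzRingType) m n (A : 'M[R]_(m, n)) (B : 'M[R]_(n, m)) :
  \det (1%:M + A *m B) = \det (1%:M + B *m A).
Proof.
transitivity (\det (block_mx 1%:M (- A) B 1%:M)).
  have -> : block_mx 1%:M (- A) B 1%:M =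
      block_mx (1%:M + A *m B) (- A) 0 1%:M *m block_mx 1%:M 0 B 1%:M.
    rewrite mulmx_block !mulmx0 !mul0mx !mulmx1 !mul1mx !add0r.
    by rewrite mulNmx addrK.
  by rewrite det_mulmx det_ublock det_lblock !det1 !mulr1.
have -> : block_mx 1%:M (- A) B 1%:M =
    block_mx 1%:M 0 B 1%:M *m block_mx 1%:M (- A) 0 (1%:M + B *m A).
  rewrite mulmx_block !mulmx0 !mul0mx !mulmx1 !mul1mx !addr0 ?add0r.
  by rewrite mulmxN addrCA addNr addr0.
by rewrite det_mulmx det_lblock det_ublock !det1 !mul1r.
Qed.

Section sphere.
Context {R : realType}.
Notation leb := (@lebesgue_measure R).

Lemma rnorm_ge0 n (x : 'cV[R]_n) : 0 <= rnorm x.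
Proof. exact: sqrtr_ge0. Qed.

Lemma rnorm_sqr n (x : 'cV[R]_n) : rnorm x ^+ 2 = \sum_i x i ord0 ^+ 2.
Proof. by rewrite sqr_sqrtr// sumr_ge0// => i _; exact: sqr_ge0. Qed.

Lemma rnormZ n (r : R) (x : 'cV[R]_n) : 0 <= r -> rnorm (r *: x) = r * rnorm x.
Proof.
move=> r0; rewrite /rnorm.
under eq_bigr do rewrite mxE exprMn.
by rewrite -mulr_sumr sqrtrM ?sqr_ge0// sqrtr_sqr ger0_norm.
Qed.

(** The Gram matrix is the identity plus the rank-one matrix [x x^T / (1 - |x|^2)], so Sylvester's
    identity reduces its determinant to the number [1 + |x|^2 / (1 - |x|^2)]. *)
Lemma det_sphere_gram n (x : 'cV[R]_n) : rnorm x < 1 ->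
  \det (sphere_gram (k := n.+1) x) = (1 - rnorm x ^+ 2)^-1.
Proof.
move=> x1; have c0 : 0 < 1 - rnorm x ^+ 2.
  by rewrite subr_gt0 -(expr1n _ 2) ltr_pXn2r ?nnegrE// rnorm_ge0.
have -> : sphere_gram (k := n.+1) x =
    1%:M + ((1 - rnorm x ^+ 2)^-1 *: x) *m trmx x :> 'M[R]_n.
  apply/matrixP => p q; rewrite !mxE big_ord1 !mxE big_ord_recr/= !mxE/=.
  rewrite insubF ?ltnn//; congr (_ + _).
    rewrite (bigD1 p)//= !mxE/= valK eqxx mul1r.
    rewrite big1 ?addr0// => i ip.
    by rewrite !mxE/= valK (negbTE ip) mul0r.
  rewrite -[in RHS](sqr_sqrtr (ltW c0)) -exprVn; ring.
rewrite det_1Dmulmx -scalemxAr [X in \det X]mx11_scalar det_scalar expr1.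
rewrite !mxE (_ : \sum_j _ = rnorm x ^+ 2); last first.
  by rewrite rnorm_sqr; apply: eq_bigr => i _; rewrite !mxE expr2.
by rewrite eqxx mulr1n; field; rewrite gt_eqF.
Qed.

Lemma sphere_densityE n (x : vec (measurableTypeR R) n) :
  sphere_density (k := n.+1) x =
  (`[< tau_ball n x >])%:R / Num.sqrt (1 - rnorm x ^+ 2).
Proof.
rewrite /sphere_density indicE (_ : x \in _ = `[< tau_ball n x >])//.
have [/asboolP[_ x1]|_] := boolP `[< _ >]; last by rewrite !mul0r.
by rewrite !mul1r det_sphere_gram// sqrtrV// subr_ge0 expr_le1// ?rnorm_ge0// ltW.
Qed.

Lemma ge0_integral_sphere n (F : vec (measurableTypeR R) n.+1 -> \bar R) :
  measurable_fun setT F -> (forall x, 0 <= F x)%E ->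
  (\int[sphere_measure n.+1]_s F s =
   \int[lebesgueR n]_x (F (sphere_chart (k := n.+1) x) *
     ((`[< tau_ball n x >])%:R / Num.sqrt (1 - rnorm x ^+ 2))%:E))%E.
Proof.
move=> mF F0.
have mchart : measurable_fun setT (@sphere_chart R n.+1).
  exact: measurable_sphere_chart.
rewrite (_ : \int[_]_s _ = \int[pushforward (density_measure (lebesgueR n)
    (@measurable_sphere_density R n.+1) (@sphere_density_ge0 R n.+1))
    (@sphere_chart R n.+1)]_s F s)%E//.
rewrite ge0_integral_pushforward//= preimage_setT ge0_integral_density//.
  by apply: eq_integral => x _; rewrite sphere_densityE.
exact: measurableT_comp.
Qed.

Lemma sphere_chartE n (x : vec (measurableTypeR R) n) :
  sphere_chart (k := n.+1) x = vec_snoc x (Num.sqrt (1 - rnorm x ^+ 2)).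
Proof. by []. Qed.

Lemma vec_snocZ n (r : R) (x : 'cV[R]_n) (y : R) :
  r *: (vec_snoc (x : vec (measurableTypeR R) n) y : 'cV[R]_n.+1) =
  vec_snoc (r *: x : vec (measurableTypeR R) n) (r * y) :> 'cV[R]_n.+1.
Proof.
by apply/matrixP => i j; rewrite !mxE; case: insubP => [i'|] *; rewrite ?mxE.
Qed.

Lemma vec_snoc_widen n (x : vec (measurableTypeR R) n) y (i : 'I_n) j :
  (vec_snoc x y : 'cV[R]_n.+1) (widen_ord (leqnSn n) i) j = (x : 'cV[R]_n) i ord0.
Proof.
rewrite mxE/= insubT//= => iin.
by congr (x _ _); exact: val_inj.
Qed.

Lemma vec_snoc_max n (x : vec (measurableTypeR R) n) y j :
  (vec_snoc x y : 'cV[R]_n.+1) ord_max j = y.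
Proof. by rewrite mxE/= insubF ?ltnn. Qed.

Lemma positive_vec_snoc n (x : vec (measurableTypeR R) n) (y : R) :
  positive (vec_snoc x y) = positive x && (0 < y).
Proof.
apply/forallP/andP => [H|[/forallP H y0] i].
  split; last by have := H ord_max; rewrite vec_snoc_max.
  by apply/forallP => i; have := H (widen_ord (leqnSn n) i); rewrite vec_snoc_widen.
by rewrite mxE; case: insubP => [i'|] *.
Qed.

Lemma rnorm_vec_snoc n (x : vec (measurableTypeR R) n) (y : R) :
  rnorm (vec_snoc x y) ^+ 2 = rnorm x ^+ 2 + y ^+ 2.
Proof.
rewrite !rnorm_sqr big_ord_recr/= vec_snoc_max; congr (_ + _).
by apply: eq_bigr => i _; rewrite vec_snoc_widen.
Qed.

Lemma positiveZ n (r : R) (x : vec (measurableTypeR R) n) : 0 < r ->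
  positive (r *: (x : 'cV[R]_n) : vec (measurableTypeR R) n) = positive x.
Proof.
by move=> r0; apply: eq_forallb => i; rewrite mxE pmulr_rgt0.
Qed.

(** The half-space formula over the first [n] coordinates puts the point at [r] times
    [(x, sqrt (1 - |x|^2))] with weight [1 / sqrt (1 - |x|^2)]. These are the chart of the sphere
    and its density, so the inner integral is one over [sphere_measure]. *)
Lemma ge0_integral_orthant n (F : vec (measurableTypeR R) n.+1 -> \bar R) :
  measurable_fun setT F -> (forall x, 0 <= F x)%E ->
  (\int[lebesgueR n.+1]_x (F x * (positive x)%:R%:E) =
   \int[leb]_r \int[sphere_measure n.+1]_s (F (r *: (s : 'cV[R]_n.+1))%R *
     ((0 < r)%R%:R * r ^+ n * (positive s && (rnorm s == 1))%:R)%:E))%E.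
Proof.
move=> mF F0.
have mpos : measurable_fun setT
    (fun x : vec (measurableTypeR R) n.+1 => (positive x)%:R%:E : \bar R).
  by apply/measurable_EFinP/measurable_natr_bool; exact: measurable_positive.
pose P x := (F x * (positive x)%:R%:E)%E.
have mP : measurable_fun setT P by exact: emeasurable_funM.
have P0 x : (0 <= P x)%E by rewrite mule_ge0.
apply: (etrans (@vec_integral_snoc _ _ _ leb n P mP P0)).
pose Q (p : vec (measurableTypeR R) n * measurableTypeR R) := P (vec_snoc p.1 p.2).
have mQ : measurable_fun setT Q.
  exact: (measurableT_comp mP (@measurable_vec_snoc _ _ n)).
have Q0 p : (0 <= Q p)%E by exact: P0.
have mscale : measurable_fun setT
    (fun p : measurableTypeR R * vec (measurableTypeR R) n =>
      p.1 *: (p.2 : 'cV[R]_n) : vec (measurableTypeR R) n).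
  apply: measurable_vecP => i; under eq_fun do rewrite mxE.
  apply: measurable_funM; first exact: measurable_fst.
  exact: (measurableT_comp (measurable_coord i) measurable_snd).
transitivity (\int[lebesgueR n]_x \int[leb]_y (Q (x, y) * (0 < y)%R%:R%:E))%E.
  apply: eq_integral => x _; apply: eq_integral => y _.
  rewrite /Q/P/= positive_vec_snoc -muleA -EFinM.
  by case: (0 < y)%R; rewrite ?andbT ?andbF /= ?mulr1 ?mulr0.
have normZ (r : R) (x : vec (measurableTypeR R) n) : 0 < r ->
    rnorm (r *: (x : 'cV[R]_n)) = r * rnorm x.
  by move=> r0; rewrite rnormZ// ltW.
apply: (etrans (@ge0_integral_polar_half _ _ R (lebesgueR n) n
  (fun x => rnorm x) (fun r x => r *: (x : 'cV[R]_n) : vec (measurableTypeR R) n)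
  (@measurable_rnorm R n) (fun x => rnorm_ge0 x) mscale normZ
  (@vec_integral_scale R n) Q mQ Q0)).
apply: eq_integral => r _.
have mZ : measurable_fun setT (fun s : vec (measurableTypeR R) n.+1 =>
    r *: (s : 'cV[R]_n.+1) : vec (measurableTypeR R) n.+1).
  apply: measurable_vecP => i; under eq_fun do rewrite mxE.
  by apply: measurable_funM => //; exact: measurable_coord.
rewrite ge0_integral_sphere; first last.
- move=> s; rewrite mule_ge0// lee_fin mulr_ge0//.
  by case: ltP => /= [r0|]; rewrite ?mul0r// mul1r exprn_ge0// ltW.
- apply: emeasurable_funM; first exact: (measurableT_comp mF mZ).
  apply/measurable_EFinP; apply: measurable_funM => //.
  apply: measurable_natr_bool; apply: measurable_and.
    exact: measurable_positive.
  by apply: measurable_fun_eqr; [exact: measurable_rnorm|exact: measurable_cst].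
apply: eq_integral => x _; rewrite /Q /P/= sphere_chartE -vec_snocZ.
rewrite -!muleA -!EFinM.
have [r0|r0] := ltP 0 r; last by rewrite /= !(mul0r, mulr0).
congr (_ * _%:E)%E; rewrite positiveZ// positive_vec_snoc.
have [/forallP xp|xp] /= := boolP (positive x); last by rewrite !(mul0r, mulr0).
(* Off the unit ball the half-space indicator and that of [tau_ball] both vanish; inside it the
   chart point has norm 1 and a positive last coordinate. *)
have [x1|x1] := ltP (rnorm x) 1; last first.
  rewrite (_ : `[< _ >] = false) ?mul0r ?mulr0//.
  by apply/negbTE/negP => /asboolP[_]; rewrite ltNge x1.
have c0 : 0 < 1 - rnorm x ^+ 2.
  by rewrite subr_gt0 -(expr1n _ 2) ltr_pXn2r ?nnegrE// rnorm_ge0.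
rewrite sqrtr_gt0 c0/= (_ : _ == 1)/=; last first.
  rewrite -(@eqrXn2 _ 2)// ?rnorm_ge0// rnorm_vec_snoc [X in _ + X]sqr_sqrtr ?(ltW c0)//.
  by apply/eqP; ring.
rewrite (_ : `[< _ >] = true) ?mul1r ?mulr1//.
by apply/asboolP; split => // i; exact/ltW.
Qed.

End sphere.

(** * Gaussian integrals *)

Section gaussian_moments.
Context {R : realType}.
Notation leb := (@lebesgue_measure R).

Lemma cvgy_pow_expRN i : (x ^+ i * expR (- x) @[x --> +oo] --> (0 : R)).
Proof.
apply/cvgrPdist_le => e e0; near=> x.
have x0 : 0 < x by near: x; exact: nbhs_pinfty_gt.
rewrite sub0r normrN ger0_norm; last by rewrite mulr_ge0 ?exprn_ge0 ?expR_ge0// ltW.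
rewrite expRN ler_pdivrMr ?expR_gt0//.
have xe : i.+1`!%:R / e <= x by near: x; apply: nbhs_pinfty_ge; exact: num_real.
have := @expR_ge1Dxn R x i (ltW x0).
rewrite -(ler_pM2l e0) => /(le_trans _); apply.
rewrite mulrDr mulr1 ler_wpDl ?(ltW e0)//.
rewrite ler_pdivrMr// in xe.
rewrite mulrA ler_pdivlMr ?ltr0n ?fact_gt0//.
rewrite exprSr mulrCA ler_wpM2l ?exprn_ge0 ?(ltW x0)//.
by rewrite mulrC.
Unshelve. all: by end_near. Qed.

Lemma cvgy_poly_expRN (p : {poly R}) : p.[x] * expR (- x) @[x --> +oo] --> (0 : R).
Proof.
under eq_cvg do rewrite horner_coef mulr_suml.
suff H n : (fun x => \sum_(i < n) p`_i * x ^+ i * expR (- x)) @ +oo --> (0 : R).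
  exact: H.
elim: n => [|n IH].
  rewrite (_ : (fun x => _) = cst 0); first exact: cvg_cst.
  by apply/funext => x; rewrite big_ord0.
have M : (fun x => p`_n * (x ^+ n * expR (- x))) @ +oo --> p`_n * 0.
  by apply: cvgMl_tmp; exact: cvgy_pow_expRN.
have -> : (fun x => \sum_(i < n.+1) p`_i * x ^+ i * expR (- x)) =
    (fun x => \sum_(i < n) p`_i * x ^+ i * expR (- x)) +
    (fun x => p`_n * (x ^+ n * expR (- x))).
  by apply/funext => x; rewrite big_ord_recr/= -mulrA.
have := cvgD IH M; rewrite mulr0 addr0; exact.
Qed.

(** Repeated integration by parts in closed form: for such a [p], the function [- p.[x] * expR (-
    x)] is a primitive of [x ^+ a * expR (- x)], and its value at 0 yields the factorial. *)
Lemma poly_subr_deriv_Xn a :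
  exists p : {poly R}, p - p^`() = 'X^a /\ p.[0] = a`!%:R.
Proof.
elim: a => [|a [p [pE p0]]].
  by exists 1; rewrite derivC subr0 hornerC.
exists ('X^(a.+1) + a.+1%:R *: p); split.
  rewrite derivD derivXn derivZ opprD addrACA -scalerBr pE.
  by rewrite /= scaler_nat -addrA addNr addr0.
by rewrite hornerD hornerZ hornerXn expr0n/= add0r p0 factS natrM.
Qed.

Lemma integral_pow_expRN a :
  (\int[leb]_(x in `[0%R, +oo[) (x ^+ a * expR (- x))%:E = (a`!%:R : R)%:E)%E.
Proof.
have [p [pE p0]] := poly_subr_deriv_Xn a.
pose F x := - (p.[x] * expR (- x)).
have dF (x : R) : is_derive x (1%R : R) F (x ^+ a * expR (- x)).
  rewrite /F.
  have -> : (fun x => - (p.[x] * expR (- x))) = - (horner p * (expR \o -%R)) by [].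
  apply: is_derive_eq.
  rewrite /= -hornerXn -pE hornerD hornerN.
  rewrite /GRing.scale/=; ring.
have cF : continuous F.
  move=> x; apply: differentiable_continuous; apply/derivable1_diffP.
  exact: (@ex_derive _ _ _ _ _ _ _ (dF x)).
rewrite (ge0_continuous_FTC2y (F := F) (l := 0)).
- by rewrite /F p0 oppr0 expR0 mulr1 EFinN sub0e oppeK.
- by move=> x x0; rewrite mulr_ge0 ?exprn_ge0 ?expR_ge0.
- apply: continuous_subspaceT => x; apply: cvgM.
    exact: exprn_continuous.
  apply: (@continuous_comp _ _ _ -%R expR); last exact: continuous_expR.
  exact: opp_continuous.
- rewrite -oppr0; apply: cvgN; exact: cvgy_poly_expRN.
- by move=> x _; apply: ex_derive.
- exact/cvg_at_right_filter/cF.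
- by move=> x _; rewrite derive1E derive_val.
Qed.

(** Radial exponents in complex spaces are odd, so [u = x ^+ 2] leads to the factorial integrals and
    no square root of [pi] arises. *)
Lemma integral_gaussian_pow a :
  (\int[leb]_x ((0 < x)%R%:R * x ^+ a.*2.+1 * expR (- x ^+ 2))%:E =
   ((a`!%:R / 2) : R)%:E)%E.
Proof.
have mf : measurable_fun setT (fun u : measurableTypeR R => u ^+ a * expR (- u)).
  apply: measurable_funM; first exact: measurable_funX.
  exact: (measurableT_comp (@measurable_expR R) (@oppr_measurable R setT)).
pose F (u : R) := ((0 < u)%R%:R * (u ^+ a * expR (- u)) / 2)%:E.
have mpos : measurable_fun setT (fun u : measurableTypeR R => (0 < u)%R%:R : R).
  apply: measurable_natr_bool.
  by apply: measurable_fun_ltr => //; exact: measurable_cst.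
have mF : measurable_fun setT F.
  apply/measurable_EFinP; apply: measurable_funM => //.
  exact: measurable_funM.
have F0 u : (0 <= F u)%E.
  rewrite lee_fin divr_ge0//; case: ltP => [u0|_]; last by rewrite mul0r.
  by rewrite mul1r mulr_ge0 ?expR_ge0// exprn_ge0// ltW.
have H := ge0_integral_sqr mF F0.
transitivity (\int[leb]_x (F (x ^+ 2)%R * ((0 < x)%R%:R * (2 * x))%:E))%E.
  apply: eq_integral => x _; rewrite /F -EFinM; congr (_%:E).
  have [x0|x0] := ltP 0 x; last by rewrite !(mul0r, mulr0).
  by rewrite exprn_gt0// !mul1r -exprM mul2n exprSr; field.
rewrite -H.
transitivity (\int[leb]_(u in `]0%R, +oo[) (2^-1%:E * (u ^+ a * expR (- u))%:E))%E.
  rewrite integral_itv_natr; apply: eq_integral => u _.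
  rewrite in_itv/= andbT /F -!EFinM; congr (_%:E).
  by case: (0 < u)%R; rewrite /= ?(mulr0, mul0r)// !mulr1 mul1r mulrC.
rewrite ge0_integralZl_EFin//; last first.
- by apply/measurable_EFinP; exact: measurable_funTS.
- move=> u; rewrite /= in_itv/= andbT => u0.
  by rewrite lee_fin mulr_ge0 ?expR_ge0// exprn_ge0// ltW.
rewrite integral_itv_obnd_cbnd; last first.
  by apply/measurable_EFinP; exact: measurable_funTS.
by rewrite integral_pow_expRN -EFinM mulrC.
Qed.

End gaussian_moments.

(** * Polar coordinates in complex space and their inverse *)

Section polar_coordinates.
Context {R : realType}.
Notation leb := (@lebesgue_measure R).

Definition polar_weight k (r : R) (s : vec (measurableTypeR R) k) (t : vec R[i] k) : R :=
  (0 < r)%R%:R * r ^+ (2 * k - 1) *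
  ((positive s && (rnorm s == 1))%:R * \prod_i (s : 'cV[R]_k) i ord0 *
   (unimodular t)%:R).

Lemma ge0_integral_polar n (F : vec R[i] n.+1 -> \bar R) :
  measurable_fun setT F -> (forall x, 0 <= F x)%E ->
  (\int[lebesgueC n.+1]_z F z =
   \int[leb]_r \int[sphere_measure n.+1]_s \int[torus_haar n.+1]_t
     (F (polar_point (r *: (s : 'cV[R]_n.+1))%R t) * (polar_weight r s t)%:E))%E.
Proof.
move=> mF F0; apply: (etrans (ge0_integral_polar_torus mF F0)).
pose G (p : vec (measurableTypeR R) n.+1 * vec R[i] n.+1) :=
  (F (polar_point p.1 p.2) * (torus_weight p.1 p.2)%:E)%E.
have mG : measurable_fun setT G.
  apply: emeasurable_funM; last exact: emeasurable_torus_weight.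
  exact: (measurableT_comp mF (@measurable_polar_point R n.+1)).
have G0 p : (0 <= G p)%E by rewrite mule_ge0// lee_fin torus_weight_ge0.
have mQ := measurable_fun_fubini_tonelli_F (m2 := torus_haar n.+1) G mG G0.
have Q0 z : (0 <= fubini_F (torus_haar n.+1) G z)%E.
  by apply: integral_ge0 => v _; exact: G0.
transitivity (\int[lebesgueR n.+1]_rho
    (fubini_F (torus_haar n.+1) G rho * (positive rho)%:R%:E))%E.
  apply: eq_integral => rho _; rewrite /fubini_F.
  have [_|rho0] := boolP (positive rho); first by rewrite mule1.
  rewrite mule0 integral0_eq// => t _.
  by rewrite /torus_weight (negbTE rho0) !mul0r mule0.
apply: (etrans (ge0_integral_orthant mQ Q0)).
apply: eq_integral => r _; apply: eq_integral => s _.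
rewrite /fubini_F -ge0_integralZr//; last 2 first.
- exact: (measurableT_comp mG (pair1_measurable
    (r *: (s : 'cV[R]_n.+1) : vec (measurableTypeR R) n.+1))).
- rewrite lee_fin mulr_ge0//.
  by case: ltP => /= [r0|]; rewrite ?mul0r// mul1r exprn_ge0// ltW.
apply: eq_integral => t _; rewrite /G/= -muleA -EFinM; congr (_ * _%:E)%E.
rewrite /torus_weight /polar_weight.
have [r0|r0] := ltP 0 r; last by rewrite !(mul0r, mulr0).
rewrite positiveZ//; under eq_bigr do rewrite mxE.
rewrite big_split/= prodr_const card_ord.
have [sp|_] /= := boolP (positive s); last by rewrite !(mul0r, mulr0).
(* The power [n] of the radius comes from the orthant formula, the power [n.+1] from the product of
   the rescaled moduli. *)
rewrite (_ : 2 * n.+1 - 1 = n + n.+1)%N; last by rewrite mul2n -addnn addSn subn1.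
by rewrite exprD; ring.
Qed.

Lemma normc_ge0 (z : R[i]) : 0 <= Normc.normc z.
Proof. by case: z => a b; exact: sqrtr_ge0. Qed.

Lemma normcM_real (t : R[i]) (x : R) : 0 <= x ->
  Normc.normc (t * x%:C) = Normc.normc t * x.
Proof.
move=> x0; rewrite Normc.normcM; congr (_ * _).
by rewrite /= expr0n/= addr0 sqrtr_sqr ger0_norm.
Qed.

Lemma cnorm_sqr k (z : 'cV[R[i]]_k) :
  cnorm z ^+ 2 = \sum_i Normc.normc (z i ord0) ^+ 2.
Proof. by rewrite sqr_sqrtr// sumr_ge0// => i _; exact: sqr_ge0. Qed.

Lemma cnorm_ge0 k (z : 'cV[R[i]]_k) : 0 <= cnorm z.
Proof. exact: sqrtr_ge0. Qed.

(** At [z = 0] the value is the first basis vector, so that for positive [k] the result always lies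
    on [pos_sphere]. *)
Definition modulus_part k (z : vec R[i] k) : vec (measurableTypeR R) k :=
  \col_i (if cnorm z == 0 then (val i == 0%N)%:R
          else Normc.normc ((z : 'cV[R[i]]_k) i ord0) / cnorm z).

(** A vanishing coordinate gets phase 1, so that the result always lies on [torus]. *)
Definition phase_part k (z : vec R[i] k) : vec R[i] k :=
  \col_i (if Normc.normc ((z : 'cV[R[i]]_k) i ord0) == 0 then 1
          else (z : 'cV[R[i]]_k) i ord0 * (Normc.normc ((z : 'cV[R[i]]_k) i ord0))^-1%:C).

Lemma measurable_cnorm k :
  measurable_fun setT (fun z : vec R[i] k => cnorm z).
Proof.
apply: (measurableT_comp measurable_sqrt).
apply: measurable_sum => i; apply: measurable_funX.
by apply: measurable_normc; exact: measurable_coord.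
Qed.

Lemma measurable_modulus_part k : measurable_fun setT (@modulus_part k).
Proof.
apply: measurable_vecP => i; under eq_fun do rewrite mxE.
apply: measurable_fun_ifT.
- by apply: measurable_fun_eqr; [exact: measurable_cnorm|exact: measurable_cst].
- exact: measurable_cst.
- apply: measurable_funM; last by apply: measurable_funV; exact: measurable_cnorm.
  by apply: measurable_normc; exact: measurable_coord.
Qed.

Lemma measurable_phase_part k : measurable_fun setT (@phase_part k).
Proof.
apply: measurable_vecP => i; under eq_fun do rewrite mxE.
have mn : measurable_fun setT
    (fun z : vec R[i] k => Normc.normc ((z : 'cV[R[i]]_k) i ord0)).
  by apply: measurable_normc; exact: measurable_coord.
apply: measurable_fun_ifT.
- by apply: measurable_fun_eqr => //; exact: measurable_cst.
- exact: measurable_cst.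
- apply: measurable_funM_complex; first exact: measurable_coord.
  by apply: measurable_real_complex; exact: measurable_funV.
Qed.

Lemma modulus_part_sphere n (z : vec R[i] n.+1) : pos_sphere n.+1 (modulus_part z).
Proof.
split=> [i|].
  by rewrite mxE; case: ifP => _ //; rewrite divr_ge0 ?cnorm_ge0 ?normc_ge0.
apply/eqP; rewrite -(@eqrXn2 _ 2)// ?rnorm_ge0// rnorm_sqr expr1n.
have [z0|z0] := eqVneq (cnorm z) 0.
  rewrite (bigD1 ord0)//= mxE z0 eqxx/= expr1n big1 ?addr0// => i i0.
  rewrite mxE z0 eqxx (_ : (_ == 0)%N = false) ?expr0n//.
  by apply/negbTE; apply: contra i0 => /eqP i0; apply/eqP/val_inj.
under eq_bigr do rewrite mxE (negbTE z0) expr_div_n.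
by rewrite -mulr_suml -cnorm_sqr divff// sqrf_eq0.
Qed.

Lemma normr_normc (z : R[i]) : `|z| = (Normc.normc z)%:C.
Proof. by rewrite normc_def; case: z. Qed.

Lemma normc_phase_part k (z : vec R[i] k) i :
  Normc.normc ((phase_part z : 'cV[R[i]]_k) i ord0) = 1.
Proof.
rewrite mxE; case: ifPn => [_|z0]; first by rewrite Normc.normc1.
by rewrite normcM_real ?divff// invr_ge0 normc_ge0.
Qed.

Lemma phase_part_torus k (z : vec R[i] k) : torus k (phase_part z).
Proof. by move=> i; rewrite normr_normc normc_phase_part. Qed.

(** Valid at every point, including those with vanishing coordinates, where the conventional values
    are multiplied by 0. This makes the two parts an admissible choice of [s] and [t] for every
    [z]. *)
Lemma modulus_phaseE k (z : vec R[i] k) i : (z : 'cV[R[i]]_k) i ord0 =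
  (cnorm z)%:C * ((phase_part z : 'cV[R[i]]_k) i ord0 *
                  ((modulus_part z : 'cV[R]_k) i ord0)%:C).
Proof.
rewrite !mxE; have [z0|z0] := eqVneq (cnorm z) 0.
  rewrite z0 mul0r; apply: Normc.eq0_normc; apply/eqP.
  have /eqP := cnorm_sqr z; rewrite z0 expr0n/= eq_sym psumr_eq0 => [|j _]; last exact: sqr_ge0.
  by move=> /allP/(_ i); rewrite mem_index_enum => /(_ isT); rewrite sqrf_eq0.
case: ifPn => [/eqP n0|n0].
  by rewrite n0 mul0r mul1r mulr0; exact: Normc.eq0_normc.
set w := Normc.normc _ in n0 *; set c := cnorm z in z0 *.
have E : c * (w^-1 * (w / c)) = 1 by field; rewrite n0 z0.
rewrite -[LHS]mulr1 -[1 in LHS]/((1 : R)%:C) -E [in LHS]rmorphM [in LHS]rmorphM.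
by rewrite mulrCA !mulrA.
Qed.

Section polar_point_coordinates.
Variables (k : nat) (r : R) (s : vec (measurableTypeR R) k) (t : vec R[i] k).
Hypotheses (r0 : 0 < r) (s0 : positive s) (s1 : rnorm s = 1).
Hypothesis t1 : unimodular t.
Let z := polar_point (r *: (s : 'cV[R]_k)) t.

Let normc_z i : Normc.normc ((z : 'cV[R[i]]_k) i ord0) = r * (s : 'cV[R]_k) i ord0.
Proof.
have si := forallP s0 i; rewrite !mxE normcM_real ?mulr_ge0 ?ltW//.
by rewrite (eqP (forallP t1 i)) mul1r.
Qed.

Lemma cnorm_polar_point : cnorm z = r.
Proof.
apply/eqP; rewrite -(@eqrXn2 _ 2)// ?cnorm_ge0// ?ltW// cnorm_sqr.
under eq_bigr do rewrite normc_z exprMn.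
by rewrite -mulr_sumr -rnorm_sqr s1 expr1n mulr1.
Qed.

Lemma modulus_polar_point : modulus_part z = s.
Proof.
apply/matrixP => i j; rewrite (ord1 j) mxE cnorm_polar_point gt_eqF// normc_z.
by rewrite mulrAC divff ?mul1r// gt_eqF.
Qed.

Lemma phase_polar_point : phase_part z = t.
Proof.
apply/matrixP => i j; rewrite (ord1 j) mxE normc_z.
have si := forallP s0 i; have rs0 : 0 < r * (s : 'cV[R]_k) i ord0 by exact: mulr_gt0.
rewrite gt_eqF// !mxE -mulrA -rmorphM/= divff ?mulr1// gt_eqF//.
Qed.

End polar_point_coordinates.

(** [polar_weight] vanishes wherever [cnorm], [modulus_part] and [phase_part] might fail to return
    [r], [s] and [t]; elsewhere they invert [polar_point] exactly. *)
Lemma ge0_integral_polar_coordinates n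
    (h : measurableTypeR R * vec (measurableTypeR R) n.+1 * vec R[i] n.+1 -> \bar R) :
  measurable_fun setT h -> (forall p, 0 <= h p)%E ->
  (\int[lebesgueC n.+1]_z h (cnorm z, modulus_part z, phase_part z) =
   \int[leb]_r \int[sphere_measure n.+1]_s \int[torus_haar n.+1]_t
     (h (r, s, t) * (polar_weight r s t)%:E))%E.
Proof.
move=> mh h0.
have mF : measurable_fun setT
    (fun z : vec R[i] n.+1 => h (cnorm z, modulus_part z, phase_part z)).
  apply: (measurableT_comp mh).
  apply/measurable_fun_pairP; split => /=; last exact: measurable_phase_part.
  apply/measurable_fun_pairP; split => /=; last exact: measurable_modulus_part.
  exact: measurable_cnorm.
apply: (etrans (ge0_integral_polar mF (fun z => h0 _))).
apply: eq_integral => r _; apply: eq_integral => s _; apply: eq_integral => t _.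
rewrite /polar_weight; have [r0|r0] := ltP 0 r; last by rewrite !mul0r !mule0.
have [/andP[s0 /eqP s1]|_] := boolP (positive s && _); last by rewrite !(mul0r, mulr0) !mule0.
have [t1|_] := boolP (unimodular t); last by rewrite !mulr0 !mule0.
by rewrite cnorm_polar_point// modulus_polar_point// phase_polar_point.
Qed.

End polar_coordinates.

(** * Separation of radius and angles, and the angular constants *)

Lemma vec_integral_prod d (T : measurableType d) (R : realType)
    (mu : {sigma_finite_measure set T -> \bar R}) n (f : 'I_n -> T -> R)
    (c : 'I_n -> R) :
  (forall i, measurable_fun setT (f i)) -> (forall i x, 0 <= f i x) ->
  (forall i, (\int[mu]_x (f i x)%:E = (c i)%:E)%E) ->
  (\int[vec_measure mu n]_v (\prod_i f i ((v : 'cV[T]_n) i ord0))%:E =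
   (\prod_i c i)%:E)%E.
Proof.
move=> + + + ; elim: n f c => [|n IH] f c mf f0 fc.
  rewrite (vec_integral0 _ (const_mx point)); first by rewrite !big_ord0.
  by under eq_fun do rewrite big_ord0; exact: measurable_cst.
have mP k (g : 'I_k -> T -> R) : (forall i, measurable_fun setT (g i)) ->
    measurable_fun setT (fun v : vec T k => (\prod_i g i ((v : 'cV[T]_k) i ord0))%:E).
  move=> mg; apply/measurable_EFinP; apply: measurable_prod => i _.
  exact: (measurableT_comp (mg i) (measurable_coord i)).
have P0 (v : vec T n.+1) : (0 <= (\prod_i f i ((v : 'cV[T]_n.+1) i ord0))%:E)%E.
  by rewrite lee_fin prodr_ge0.
apply: (etrans (@vec_integralS _ _ _ mu n _ (mP _ _ mf) P0)).
pose g i := f (lift ord0 i).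
transitivity (\int[mu]_x ((f ord0 x)%:E * (\prod_i c (lift ord0 i))%:E))%E.
  apply: eq_integral => x _.
  rewrite -(IH g _ (fun i => mf _) (fun i => f0 _) (fun i => fc _)).
  rewrite -ge0_integralZl_EFin//.
  - apply: eq_integral => v _; rewrite -EFinM big_ord_recl/= mxE unlift_none.
    congr (_ * _)%:E; apply: eq_bigr => i _.
    by rewrite mxE liftK.
  - by move=> v _; rewrite lee_fin prodr_ge0// => i _; exact: f0.
  - by apply: mP => i; exact: mf.
have c0 : 0 <= \prod_i c (lift ord0 i).
  apply: prodr_ge0 => i _; rewrite -lee_fin -fc; apply: integral_ge0 => x _.
  by rewrite lee_fin.
under eq_integral do rewrite muleC.
rewrite ge0_integralZl_EFin//; last 2 first.
- by move=> x _; rewrite lee_fin.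
- exact/measurable_EFinP/mf.
by rewrite fc -EFinM big_ord_recl mulrC.
Qed.

Section radial.
Context {R : realType}.
Notation leb := (@lebesgue_measure R).

Lemma integral_circle_normc :
  (\int[circle_measure]_t (Normc.normc t == 1)%:R%:E = (2 * pi : R)%:E)%E.
Proof.
have m1 : measurable_fun setT (fun t : R[i] => (Normc.normc t == 1)%:R%:E : \bar R).
  apply/measurable_EFinP/measurable_natr_bool.
  by apply: measurable_fun_eqr; [exact: measurable_normc|exact: measurable_cst].
rewrite ge0_integral_circle//.
transitivity (\int[leb]_(t in `]0%R, pi[) (cst (2 : R)%:E t))%E.
  rewrite integral_itv_natr; apply: eq_integral => t _.
  rewrite in_itv/= !sqrrN cos2Dsin2 sqrtr1 eqxx.
  by rewrite -EFinD.
rewrite integral_cst//.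
have E : leb `]0, pi[%classic = (pi : R)%:E.
  by rewrite lebesgue_measure_itv/= lte_fin pi_gt0 -EFinB subr0.
exact: (etrans (congr1 (mule 2%:E) E)).
Qed.

Lemma integral_gaussian_complex a :
  (\int[lebesgue_complex]_z
     (expR (- Normc.normc z ^+ 2) * Normc.normc z ^+ (2 * a))%:E =
   ((pi : R) * a`!%:R)%:E)%E.
Proof.
have mn : measurable_fun setT (fun z : R[i] => Normc.normc z).
  exact: measurable_normc.
have mF : measurable_fun setT (fun z : R[i] =>
    (expR (- Normc.normc z ^+ 2) * Normc.normc z ^+ (2 * a))%:E).
  apply/measurable_EFinP; apply: measurable_funM; last exact: measurable_funX.
  apply: (measurableT_comp (@measurable_expR R)); apply: measurable_funN.
  exact: measurable_funX.
rewrite (ge0_integral_polar_complex mF); last first.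
  by move=> z; rewrite lee_fin mulr_ge0 ?expR_ge0// exprn_ge0// normc_ge0.
pose g (r : R) := (0 < r)%R%:R * r ^+ a.*2.+1 * expR (- r ^+ 2).
have g0 r : 0 <= g r.
  rewrite /g mulr_ge0 ?expR_ge0//.
  by case: ltP => /= [r0|]; rewrite ?mul0r// mul1r exprn_ge0// ltW.
have m1 : measurable_fun setT (fun t : R[i] => (Normc.normc t == 1)%:R%:E : \bar R).
  apply/measurable_EFinP/measurable_natr_bool.
  by apply: measurable_fun_eqr => //; exact: measurable_cst.
have mg : measurable_fun setT (fun r : measurableTypeR R => (g r)%:E).
  apply/measurable_EFinP; apply: measurable_funM; first apply: measurable_funM.
  - apply: measurable_natr_bool.
    by apply: measurable_fun_ltr => //; exact: measurable_cst.
  - exact: measurable_funX.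
  - apply: (measurableT_comp (@measurable_expR R)); apply: measurable_funN.
    exact: measurable_funX.
transitivity (\int[leb]_r ((2 * pi)%:E * (g r)%:E))%E.
  apply: eq_integral => r _.
  rewrite -integral_circle_normc muleC -ge0_integralZl_EFin//.
  apply: eq_integral => t _; rewrite -!EFinM; congr (_%:E).
  rewrite /g; have [r0|r0] := ltP 0 r; last by rewrite !mul0r mulr0.
  rewrite normcM_real ?ltW//.
  have [->|_] := eqVneq (Normc.normc t) 1; last by rewrite !mulr0.
  by rewrite !mul1r !mulr1 -mul2n (exprSr _ (2 * a)); ring.
rewrite ge0_integralZl_EFin ?mulr_ge0 ?pi_ge0//; last by move=> r _; rewrite lee_fin.
rewrite integral_gaussian_pow -EFinM; congr (_%:E).
by field.
Qed.

(** What remains of the polar Jacobian times [\prod_i |z_i| ^+ (2 * e_i)] once the powers of the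
    radius are taken out. *)
Definition angular_weight k (e : 'cV[nat]_k) (s : vec (measurableTypeR R) k)
    (t : vec R[i] k) : R :=
  (positive s && (rnorm s == 1))%:R * \prod_i (s : 'cV[R]_k) i ord0 *
  (unimodular t)%:R * \prod_i (s : 'cV[R]_k) i ord0 ^+ (2 * e i ord0).

Lemma angular_weight_ge0 k (e : 'cV[nat]_k) s t : 0 <= angular_weight e s t.
Proof.
rewrite /angular_weight; have [/andP[/forallP s0 _]|_] := boolP (_ && _).
  rewrite mul1r mulr_ge0//; last first.
    by rewrite prodr_ge0// => i _; rewrite exprn_ge0// ltW.
  by rewrite mulr_ge0// prodr_ge0// => i _; exact/ltW.
by rewrite !mul0r.
Qed.

Lemma measurable_angular_weight k (e : 'cV[nat]_k) : measurable_fun setT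
  (fun p : vec (measurableTypeR R) k * vec R[i] k =>
    (angular_weight e p.1 p.2)%:E : \bar R).
Proof.
apply/measurable_EFinP; apply: measurable_funM;
  first apply: measurable_funM; first apply: measurable_funM.
- apply: measurable_natr_bool; apply: measurable_and.
    exact: (measurableT_comp (@measurable_positive R k) measurable_fst).
  apply: measurable_fun_eqr; last exact: measurable_cst.
  exact: (measurableT_comp (@measurable_rnorm R k) measurable_fst).
- exact: (measurableT_comp (@measurable_prod_coord R k) measurable_fst).
- apply: measurable_natr_bool.
  exact: (measurableT_comp (@measurable_unimodular R k) measurable_snd).
- apply: measurable_prod => i _; apply: measurable_funX.
  exact: (measurableT_comp (measurable_coord i) measurable_fst).
Qed.

(** The monomial modulus is homogeneous of degree twice the sum of [e]; this degree joins the
    Jacobian exponent [2 * n.+1 - 1] and the angles separate. *)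
Lemma ge0_integral_radial_angular n (e : 'cV[nat]_n.+1) (h : measurableTypeR R -> \bar R) :
  measurable_fun setT h -> (forall r, 0 <= h r)%E ->
  (\int[lebesgueC n.+1]_z (h (cnorm z) *
     (\prod_i Normc.normc ((z : 'cV[R[i]]_n.+1) i ord0) ^+ (2 * e i ord0))%:E) =
   \int[leb]_r (h r * ((0 < r)%R%:R * r ^+ (2 * n.+1 + 2 * (\sum_i e i ord0) - 1))%:E) *
   \int[sphere_measure n.+1]_s \int[torus_haar n.+1]_t (angular_weight e s t)%:E)%E.
Proof.
move=> mh h0.
pose F (z : vec R[i] n.+1) := (h (cnorm z) *
  (\prod_i Normc.normc ((z : 'cV[R[i]]_n.+1) i ord0) ^+ (2 * e i ord0))%:E)%E.
have mF : measurable_fun setT F.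
  apply: emeasurable_funM; first exact: (measurableT_comp mh (@measurable_cnorm R _)).
  apply/measurable_EFinP; apply: measurable_prod => i _; apply: measurable_funX.
  by apply: measurable_normc; exact: measurable_coord.
have F0 z : (0 <= F z)%E.
  by rewrite mule_ge0// lee_fin prodr_ge0// => i _; rewrite exprn_ge0// normc_ge0.
apply: (etrans (ge0_integral_polar mF F0)).
have mw := @measurable_angular_weight _ e.
have w0 (p : vec (measurableTypeR R) n.+1 * vec R[i] n.+1) :
  (0 <= (angular_weight e p.1 p.2)%:E)%E by rewrite lee_fin angular_weight_ge0.
have mI := measurable_fun_fubini_tonelli_F (m2 := torus_haar n.+1) _ mw w0.
have I0 s : (0 <= \int[torus_haar n.+1]_t (angular_weight e s t)%:E)%E.
  by apply: integral_ge0 => t _; exact: (w0 (s, t)).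
pose g (r : measurableTypeR R) := ((0 < r)%R%:R * r ^+ (2 * n.+1 + 2 * (\sum_i e i ord0) - 1)).
have g0 r : 0 <= g r.
  by rewrite /g; case: ltP => /= [r0|]; rewrite ?mul0r// mul1r exprn_ge0// ltW.
have mhg : measurable_fun setT (fun r => h r * (g r)%:E)%E.
  apply: emeasurable_funM => //; apply/measurable_EFinP; apply: measurable_funM.
    apply: measurable_natr_bool.
    by apply: measurable_fun_ltr => //; exact: measurable_cst.
  exact: measurable_funX.
have hg0 r : (0 <= h r * (g r)%:E)%E by rewrite mule_ge0// lee_fin.
rewrite -ge0_integralZr//; last by apply: integral_ge0 => s _; exact: I0.
apply: eq_integral => r _.
rewrite -ge0_integralZl//.
apply: eq_integral => s _.
rewrite -ge0_integralZl//; last 2 first.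
- exact: (measurableT_comp mw (pair1_measurable s)).
- by move=> t _; exact: (w0 (s, t)).
apply: eq_integral => t _.
rewrite /F /polar_weight /angular_weight /g.
have [r0|r0] := ltP 0 r; last by rewrite !mul0r !mule0 mul0e.
have [/andP[s0 /eqP s1]|_] := boolP (positive s && _); last by rewrite !(mul0r, mulr0) !mule0.
have [t1|_] := boolP (unimodular t); last by rewrite !(mul0r, mulr0) !mule0.
rewrite cnorm_polar_point// -!muleA -!EFinM; congr (_ * _%:E)%E.
rewrite (eq_bigr (fun i => r ^+ (2 * e i ord0) * (s : 'cV[R]_n.+1) i ord0 ^+ (2 * e i ord0))); last first.
  move=> i _; rewrite !mxE normcM_real; last first.
    by rewrite mulr_ge0 ?ltW// (forallP s0).
  by rewrite (eqP (forallP t1 i)) mul1r exprMn.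
rewrite big_split/= prodrXr -big_distrr/=.
rewrite (_ : 2 * n.+1 + 2 * \sum_i e i ord0 - 1 =
  (2 * n.+1 - 1) + 2 * \sum_i e i ord0)%N; last by rewrite addnBAC// muln_gt0.
by rewrite exprD; ring.
Qed.

Lemma integral_angular_weight n (e : 'cV[nat]_n.+1) :
  (\int[sphere_measure n.+1]_s \int[torus_haar n.+1]_t (angular_weight e s t)%:E =
   (2 * pi ^+ n.+1 * (\prod_i (e i ord0)`!)%N%:R /
     (n.+1 + (\sum_i e i ord0) - 1)`!%:R)%:E)%E.
Proof.
set J := (X in X = _); set S := (\sum_i e i ord0)%N.
pose h1 (r : measurableTypeR R) := (expR (- r ^+ 2))%:E.
have mh1 : measurable_fun setT h1.
  apply/measurable_EFinP; apply: (measurableT_comp (@measurable_expR R)).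
  by apply: measurable_funN; exact: measurable_funX.
have h10 r : (0 <= h1 r)%E by rewrite lee_fin expR_ge0.
have := ge0_integral_radial_angular e mh1 h10; rewrite -/J -/S.
(* The exponent equals [2 * (n + S) + 1], whence the Gaussian moment of index [n + S]; this is the
   factorial of [n.+1 + S - 1] in the denominator of the claim, and its half gives the factor 2. *)
have -> : (\int[leb]_r (h1 r * ((0 < r)%R%:R * r ^+ (2 * n.+1 + 2 * S - 1))%:E) =
    ((n + S)`!%:R / 2)%:E)%E.
  rewrite -integral_gaussian_pow; apply: eq_integral => r _.
  rewrite -EFinM mulrC; congr (_ * _ ^+ _ * _)%:E.
  by rewrite mulnS -mul2n mulnDr -addnA add2n subn1.
pose f (i : 'I_n.+1) (z : R[i]) :=
  expR (- Normc.normc z ^+ 2) * Normc.normc z ^+ (2 * e i ord0).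
have -> : (\int[lebesgueC n.+1]_z (h1 (cnorm z) *
     (\prod_i Normc.normc ((z : 'cV[R[i]]_n.+1) i ord0) ^+ (2 * e i ord0))%:E) =
     (\prod_i (pi * (e i ord0)`!%:R : R))%:E)%E.
  rewrite -(@vec_integral_prod _ _ _ lebesgue_complex n.+1 f).
  - apply: eq_integral => z _; rewrite -EFinM big_split/=; congr (_ * _)%:E.
    by rewrite cnorm_sqr -sumrN expR_sum.
  - move=> i; apply: measurable_funM; last exact/measurable_funX/measurable_normc.
    apply: (measurableT_comp (@measurable_expR R)); apply: measurable_funN.
    exact/measurable_funX/measurable_normc.
  - by move=> i z; rewrite mulr_ge0 ?expR_ge0// exprn_ge0// normc_ge0.
  - by move=> i; exact: integral_gaussian_complex.
rewrite big_split/= prodr_const card_ord -natr_prod => JE.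
have fS : ((n + S)`!%:R : R) != 0 by rewrite pnatr_eq0 -lt0n fact_gt0.
(* [J] is not known to be finite beforehand, so the division is done by multiplying with the inverse
   of the radial factor, a finite nonzero real. *)
rewrite -[J]mul1e (_ : 1%E = (((n + S)`!%:R / 2)^-1 * ((n + S)`!%:R / 2) : R)%:E)%E; last first.
  by rewrite mulVf// mulf_neq0// invr_eq0 pnatr_eq0.
rewrite EFinM -muleA -JE -EFinM addSn subn1/=; congr (_%:E).
by field; rewrite fS.
Qed.

Lemma ge0_integral_radial n (e : 'cV[nat]_n.+1) (h : measurableTypeR R -> \bar R) :
  measurable_fun setT h -> (forall r, 0 <= h r)%E ->
  (\int[lebesgueC n.+1]_z (h (cnorm z) *
     (\prod_i Normc.normc ((z : 'cV[R[i]]_n.+1) i ord0) ^+ (2 * e i ord0))%:E) =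
   (2 * pi ^+ n.+1 * (\prod_i (e i ord0)`!)%N%:R /
     (n.+1 + (\sum_i e i ord0) - 1)`!%:R)%:E *
   \int[leb]_r (h r * ((0 < r)%R%:R * r ^+ (2 * n.+1 + 2 * (\sum_i e i ord0) - 1))%:E))%E.
Proof.
move=> mh h0; by rewrite ge0_integral_radial_angular// integral_angular_weight muleC.
Qed.

End radial.

(** * Products of blocks *)

(** The total dimension and the sum of the first block with the others are only propositionally
    equal, hence the cast. Injectivity of [col_mx] and of the cast identifies the blocks. *)
Lemma col_mx_submxcol (T : Type) m (k : 'I_m.+1 -> nat)
    (eN : (k ord0 + \sum_(l < m) k (lift ord0 l))%N = (\sum_l k l)%N)
    (x : 'cV[T]_(k ord0)) (y : 'cV[T]_(\sum_(l < m) k (lift ord0 l))) :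
  (submxcol (castmx (eN, erefl) (col_mx x y)) ord0 = x) /\
  (forall l, submxcol (castmx (eN, erefl) (col_mx x y)) (lift ord0 l) =
             submxcol y l).
Proof.
set Z := castmx _ _.
have E : castmx (eN, erefl) (col_mx (submxcol Z ord0)
    (\mxcol_l submxcol Z (lift ord0 l))) = castmx (eN, erefl) (col_mx x y).
  rewrite -[RHS]submxcolK mxcol_recu; congr (castmx (_, _) _).
  exact: eq_irrelevance.
have [x' y'] := eq_col_mx (can_inj (castmxK eN erefl) E).
split; first exact: x'.
by move=> l; rewrite -[in RHS]y' mxcolK.
Qed.

Lemma vec_integral_blocks d (T : measurableType d) (R : realType)
    (mu : {sigma_finite_measure set T -> \bar R}) m (k : 'I_m -> nat)
    (f : forall l, vec T (k l) -> R) (c : 'I_m -> R) :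
  (forall l, measurable_fun setT (f l)) -> (forall l v, 0 <= f l v) ->
  (forall l, (\int[vec_measure mu (k l)]_v (f l v)%:E = (c l)%:E)%E) ->
  (\int[vec_measure mu (\sum_l k l)]_z
    (\prod_l f l (submxcol (z : 'cV[T]_(\sum_l k l)) l))%:E = (\prod_l c l)%:E)%E.
Proof.
(* The dimension is generalised so that the induction can replace it by [k ord0] plus the rest, the
   form that [vec_integral_col_mx] splits. *)
suff H N (eN : N = (\sum_l k l)%N) :
    (forall l, measurable_fun setT (f l)) -> (forall l v, 0 <= f l v) ->
    (forall l, (\int[vec_measure mu (k l)]_v (f l v)%:E = (c l)%:E)%E) ->
    (\int[vec_measure mu N]_z
      (\prod_l f l (submxcol (castmx (eN, erefl) (z : 'cV[T]_N)) l))%:E =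
      (\prod_l c l)%:E)%E.
  move=> mf f0 fc; rewrite -(H _ erefl)//.
elim: m k f c N eN => [|m IH] k f c N eN mf f0 fc.
  have N0 : N = 0%N by rewrite eN big_ord0.
  under eq_integral do rewrite big_ord0.
  by rewrite big_ord0; move: N0 => {eN} ->; rewrite (vec_integral0 _ (const_mx point)).
have eN' : N = (k ord0 + \sum_(l < m) k (lift ord0 l))%N by rewrite eN big_ord_recl.
move: eN; rewrite eN' => eN {eN'}.
have mblock l : measurable_fun setT
    (fun z : vec T (k ord0 + \sum_(l < m) k (lift ord0 l)) =>
      submxcol (castmx (eN, erefl) (z : 'cV[T]_(_))) l : vec T (k l)).
  apply: measurable_vecP => i.
  rewrite (_ : (fun z => _) = fun z : vec T _ =>
    (z : 'cV[T]__) (cast_ord (esym eN) (tagnat.Rank l i)) ord0).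
    exact: measurable_coord.
  by apply/funext => z; rewrite /submxcol [LHS]mxE castmxE; congr (z _ _); exact: ord1.
have mF : measurable_fun setT
    (fun z : vec T (k ord0 + \sum_(l < m) k (lift ord0 l)) =>
      (\prod_l f l (submxcol (castmx (eN, erefl) (z : 'cV[T]_(_))) l))%:E).
  apply/measurable_EFinP; apply: measurable_prod => l _.
  exact: (measurableT_comp (mf l) (mblock l)).
have F0 (z : vec T (k ord0 + \sum_(l < m) k (lift ord0 l))) :
    (0 <= (\prod_l f l (submxcol (castmx (eN, erefl) (z : 'cV[T]_(_))) l))%:E)%E.
  by rewrite lee_fin prodr_ge0.
apply: (etrans (vec_integral_col_mx mu mF F0)).
have c0 : 0 <= \prod_l c (lift ord0 l).
  apply: prodr_ge0 => i _; rewrite -lee_fin -fc; apply: integral_ge0 => x _.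
  by rewrite lee_fin.
transitivity (\int[vec_measure mu (k ord0)]_x
    ((\prod_l c (lift ord0 l))%:E * (f ord0 x)%:E))%E.
  apply: eq_integral => x _.
  rewrite -(IH (fun l => k (lift ord0 l)) (fun l => f (lift ord0 l))
    (fun l => c (lift ord0 l)) _ erefl)//.
  rewrite muleC -ge0_integralZl_EFin//.
  - apply: eq_integral => y _.
    have [Zx Zy] := col_mx_submxcol eN x y.
    rewrite big_ord_recl [X in f ord0 X]Zx EFinM; congr (_ * _%:E)%E.
    by apply: eq_bigr => l _; rewrite [X in f _ X]Zy castmx_id.
  - by move=> y _; rewrite lee_fin prodr_ge0.
  - apply/measurable_EFinP; apply: measurable_prod => l _.
    apply: (measurableT_comp (mf _)); apply: measurable_vecP => i.
    rewrite (_ : (fun z => _) = fun z : vec T _ =>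
      (z : 'cV[T]__) (tagnat.Rank l i) ord0).
      exact: measurable_coord.
    by apply/funext => z; rewrite /submxcol castmx_id [LHS]mxE.
rewrite ge0_integralZl_EFin//; last 2 first.
- by move=> x _; rewrite lee_fin.
- by apply/measurable_EFinP; exact: (mf ord0).
by rewrite fc -EFinM big_ord_recl mulrC.
Qed.

Lemma measurable_submxcol d (T : measurableType d) m (k : 'I_m -> nat) l :
  measurable_fun setT (fun z : vec T (\sum_l k l) =>
    submxcol (z : 'cV[T]_(\sum_l k l)) l : vec T (k l)).
Proof.
apply: measurable_vecP => i.
rewrite (_ : (fun z => _) = fun z : vec T _ =>
  (z : 'cV[T]__) (tagnat.Rank l i) ord0).
  exact: measurable_coord.
by apply/funext => z; rewrite /submxcol [LHS]mxE.
Qed.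

(** * Measures determined by their values on boxes *)

Section box_unique.
Context d d' (T : measurableType d) (Y : measurableType d') (R : realType).
Variable m : nat.
Variables mu nu : {measure set (vec T m * Y) -> \bar R}.

Definition box (A : 'I_m -> set T) (D : set Y) : set (vec T m * Y) :=
  [set p | (forall l, A l ((p.1 : 'cV[T]_m) l ord0)) /\ D p.2].

Lemma measurable_box A D : (forall l, measurable (A l)) -> measurable D ->
  measurable (box A D).
Proof.
move=> mA mD.
rewrite (_ : box A D = (\bigcap_(l in [set: 'I_m])
    (fun p : vec T m * Y => (p.1 : 'cV[T]_m) l ord0) @^-1` (A l)) `&` snd @^-1` D).
  apply: measurableI.
    apply: fin_bigcap_measurable => // l _.
    rewrite -[X in measurable X]setTI.
    exact: (measurableT_comp (measurable_coord l) measurable_fst).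
  by rewrite -[X in measurable X]setTI; exact: measurable_snd.
by apply/seteqP; split => p [pA pD]; split => // l; [move=> _|]; exact: pA.
Qed.

(** Boxes are stable under intersection and generate the product sigma-algebra. Finiteness allows
    the whole space, itself a box, as exhausting sequence. *)
Lemma box_measure_unique : (mu setT < +oo)%E ->
  (forall A D, (forall l, measurable (A l)) -> measurable D ->
    mu (box A D) = nu (box A D)) ->
  forall E, measurable E -> mu E = nu E.
Proof.
move=> muoo munu.
pose G := [set E | exists A D, [/\ forall l, measurable (A l), measurable D &
                                  E = box A D]].
have GT : G setT.
  by exists (fun=> setT), setT; split => //; apply/seteqP; split.
apply: (@measure_unique _ R _ G (fun=> setT)) => //.
(* Measurability of the identity from the generated sigma-algebra to the product one gives the
   inclusion, and it can be tested on each coordinate. *)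
- apply/seteqP; split.
    pose id_ : g_sigma_algebraType G -> vec T m * Y := id.
    suff : measurable_fun setT id_ by move=> mid E mE; rewrite -[E]setTI; exact: mid.
    apply/measurable_fun_pairP; split.
      apply: measurable_vecP => l _ A mA; rewrite setTI.
      apply: sub_sigma_algebra; exists (fun l' => if l' == l then A else setT), setT.
      split=> [l'||] //; first by case: ifP.
      apply/seteqP; split => p /=.
        by move=> pA; split=> // l'; case: eqP => // ->.
      by move=> [/(_ l)]; rewrite eqxx.
    move=> _ D mD; rewrite setTI; apply: sub_sigma_algebra.
    exists (fun=> setT), D; split => //.
    by apply/seteqP; split => p //= [].
  apply: smallest_sub; first exact: sigma_algebra_measurable.
  by move=> _ [A [D [mA mD ->]]]; exact: measurable_box.
- move=> _ _ [A [D [mA mD ->]]] [A' [D' [mA' mD' ->]]].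
  exists (fun l => A l `&` A' l), (D `&` D'); split.
  + by move=> l; exact: measurableI.
  + exact: measurableI.
  + apply/seteqP; split => p.
      by move=> [[pA pD] [pA' pD']]; split; [move=> l|]; split.
    by move=> [pA [pD pD']]; split; split => // l; have [] := pA l.
- by rewrite bigcup_const.
- by move=> _ [A [D [mA mD ->]]]; exact: munu.
Qed.

End box_unique.

Section sigma_finite_product.
Context d d' (T : measurableType d) (T' : measurableType d') (R : realType).
Variables (mu : {sigma_finite_measure set T -> \bar R}).
Variables (nu : {sigma_finite_measure set T' -> \bar R}).

(* [mu \x nu] has no canonical structure of sigma-finite measure. *)
Definition sigma_finite_product :
    {sigma_finite_measure set (T * T')%type -> \bar R} :=
  HB.pack_for {sigma_finite_measure set (T * T')%type -> \bar R}
    (mu \x nu)%E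
    (Measure_isSigmaFinite.Build _ _ _ (mu \x nu)%E
      (product_measure1_sigma_finite mu nu)).

Lemma ge0_integral_product (F : T * T' -> \bar R) :
  measurable_fun setT F -> (forall x, 0 <= F x)%E ->
  (\int[sigma_finite_product]_p F p = \int[mu]_x \int[nu]_y F (x, y))%E.
Proof. by move=> mF F0; exact: fubini_tonelli1. Qed.

End sigma_finite_product.

Lemma measurable_prod_cond d (T : measurableType d) (R : realType) (I : finType)
    (P : pred I) (f : I -> T -> R) : (forall i, measurable_fun setT (f i)) ->
  measurable_fun setT (fun x => \prod_(i | P i) f i x).
Proof.
move=> mf; under eq_fun do rewrite -big_filter.
by apply: measurable_prod => i _; exact: mf.
Qed.

(** * Densities on the blocks and the values of box integrals *)

Section angular_measure.
Context {R : realType}.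
Notation leb := (@lebesgue_measure R).
Notation rvec := (vec (measurableTypeR R)).

Definition polar_product k :
    {sigma_finite_measure set (rvec k * vec R[i] k)%type -> \bar R} :=
  sigma_finite_product (sphere_measure k) (torus_haar k).

Definition angular k (y : rvec k * vec R[i] k) : R :=
  angular_weight (const_mx 0%N) y.1 y.2.

Lemma angular_ge0 k (y : rvec k * vec R[i] k) : 0 <= angular y.
Proof. exact: angular_weight_ge0. Qed.

Lemma measurable_angular k : measurable_fun setT (@angular k).
Proof. by apply/measurable_EFinP; exact: measurable_angular_weight. Qed.

Lemma polar_weightE k (r : R) (s : rvec k) t :
  polar_weight r s t = (0 < r)%R%:R * r ^+ (2 * k - 1) * angular (s, t).
Proof.
rewrite /angular /polar_weight /angular_weight; congr (_ * _).
rewrite [X in _ = _ * X]big1 ?mulr1// => i _.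
by rewrite mxE muln0 expr0.
Qed.

Lemma integral_angular_lty k : (0 < k)%N ->
  (\int[polar_product k]_y (angular y)%:E < +oo)%E.
Proof.
case: k => // n _.
rewrite (ge0_integral_product (sphere_measure n.+1) (torus_haar n.+1)
  (F := EFin \o @angular n.+1)).
- by rewrite /angular/= integral_angular_weight ltry.
- by apply/measurable_EFinP; exact: measurable_angular.
- by move=> y; rewrite lee_fin angular_ge0.
Qed.

(** This serves block [j], whose angles have to survive; [ge0_integral_radial_gt0] serves the other
    blocks, whose angles are integrated out. *)
Lemma ge0_integral_polar_separate k (h1 : measurableTypeR R -> R)
    (h2 : rvec k * vec R[i] k -> R) : (0 < k)%N ->
  measurable_fun setT h1 -> (forall r, 0 <= h1 r) ->
  measurable_fun setT h2 -> (forall y, 0 <= h2 y) ->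
  (\int[lebesgueC k]_z (h1 (cnorm z) * h2 (modulus_part z, phase_part z))%:E =
   \int[leb]_r (h1 r * ((0 < r)%R%:R * r ^+ (2 * k - 1)))%:E *
   \int[polar_product k]_y (h2 y * angular y)%:E)%E.
Proof.
case: k h2 => // n h2 _ mh1 h10 mh2 h20.
pose h (p : measurableTypeR R * rvec n.+1 * vec R[i] n.+1) :=
  (h1 p.1.1 * h2 (p.1.2, p.2))%:E.
have mh : measurable_fun setT h.
  apply/measurable_EFinP; apply: measurable_funM.
    apply: (measurableT_comp mh1).
    exact: (measurableT_comp measurable_fst measurable_fst).
  apply: (measurableT_comp mh2); apply/measurable_fun_pairP; split => /=.
    exact: (measurableT_comp measurable_snd measurable_fst).
  exact: measurable_snd.
have h0 p : (0 <= h p)%E by rewrite lee_fin mulr_ge0.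
apply: (etrans (ge0_integral_polar_coordinates mh h0)).
have ma : measurable_fun setT (fun y => (h2 y * @angular n.+1 y)%:E).
  apply/measurable_EFinP; apply: measurable_funM => //; exact: measurable_angular.
have a0 y : (0 <= (h2 y * @angular n.+1 y)%:E)%E by rewrite lee_fin mulr_ge0// angular_ge0.
rewrite (ge0_integral_product (sphere_measure n.+1) (torus_haar n.+1) ma a0).
have mI := measurable_fun_fubini_tonelli_F (m2 := torus_haar n.+1) _ ma a0.
have I0 s : (0 <= fubini_F (torus_haar n.+1) (fun y => (h2 y * @angular n.+1 y)%:E) s)%E.
  by apply: integral_ge0 => t _; exact: a0.
have g0 r : 0 <= h1 r * ((0 < r)%R%:R * r ^+ (2 * n.+1 - 1)).
  by rewrite mulr_ge0//; case: ltP => /= [r0|]; rewrite ?mul0r// mul1r exprn_ge0// ltW.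
have mg : measurable_fun setT
    (fun r => (h1 r * ((0 < r)%R%:R * r ^+ (2 * n.+1 - 1)))%:E).
  apply/measurable_EFinP; apply: measurable_funM => //; apply: measurable_funM.
    apply: measurable_natr_bool.
    by apply: measurable_fun_ltr => //; exact: measurable_cst.
  exact: measurable_funX.
rewrite -ge0_integralZr//; last 2 first.
- by move=> r _; rewrite lee_fin.
- by apply: integral_ge0 => s _; exact: I0.
apply: eq_integral => r _.
rewrite -(ge0_integralZl _ measurableT mI (fun s _ => I0 s)) ?lee_fin//.
apply: eq_integral => s _.
have mt : measurable_fun setT (fun t => (h2 (s, t) * angular (s, t))%:E).
  exact: (measurableT_comp ma (pair1_measurable s)).
have t0 t : [set: vec R[i] n.+1] t -> (0 <= (h2 (s, t) * angular (s, t))%:E)%E.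
  by move=> _; exact: a0.
rewrite /fubini_F -(ge0_integralZl _ measurableT mt t0) ?lee_fin//.
apply: eq_integral => t _.
by rewrite /h/= polar_weightE -!EFinM; congr (_%:E); ring.
Qed.

Lemma ge0_integral_radial_gt0 k (e : 'cV[nat]_k) (h : measurableTypeR R -> R) :
  (0 < k)%N -> measurable_fun setT h -> (forall r, 0 <= h r) ->
  (\int[lebesgueC k]_z (h (cnorm z) *
     \prod_i Normc.normc ((z : 'cV[R[i]]_k) i ord0) ^+ (2 * e i ord0))%:E =
   (2 * pi ^+ k * (\prod_i (e i ord0)`!)%N%:R /
     (k + (\sum_i e i ord0) - 1)`!%:R)%:E *
   \int[leb]_r (h r * ((0 < r)%R%:R * r ^+ (2 * k + 2 * (\sum_i e i ord0) - 1)))%:E)%E.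
Proof.
case: k e => // n e _ mh h0.
under eq_integral do rewrite EFinM.
rewrite (@ge0_integral_radial R n e (EFin \o h))//.
by apply/measurable_EFinP.
Qed.

End angular_measure.

Section block_polar.
Context {R : realType} {m : nat}.
Notation leb := (@lebesgue_measure R).
Notation rvec := (vec (measurableTypeR R)).
Variables (k : 'I_m -> nat) (j : 'I_m).
Hypothesis hk : forall l, (0 < k l)%N.
Variable e : forall l, 'cV[nat]_(k l).
Notation N := (\sum_l k l)%N.

(** Block [j] keeps the bare Jacobian exponent because its monomials stay in the integrand;
    elsewhere the degree of the monomial modulus is absorbed. *)
Definition block_exponent (l : 'I_m) : nat :=
  if l == j then (2 * k l - 1)%N
  else (2 * k l + 2 * (\sum_i e l i ord0) - 1)%N.

(** Total angular mass of the block, as computed by [integral_angular_weight]. *)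
Definition block_constant (l : 'I_m) : R :=
  2 * pi ^+ k l * (\prod_i (e l i ord0)`!)%N%:R /
    (k l + (\sum_i e l i ord0) - 1)`!%:R.

Definition block_coordinates (z : vec R[i] N) : rvec m * (rvec (k j) * vec R[i] (k j)) :=
  (block_norms (z : 'cV[R[i]]_N), (modulus_part (submxcol (z : 'cV[R[i]]_N) j),
   phase_part (submxcol (z : 'cV[R[i]]_N) j))).

Definition block_monomial (z : vec R[i] N) : R :=
  \prod_(l | l != j) \prod_i
    Normc.normc (submxcol (z : 'cV[R[i]]_N) l i ord0) ^+ (2 * e l i ord0).

Definition radial_density (l : 'I_m) (r : R) : R :=
  (0 < r)%R%:R * r ^+ block_exponent l.

Definition gaussian n (r : 'cV[R]_n) : R := expR (- \sum_l r l ord0 ^+ 2).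

Definition block_density (p : rvec m * (rvec (k j) * vec R[i] (k j))) : R :=
  (\prod_(l | l != j) block_constant l) *
  ((\prod_l radial_density l ((p.1 : 'cV[R]_m) l ord0)) * angular p.2).

Lemma radial_density_ge0 l r : 0 <= radial_density l r.
Proof.
rewrite /radial_density; case: ltP => /= [r0|]; rewrite ?mul0r// mul1r.
by rewrite exprn_ge0// ltW.
Qed.

Lemma measurable_radial_density l :
  measurable_fun setT (radial_density l : measurableTypeR R -> R).
Proof.
apply: measurable_funM; last exact: measurable_funX.
apply: measurable_natr_bool.
by apply: measurable_fun_ltr => //; exact: measurable_cst.
Qed.

Lemma block_constant_ge0 l : 0 <= block_constant l.
Proof. by rewrite divr_ge0// mulr_ge0// mulr_ge0// exprn_ge0// pi_ge0. Qed.

Lemma block_density_ge0 p : 0 <= block_density p.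
Proof.
rewrite mulr_ge0 ?prodr_ge0// => [l _|]; first exact: block_constant_ge0.
by rewrite mulr_ge0 ?angular_ge0// prodr_ge0// => l _; exact: radial_density_ge0.
Qed.

Lemma measurable_block_density : measurable_fun setT block_density.
Proof.
apply: measurable_funM; first exact: measurable_cst.
apply: measurable_funM; last exact: (measurableT_comp (@measurable_angular R _) measurable_snd).
apply: measurable_prod => l _.
apply: (measurableT_comp (measurable_radial_density l)).
exact: (measurableT_comp (measurable_coord l) measurable_fst).
Qed.

Lemma measurable_block_norms :
  measurable_fun setT (fun z : vec R[i] N => block_norms (z : 'cV[R[i]]_N) : rvec m).
Proof.
apply: measurable_vecP => l.
rewrite (_ : (fun z => _) = fun z : vec R[i] N => cnorm (submxcol (z : 'cV[R[i]]_N) l)).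
  exact: (measurableT_comp (@measurable_cnorm R (k l)) (@measurable_submxcol _ _ _ k l)).
by apply/funext => z; rewrite /block_norms [LHS]mxE.
Qed.

Lemma measurable_block_coordinates : measurable_fun setT block_coordinates.
Proof.
apply/measurable_fun_pairP; split => /=; first exact: measurable_block_norms.
apply/measurable_fun_pairP; split => /=.
  exact: (measurableT_comp (@measurable_modulus_part R _) (@measurable_submxcol _ _ _ k j)).
exact: (measurableT_comp (@measurable_phase_part R _) (@measurable_submxcol _ _ _ k j)).
Qed.

Lemma measurable_block_monomial : measurable_fun setT block_monomial.
Proof.
apply: measurable_prod_cond => l; apply: measurable_prod => i _.
apply: measurable_funX; apply: measurable_normc.
exact: (measurableT_comp (measurable_coord i) (@measurable_submxcol _ _ _ k l)).
Qed.

Lemma block_monomial_ge0 z : 0 <= block_monomial z.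
Proof.
apply: prodr_ge0 => l _; apply: prodr_ge0 => i _.
by rewrite exprn_ge0// normc_ge0.
Qed.

Lemma gaussian_ge0 n (r : 'cV[R]_n) : 0 <= gaussian r.
Proof. exact: expR_ge0. Qed.

Lemma gaussian_prod n (r : 'cV[R]_n) :
  gaussian r = \prod_l expR (- r l ord0 ^+ 2).
Proof. by rewrite /gaussian -sumrN expR_sum. Qed.

Lemma measurable_gaussian n : measurable_fun setT (@gaussian n : rvec n -> R).
Proof.
apply: (measurableT_comp (@measurable_expR R)); apply: measurable_funN.
apply: measurable_sum => l; apply: measurable_funX; exact: measurable_coord.
Qed.

Lemma integral_radial_density (A : set R) l : measurable A ->
  (\int[leb]_r (\1_A r * expR (- r ^+ 2) * radial_density l r)%:E)%E \is a fin_num.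
Proof.
move=> mA.
(* As [k l] is positive the exponent is odd in both cases, and the Gaussian moment of index [b]
   dominates the integral. *)
have [b bE] : exists b, block_exponent l = b.*2.+1.
  rewrite /block_exponent; case: ifP => _.
    by exists (k l).-1; rewrite -[in LHS](prednK (hk l)) mulnS add2n subn1 mul2n.
  move: (\sum_i e l i ord0)%N => S; exists ((k l).-1 + S)%N.
  by rewrite -[in LHS](prednK (hk l)) mulnS -addnA add2n subn1 -mulnDr mul2n.
have mexp : measurable_fun setT (fun r : measurableTypeR R => expR (- r ^+ 2)).
  apply: (measurableT_comp (@measurable_expR R)); apply: measurable_funN.
  exact: measurable_funX.
have mr := measurable_radial_density l.
have f0 r : 0 <= \1_A r * expR (- r ^+ 2) * radial_density l r.
  by rewrite mulr_ge0 ?radial_density_ge0// mulr_ge0 ?expR_ge0.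
rewrite ge0_fin_numE; last by apply: integral_ge0 => r _; rewrite lee_fin.
apply: (@le_lt_trans _ _ (b`!%:R / 2 : R)%:E); last exact: ltry.
rewrite -integral_gaussian_pow -bE; apply: ge0_le_integral => //.
- by move=> r _; rewrite lee_fin.
- apply/measurable_EFinP; by do 2 apply: measurable_funM => //.
- by apply/measurable_EFinP; apply: measurable_funM.
- move=> r _; rewrite lee_fin mulrC ler_wpM2l ?radial_density_ge0//.
  by rewrite ler_piMl ?expR_ge0// indicE; case: (_ \in _).
Qed.

Section box_values.
Variables (A : 'I_m -> set R) (D : set (rvec (k j) * vec R[i] (k j))).
Hypotheses (mA : forall l, measurable (A l)) (mD : measurable D).

Let h l (r : measurableTypeR R) : R := \1_(A l) r * expR (- r ^+ 2).

Let mh l : measurable_fun setT (h l).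
Proof.
apply: measurable_funM; first by apply: measurable_indic; exact: mA.
apply: (measurableT_comp (@measurable_expR R)); apply: measurable_funN.
exact: measurable_funX.
Qed.

Let h0 l r : 0 <= h l r.
Proof. by rewrite mulr_ge0 ?expR_ge0. Qed.

Let hd l (r : measurableTypeR R) : R := h l r * radial_density l r.

Let mhd l : measurable_fun setT (hd l).
Proof. by apply: measurable_funM => //; exact: measurable_radial_density. Qed.

Let hd0 l r : 0 <= hd l r.
Proof. by rewrite mulr_ge0 ?radial_density_ge0. Qed.

Let a l : R := fine (\int[leb]_r (hd l r)%:E)%E.

Let aE l : (\int[leb]_r (hd l r)%:E = (a l)%:E)%E.
Proof. by rewrite fineK// integral_radial_density. Qed.

Let da : R :=
  fine (\int[polar_product (k j)]_y (\1_D y * angular y)%:E)%E.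

Let mDa : measurable_fun setT (fun y => \1_D y * @angular R (k j) y).
Proof. by apply: measurable_funM; [apply: measurable_indic|exact: measurable_angular]. Qed.

Let Da0 y : 0 <= \1_D y * @angular R (k j) y.
Proof. by rewrite mulr_ge0 ?angular_ge0. Qed.

Let daE : (\int[polar_product (k j)]_y
  (\1_D y * angular y)%:E = da%:E)%E.
Proof.
rewrite fineK// ge0_fin_numE; last by apply: integral_ge0 => y _; rewrite lee_fin.
apply: le_lt_trans (@integral_angular_lty R (k j) (hk j)).
apply: ge0_le_integral => //.
- by move=> y _; rewrite lee_fin.
- by apply/measurable_EFinP; exact: mDa.
- by apply/measurable_EFinP; exact: measurable_angular.
- by move=> y _; rewrite lee_fin ler_piMl ?angular_ge0.
Qed.

(** Common value of the two box integrals, each of which is computed separately below; being a real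
    number it also gives finiteness. *)
Let value : R := (\prod_(l | l != j) block_constant l) * ((\prod_l a l) * da).

Let f0 l (v : vec R[i] (k l)) : R :=
  h l (cnorm v) * \prod_i Normc.normc ((v : 'cV[R[i]]_(k l)) i ord0) ^+ (2 * e l i ord0).

Let fj (v : vec R[i] (k j)) : R :=
  h j (cnorm v) * \1_D (modulus_part v, phase_part v).

(** One integrand per block, with an exception at [j]. The type depends on the block, so the
    exception is made by [dfwith] and not by a boolean test. *)
Let f : forall l, vec R[i] (k l) -> R :=
  @eqtype.dfwith _ (fun l => vec R[i] (k l) -> R) (@f0) j fj.

Let c l : R := if l == j then a j * da else block_constant l * a l.

(** The indicator of a box, the Gaussian and the monomial all split over the blocks, which turns the
    integral into a product of one-block integrals. *)
Lemma integral_box_blocks :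
  (\int[lebesgueC N]_z (\1_(box A D) (block_coordinates z) *
    (gaussian (block_norms (z : 'cV[R[i]]_N)) * block_monomial z))%:E = value%:E)%E.
Proof.
have mI : measurable_fun setT (\1_D : _ -> R) by apply: measurable_indic.
have mf l : measurable_fun setT (@f l).
  rewrite /f; case: eqtype.dfwithP => [|l' _].
    apply: measurable_funM.
      exact: (measurableT_comp (mh j) (@measurable_cnorm R (k j))).
    apply: (measurableT_comp mI).
    by apply/measurable_fun_pairP; split => /=;
      [exact: measurable_modulus_part|exact: measurable_phase_part].
  apply: measurable_funM.
    exact: (measurableT_comp (mh l') (@measurable_cnorm R (k l'))).
  apply: measurable_prod => i _; apply: measurable_funX.
  by apply: measurable_normc; exact: measurable_coord.
have f_ge0 l v : 0 <= @f l v.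
  rewrite /f; move: v; case: eqtype.dfwithP => [v|l' _ v]; rewrite mulr_ge0//.
  by apply: prodr_ge0 => i _; rewrite exprn_ge0// normc_ge0.
have fc l : (\int[vec_measure lebesgue_complex (k l)]_v (@f l v)%:E = (c l)%:E)%E.
  rewrite /f /c; case: eqtype.dfwithP => [|l' jl].
    rewrite eqxx EFinM -aE -daE.
    rewrite (ge0_integral_polar_separate (hk j) (mh j) (h0 j) mI)//.
    by congr (_ * _)%E; apply: eq_integral => r _;
      rewrite /hd /radial_density /block_exponent eqxx.
  rewrite eq_sym (negbTE jl) EFinM -aE.
  rewrite (ge0_integral_radial_gt0 (e l') (hk l') (mh l') (h0 l')).
  by congr (_ * _)%E; apply: eq_integral => r _;
      rewrite /hd /radial_density /block_exponent eq_sym (negbTE jl).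
transitivity ((\prod_l c l)%:E : \bar R); last first.
  congr (_%:E); rewrite /value (bigD1 j)//= /c eqxx.
  rewrite (eq_bigr (fun l => block_constant l * a l)); last by move=> l /negbTE ->.
  rewrite big_split/= (_ : \prod_l a l = a j * \prod_(l | l != j) a l).
    by ring.
  by rewrite (bigD1 j).
rewrite -(vec_integral_blocks mf f_ge0 fc).
apply: eq_integral => z _; congr (_%:E).
have -> : \1_(box A D) (block_coordinates z) =
    (\prod_l \1_(A l) (cnorm (submxcol (z : 'cV[R[i]]_N) l))) *
    \1_D (modulus_part (submxcol (z : 'cV[R[i]]_N) j),
          phase_part (submxcol (z : 'cV[R[i]]_N) j)) :> R.
  rewrite !indicE; under eq_bigr do rewrite indicE.
  rewrite prod_natr_bool -natrM mulnb; congr (nat_of_bool _)%:R.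
  apply/idP/andP.
    rewrite inE => -[/= zA zD]; split; last by rewrite inE.
    by apply/forallP => l; rewrite inE; have := zA l; rewrite /block_norms mxE.
  move=> [/forallP zA]; rewrite !inE => zD; split => //= l.
  by have := zA l; rewrite inE /block_norms [X in _ -> A l X]mxE.
have -> : gaussian (block_norms (z : 'cV[R[i]]_N)) =
    \prod_l expR (- cnorm (submxcol (z : 'cV[R[i]]_N) l) ^+ 2).
  by rewrite gaussian_prod; apply: eq_bigr => l _; rewrite /block_norms [in LHS]mxE.
rewrite (bigD1 j)//= [X in _ * (X * _)](bigD1 j)//= [RHS](bigD1 j)//=.
rewrite /f eqtype.dfwith_in /fj /h.
rewrite [in RHS](eq_bigr (fun l => \1_(A l) (cnorm (submxcol (z : 'cV[R[i]]_N) l)) *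
   expR (- cnorm (submxcol (z : 'cV[R[i]]_N) l) ^+ 2) *
   \prod_i Normc.normc (submxcol (z : 'cV[R[i]]_N) l i ord0) ^+ (2 * e l i ord0))); last first.
  by move=> l lj; rewrite eqtype.dfwith_out// eq_sym.
by rewrite !big_split/= -/(block_monomial z); ring.
Qed.

Lemma integral_box_density :
  (\int[sigma_finite_product (lebesgueR m) (polar_product (k j))]_p
    (\1_(box A D) p * (gaussian (p.1 : 'cV[R]_m) * block_density p))%:E =
   value%:E)%E.
Proof.
pose g (p : rvec m * (rvec (k j) * vec R[i] (k j))) : R :=
  (\prod_(l | l != j) block_constant l) *
  ((\prod_l hd l ((p.1 : 'cV[R]_m) l ord0)) * (\1_D p.2 * angular p.2)).
have K0 : 0 <= \prod_(l | l != j) block_constant l.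
  by apply: prodr_ge0 => l _; exact: block_constant_ge0.
have mhd1 : measurable_fun setT
    (fun r : rvec m => \prod_l hd l ((r : 'cV[R]_m) l ord0)).
  apply: measurable_prod => l _; exact: (measurableT_comp (mhd l) (measurable_coord l)).
have mg : measurable_fun setT (EFin \o g).
  apply/measurable_EFinP; apply: measurable_funM; first exact: measurable_cst.
  apply: measurable_funM; first exact: (measurableT_comp mhd1 measurable_fst).
  exact: (measurableT_comp mDa measurable_snd).
have g0 p : (0 <= (EFin \o g) p)%E.
  rewrite lee_fin mulr_ge0// mulr_ge0// prodr_ge0// => l _; exact: hd0.
have gE p : \1_(box A D) p * (gaussian (p.1 : 'cV[R]_m) * block_density p) = g p.
  have -> : \1_(box A D) p =
      (\prod_l \1_(A l) ((p.1 : 'cV[R]_m) l ord0)) * \1_D p.2 :> R.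
    rewrite !indicE; under eq_bigr do rewrite indicE.
    rewrite prod_natr_bool -natrM mulnb; congr (nat_of_bool _)%:R.
    apply/idP/andP.
      rewrite inE => -[zA zD]; split; last by rewrite inE.
      by apply/forallP => l; rewrite inE; exact: zA.
    move=> [/forallP zA]; rewrite !inE => zD; split => // l.
    by have := zA l; rewrite inE.
  rewrite /g /block_density gaussian_prod.
  have -> : \prod_l hd l ((p.1 : 'cV[R]_m) l ord0) =
      (\prod_l \1_(A l) ((p.1 : 'cV[R]_m) l ord0)) *
      (\prod_l expR (- (p.1 : 'cV[R]_m) l ord0 ^+ 2)) *
      \prod_l radial_density l ((p.1 : 'cV[R]_m) l ord0).
    by rewrite -!big_split.
  by ring.
have -> : (fun p : rvec m * (rvec (k j) * vec R[i] (k j)) =>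
    (\1_(box A D) p * (gaussian (p.1 : 'cV[R]_m) * block_density p))%:E) = EFin \o g.
  by apply/funext => p; rewrite gE.
rewrite (ge0_integral_product (lebesgueR m) (polar_product (k j)) mg g0) /value.
have c0 : 0 <= (\prod_(l | l != j) block_constant l) * da.
  rewrite mulr_ge0// -lee_fin -daE.
  by apply: integral_ge0 => y _; rewrite lee_fin.
transitivity (\int[lebesgueR m]_r
    (((\prod_(l | l != j) block_constant l) * da)%:E *
     (\prod_l hd l ((r : 'cV[R]_m) l ord0))%:E))%E.
  apply: eq_integral => r _.
  have p0 : 0 <= (\prod_(l | l != j) block_constant l) *
      \prod_l hd l ((r : 'cV[R]_m) l ord0).
    by rewrite mulr_ge0// prodr_ge0// => l _; exact: hd0.
  transitivity ((((\prod_(l | l != j) block_constant l) *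
      \prod_l hd l ((r : 'cV[R]_m) l ord0))%:E * da%:E)%E).
    rewrite -daE -ge0_integralZl_EFin//.
    - by apply: eq_integral => y _; rewrite -EFinM /g /= mulrA.
    - by move=> y _; rewrite lee_fin.
    - by apply/measurable_EFinP; exact: mDa.
  by rewrite -!EFinM mulrAC.
rewrite ge0_integralZl_EFin//; last 2 first.
- by move=> r _; rewrite lee_fin prodr_ge0// => l _; exact: hd0.
- by apply/measurable_EFinP; exact: mhd1.
rewrite (@vec_integral_prod _ _ _ leb m hd a mhd hd0 aE) -EFinM.
by congr (_%:E); ring.
Qed.

End box_values.

End block_polar.

(** * Block polar coordinates *)

Section box_transfer.
Context d d0 d' (T : measurableType d) (T0 : measurableType d0)
  (Y : measurableType d') (R : realType) (m : nat).
Variables (mu : {sigma_finite_measure set T0 -> \bar R}).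
Variables (nu : {sigma_finite_measure set (vec T m * Y)%type -> \bar R}).
Variables (phi : T0 -> (vec T m * Y)%type) (w1 : T0 -> R) (w2 : (vec T m * Y)%type -> R).
Hypothesis mphi : measurable_fun setT phi.
Hypothesis mw1 : measurable_fun setT w1.
Hypothesis w10 : forall x, 0 <= w1 x.
Hypothesis mw2 : measurable_fun setT w2.
Hypothesis w20 : forall x, 0 <= w2 x.

Let image : {measure set (vec T m * Y)%type -> \bar R}.
Proof.
unshelve refine (pushforward (density_measure mu mw1 w10) phi
  : {measure set (vec T m * Y)%type -> \bar R}).
exact: mphi.
Defined.

(** The image of the measure with density [w1] is finite and agrees on boxes with the measure of
    density [w2], hence they are equal, and integrals of any nonnegative [h] agree. *)
Lemma ge0_integral_box_transfer (h : (vec T m * Y)%type -> \bar R) :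
  (\int[mu]_x (w1 x)%:E < +oo)%E ->
  (forall A D, (forall l, measurable (A l)) -> measurable D ->
    \int[mu]_x (\1_(box A D) (phi x) * w1 x)%:E =
    \int[nu]_p (\1_(box A D) p * w2 p)%:E)%E ->
  measurable_fun setT h -> (forall p, 0 <= h p)%E ->
  (\int[mu]_x (h (phi x) * (w1 x)%:E) = \int[nu]_p (h p * (w2 p)%:E))%E.
Proof.
move=> foo boxE mh h0.
have E : forall A, measurable A -> image A = density_measure nu mw2 w20 A.
  apply: box_measure_unique.
    by rewrite /= /image /pushforward preimage_setT.
  move=> A D mA mD.
  transitivity (\int[mu]_(x in phi @^-1` box A D) (w1 x)%:E)%E => //.
  transitivity (\int[nu]_(x in box A D) (w2 x)%:E)%E => //.
  rewrite integral_mkcond (integral_mkcond (box A D)).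
  have := boxE A D mA mD.
  rewrite (_ : (fun x => (\1_(box A D) (phi x) * w1 x)%:E) =
    (fun x => (w1 x)%:E) \_ (phi @^-1` box A D)); last first.
    apply/funext => x; rewrite patchE indicE.
    have -> : (x \in phi @^-1` box A D) = (phi x \in box A D).
      by apply/idP/idP; rewrite !inE.
    by case: ifP; rewrite ?mul1r ?mul0r.
  rewrite (_ : (fun p => (\1_(box A D) p * w2 p)%:E) =
    (fun x => (w2 x)%:E) \_ (box A D)) => [->//|].
  by apply/funext => x; rewrite patchE indicE; case: ifP; rewrite ?mul1r ?mul0r.
have mhp : measurable_fun setT (h \o phi) by exact: (measurableT_comp mh mphi).
rewrite -(ge0_integral_density nu mw2 w20 mh h0).
apply: (etrans (esym (ge0_integral_density mu mw1 w10 mhp (fun x => h0 (phi x))))).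
transitivity (\int[image]_p h p)%E.
  by rewrite ge0_integral_pushforward.
by apply: eq_measure_integral => A mA _; exact: E.
Qed.

End box_transfer.

Section block_polar_coordinates.
Context {R : realType} {m : nat}.
Notation leb := (@lebesgue_measure R).
Notation rvec := (vec (measurableTypeR R)).
Variables (k : 'I_m -> nat) (j : 'I_m).
Hypothesis hk : forall l, (0 < k l)%N.
Variable e : forall l, 'cV[nat]_(k l).
Notation N := (\sum_l k l)%N.

Lemma ge0_integral_block_polar
    (h : (rvec m * (rvec (k j) * vec R[i] (k j)))%type -> \bar R) :
  measurable_fun setT h -> (forall p, 0 <= h p)%E ->
  (\int[lebesgueC N]_z (h (block_coordinates j z) * (block_monomial j e z)%:E) =
   \int[sigma_finite_product (lebesgueR m) (polar_product (k j))]_p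
     (h p * (block_density (j:=j) e p)%:E))%E.
Proof.
move=> mh h0.
pose G (p : (rvec m * (rvec (k j) * vec R[i] (k j)))%type) :=
  gaussian (p.1 : 'cV[R]_m).
have mG : measurable_fun setT G.
  exact: (measurableT_comp (@measurable_gaussian R m) measurable_fst).
have mw1 : measurable_fun setT (fun z : vec R[i] N =>
    gaussian (block_norms (z : 'cV[R[i]]_N)) * block_monomial j e z).
  apply: measurable_funM; last exact: measurable_block_monomial.
  exact: (measurableT_comp mG (@measurable_block_coordinates R m k j)).
have mw2 : measurable_fun setT (fun p => G p * block_density e p).
  by apply: measurable_funM => //; exact: measurable_block_density.
(* The reciprocal of the Gaussian is moved into the integrand, which cancels the Gaussian put into
   both weights for finiteness. *)
pose h' p := (h p * (expR (\sum_l (p.1 : 'cV[R]_m) l ord0 ^+ 2))%:E)%E.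
have E p : (expR (\sum_l (p.1 : 'cV[R]_m) l ord0 ^+ 2) * G p = 1)%R.
  by rewrite /G /gaussian -expRD subrr expR0.
have mh' : measurable_fun setT h'.
  apply: emeasurable_funM => //; apply/measurable_EFinP.
  apply: (measurableT_comp (@measurable_expR R)).
  apply: measurable_sum => l; apply: measurable_funX.
  exact: (measurableT_comp (measurable_coord l) measurable_fst).
have h'0 p : (0 <= h' p)%E by rewrite mule_ge0// lee_fin expR_ge0.
transitivity (\int[lebesgueC N]_z (h' (block_coordinates j z) *
    (gaussian (block_norms (z : 'cV[R[i]]_N)) * block_monomial j e z)%:E))%E.
  apply: eq_integral => z _.
  rewrite /h' -muleA -EFinM; congr (_ * _%:E)%E.
  by rewrite mulrA (E (block_coordinates j z)) mul1r.
transitivity (\int[sigma_finite_product (lebesgueR m) (polar_product (k j))]_p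
    (h' p * (G p * block_density e p)%:E))%E; last first.
  apply: eq_integral => p _.
  by rewrite /h' -muleA -EFinM mulrA E mul1r.
apply: (ge0_integral_box_transfer (@measurable_block_coordinates R m k j) mw1 _ mw2) => //.
- by move=> z; rewrite mulr_ge0 ?gaussian_ge0 ?block_monomial_ge0.
- by move=> p; rewrite mulr_ge0 ?gaussian_ge0 ?block_density_ge0.
(* Finiteness of the weighted measure is the box computation for the whole space. *)
- have := @integral_box_blocks R m k j hk e (fun=> setT) setT
    (fun=> measurableT) measurableT.
  rewrite (_ : (fun z => _) = (fun z : vec R[i] N =>
    (gaussian (block_norms (z : 'cV[R[i]]_N)) * block_monomial j e z)%:E)) => [->|].
    exact: ltry.
  apply/funext => z; congr (_%:E); rewrite indicE mem_set ?mul1r//.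
- by move=> A D mA mD; rewrite integral_box_blocks// integral_box_density.
Qed.

End block_polar_coordinates.

(** * From nonnegative to real integrands, on the polar domain *)

Lemma big_blocks (S : Type) (idx : S) (op : Monoid.com_law idx) m
    (k : 'I_m -> nat) (F : 'I_(\sum_l k l) -> S) :
  \big[op/idx]_i F i = \big[op/idx]_l \big[op/idx]_(i < k l) F (tagnat.Rank l i).
Proof.
rewrite sig_big_dep/= (reindex _ tagnat.rank_bij_on)/=.
by apply: eq_bigr => -[l i] _.
Qed.

Lemma Rintegral_transfer (R : realType) d d' (T : measurableType d)
    (T' : measurableType d') (mu : {measure set T -> \bar R})
    (nu : {measure set T' -> \bar R}) (D : set T) (E : set T')
    (f : T -> R) (g : T' -> R) (C : R) : 0 < C ->
  (forall s : bool, \int[mu]_(x in D) (Num.max ((-1) ^+ s * f x) 0)%:E =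
     C%:E * \int[nu]_(y in E) (Num.max ((-1) ^+ s * g y) 0)%:E)%E ->
  \int[mu]_(x in D) f x = C * \int[nu]_(y in E) g y.
Proof.
move=> C0 H; rewrite /Rintegral !(integralE _ _ (fun x => (_ x)%:E)).
have Epos T0 (u : T0 -> R) : ((fun x => (u x)%:E) ^\+ =
    (fun x => (Num.max ((-1) ^+ false * u x) 0)%:E))%E.
  by apply/funext => x; rewrite funeposE EFin_max expr0 mul1r.
have Eneg T0 (u : T0 -> R) : ((fun x => (u x)%:E) ^\- =
    (fun x => (Num.max ((-1) ^+ true * u x) 0)%:E))%E.
  by apply/funext => x; rewrite funenegE EFin_max expr1 mulN1r EFinN.
rewrite !Epos !Eneg !H.
have pos s : (0 <= \int[nu]_(y in E) (Num.max ((-1) ^+ s * g y) 0)%:E)%E.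
  by apply: integral_ge0 => y _; rewrite lee_fin le_max lexx orbT.
move: (pos false) (pos true).
move: (\int[nu]_(y in E) _)%E (\int[nu]_(y in E) _)%E => A B.
have Coo : (C%:E * +oo = +oo :> \bar R)%E by rewrite gt0_muley.
case: A => [A| |]; case: B => [B| |] //= _ _; rewrite ?Coo /= ?mulr0//.
by rewrite mulrBr.
Qed.

Section block_point.
Context {R : realType} {m : nat}.
Notation leb := (@lebesgue_measure R).
Notation rvec := (vec (measurableTypeR R)).
Variables (k : 'I_m -> nat) (j : 'I_m).
Hypothesis hk : forall l, (0 < k l)%N.
Notation N := (\sum_l k l)%N.
Notation P := (rvec m * rvec (k j) * vec R[i] (k j))%type.

(** Same data as [block_coordinates], associated to the left as in [polar_measure]; the box argument
    needs the angular pair grouped together. *)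
Definition block_point (z : vec R[i] N) : P :=
  (block_norms (z : 'cV[R[i]]_N), modulus_part (submxcol (z : 'cV[R[i]]_N) j),
   phase_part (submxcol (z : 'cV[R[i]]_N) j)).

Lemma measurable_block_point : measurable_fun setT block_point.
Proof.
apply/measurable_fun_pairP; split => /=; last first.
  exact: (measurableT_comp (@measurable_phase_part R _) (@measurable_submxcol _ _ _ k j)).
apply/measurable_fun_pairP; split => /=; first exact: measurable_block_norms.
exact: (measurableT_comp (@measurable_modulus_part R _) (@measurable_submxcol _ _ _ k j)).
Qed.

Lemma rnorm_block_norms (z : 'cV[R[i]]_N) : rnorm (block_norms z) = cnorm z.
Proof.
rewrite /rnorm /cnorm; congr Num.sqrt.
rewrite big_blocks; apply: eq_bigr => l _.
by rewrite mxE cnorm_sqr; apply: eq_bigr => i _; rewrite mxE.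
Qed.

Lemma measurable_pos_sphere n : measurable (pos_sphere n : set (rvec n)).
Proof.
rewrite (_ : pos_sphere n =
  (\bigcap_(i in [set: 'I_n])
    ((fun x : rvec n => (x : 'cV[R]_n) i ord0)
      @^-1` `[0, +oo[%classic)) `&`
  ((fun x : rvec n => rnorm x) @^-1` [set 1])); last first.
  apply/seteqP; split => x /=.
    by move=> [x0 x1]; split => // i _ /=; rewrite in_itv/= x0.
  move=> [x0 x1]; split => // i.
  by have := x0 i I; rewrite /= in_itv/= andbT.
apply: measurableI.
  apply: fin_bigcap_measurable => // i _.
  by rewrite -[X in measurable X]setTI; exact: measurable_coord.
by rewrite -[X in measurable X]setTI; exact: measurable_rnorm.
Qed.

Lemma torusE n : torus n = [set t : vec R[i] n | unimodular t].
Proof.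
apply/seteqP; split => t /=; rewrite /torus/= => tu.
  apply/forallP => i; have /eqP := tu i; rewrite normr_normc.
  by move=> /eqP[->].
by move=> i; rewrite normr_normc (eqP (forallP tu i)).
Qed.

Lemma measurable_torus n : measurable (torus n : set (vec R[i] n)).
Proof.
rewrite torusE.
have -> : [set t | unimodular t] = (@unimodular R n) @^-1` [set true].
  by apply/seteqP; split => t.
by rewrite -[X in measurable X]setTI; exact: measurable_unimodular.
Qed.

Lemma measurable_polar_domain : measurable (polar_domain k j : set P).
Proof.
apply: measurableX; last exact: measurable_torus.
apply: measurableX; last exact: measurable_pos_sphere.
exact: measurable_tau_ball.
Qed.

(** The sphere and torus conditions hold for every [z] thanks to the default values, and the norm of
    the block norms is that of [z]. *)
Lemma block_point_domain z : polar_domain k j (block_point z) <-> unit_ball N z.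
Proof.
rewrite /unit_ball/= -rnorm_block_norms; split => [[[[]]]//|z1].
split; last exact: phase_part_torus.
split; last first.
  rewrite /=; case: (k j) (hk j) (submxcol _ j) => // n _ w.
  exact: modulus_part_sphere.
by split => // l; rewrite mxE cnorm_ge0.
Qed.

End block_point.

Lemma measurable_unit_ball (R : realType) n :
  measurable (unit_ball n : set (vec R[i] n)).
Proof.
rewrite (_ : unit_ball n = (fun z : vec R[i] n => cnorm z) @^-1` `]-oo, 1[%classic).
  by rewrite -[X in measurable X]setTI; exact: measurable_cnorm.
by apply/seteqP; split => z /=; rewrite in_itv.
Qed.

Section block_point_integral.
Context {R : realType} {m : nat}.
Notation leb := (@lebesgue_measure R).
Notation rvec := (vec (measurableTypeR R)).
Variables (k : 'I_m -> nat) (j : 'I_m).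
Hypothesis hk : forall l, (0 < k l)%N.
Variable e : forall l, 'cV[nat]_(k l).
Notation N := (\sum_l k l)%N.
Notation P := (rvec m * rvec (k j) * vec R[i] (k j))%type.

Definition polar_jacobian (p : P) : R :=
  (\prod_l (p.1.1 : 'cV[R]_m) l ord0 ^+ block_exponent j e l) *
  \prod_i (p.1.2 : 'cV[R]_(k j)) i ord0.

(** The indicators of [block_density] exclude boundary points where some [r_l] or [s_i] is 0. There
    [polar_jacobian] vanishes as well, since all exponents are positive, so the two agree on the
    whole domain. *)
Lemma block_density_domain (p : P) : polar_domain k j p ->
  block_density e (p.1.1, (p.1.2, p.2)) =
  (\prod_(l | l != j) block_constant e l) * polar_jacobian p.
Proof.
case: p => [[r s] t] [[/= [r0 _] [s0 s1]]]; rewrite torusE /= => t1.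
rewrite /block_density /polar_jacobian /=; congr (_ * (_ * _)).
  apply: eq_bigr => l _; rewrite /radial_density.
  have el : (0 < block_exponent j e l)%N.
    rewrite /block_exponent; case: ifP => _; rewrite subn_gt0.
      by rewrite (leq_trans _ (leq_pmulr _ (hk l))).
    by rewrite (leq_trans _ (leq_addr _ _))// (leq_trans _ (leq_pmulr _ (hk l))).
  have := r0 l; rewrite le_eqVlt => /predU1P[<-|->]; last by rewrite mul1r.
  by rewrite ltxx mul0r expr0n gtn_eqF.
rewrite /angular /angular_weight/= t1 mulr1 s1 eqxx andbT.
rewrite [X in _ * X]big1 ?mulr1; last by move=> i _; rewrite mxE muln0 expr0.
have [//|/forallPn[i si]] := boolP (positive s); first by rewrite mul1r.
rewrite mul0r (bigD1 i)//= (_ : (s : 'cV[R]__) i ord0 = 0) ?mul0r//.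
by apply/eqP; rewrite eq_le s0 andbT leNgt.
Qed.

Lemma measurable_polar_jacobian : measurable_fun setT polar_jacobian.
Proof.
apply: measurable_funM.
  apply: measurable_prod => l _; apply: measurable_funX.
  apply: (measurableT_comp (measurable_coord l)).
  exact: (measurableT_comp measurable_fst measurable_fst).
apply: measurable_prod => i _.
apply: (measurableT_comp (measurable_coord i)).
exact: (measurableT_comp measurable_snd measurable_fst).
Qed.

Lemma polar_jacobian_ge0 p : polar_domain k j p -> 0 <= polar_jacobian p.
Proof.
move=> [[/= [r0 _] [s0 _]] _]; rewrite mulr_ge0// prodr_ge0// => l _.
by rewrite exprn_ge0.
Qed.

(** Reassociation of the triple product, through the iterated integrals on both sides. *)
Lemma ge0_integral_polar_measure (F : P -> \bar R) :
  measurable_fun setT F -> (forall p, 0 <= F p)%E ->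
  (\int[polar_measure k j]_p F p =
   \int[sigma_finite_product (lebesgueR m) (polar_product (k j))]_p
     F (p.1, p.2.1, p.2.2))%E.
Proof.
move=> mF F0.
pose base := sigma_finite_product (lebesgueR m) (@sphere_measure R (k j)).
transitivity (\int[sigma_finite_product base (torus_haar (k j))]_p F p)%E => //.
rewrite (ge0_integral_product base (torus_haar (k j)) mF F0).
have mF1 := measurable_fun_fubini_tonelli_F (m2 := torus_haar (k j)) _ mF F0.
have F10 x : (0 <= \int[torus_haar (k j)]_t F (x, t))%E.
  by apply: integral_ge0 => t _.
rewrite (ge0_integral_product (lebesgueR m) (@sphere_measure R (k j)) mF1 F10).
pose G (p : rvec m * (rvec (k j) * vec R[i] (k j))) := F (p.1, p.2.1, p.2.2).
have mG : measurable_fun setT G.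
  apply: (measurableT_comp mF).
  apply/measurable_fun_pairP; split => /=; last first.
    exact: (measurableT_comp measurable_snd measurable_snd).
  apply/measurable_fun_pairP; split => /=; first exact: measurable_fst.
  exact: (measurableT_comp measurable_fst measurable_snd).
rewrite (ge0_integral_product (lebesgueR m) (polar_product (k j)) mG (fun p => F0 _)).
apply: eq_integral => r _.
have mGr : measurable_fun setT (fun y => G (r, y)).
  exact: (measurableT_comp mG (pair1_measurable r)).
apply: esym.
exact: (ge0_integral_product (sphere_measure (k j)) (torus_haar (k j)) mGr (fun p => F0 _)).
Qed.

Lemma ge0_integral_block_point (F : P -> R) :
  measurable_fun (polar_domain k j) F -> (forall p, 0 <= F p) ->
  (\int[lebesgueC N]_(z in unit_ball N)
     (F (block_point j z) * block_monomial j e z)%:E =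
   (\prod_(l | l != j) block_constant e l)%:E *
   \int[polar_measure k j]_(p in polar_domain k j)
     (F p * polar_jacobian p)%:E)%E.
Proof.
move=> mF F0.
have mD := @measurable_polar_domain R m k j.
pose G := (EFin \o F) \_ (polar_domain k j).
have mG : measurable_fun setT G.
  by apply/(measurable_restrictT _ _).1 => //; exact/measurable_EFinP.
have G0 p : (0 <= G p)%E by rewrite /G patchE; case: ifP => //; rewrite lee_fin.
have K0 : 0 <= \prod_(l | l != j) @block_constant R m k e l.
  by apply: prodr_ge0 => l _; exact: block_constant_ge0.
pose assoc (p : rvec m * (rvec (k j) * vec R[i] (k j))) : P := (p.1, p.2.1, p.2.2).
have massoc : measurable_fun setT assoc.
  apply/measurable_fun_pairP; split => /=; last first.
    exact: (measurableT_comp measurable_snd measurable_snd).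
  apply/measurable_fun_pairP; split => /=; first exact: measurable_fst.
  exact: (measurableT_comp measurable_fst measurable_snd).
have mGa : measurable_fun setT (G \o assoc) by exact: (measurableT_comp mG massoc).
transitivity (\int[lebesgueC N]_z
    ((G \o assoc) (block_coordinates j z) * (block_monomial j e z)%:E))%E.
  rewrite (integral_mkcond (unit_ball N)); apply: eq_integral => z _.
  rewrite patchE /= -[assoc _]/(block_point j z) /G patchE.
  have -> : (block_point j z \in polar_domain k j) = (z \in unit_ball N).
    by apply/idP/idP; rewrite !inE => /(block_point_domain j hk).
  by case: ifP => _; rewrite ?EFinM ?mul0e.
have Ga0 p : (0 <= (G \o assoc) p)%E by exact: G0.
apply: (etrans (ge0_integral_block_polar hk e mGa Ga0)).
have mW : measurable_fun setT
    (fun p : P => (block_density e (p.1.1, (p.1.2, p.2)))%:E : \bar R).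
  apply/measurable_EFinP; apply: (measurableT_comp (measurable_block_density e)).
  apply/measurable_fun_pairP; split => /=.
    exact: (measurableT_comp measurable_fst measurable_fst).
  apply/measurable_fun_pairP; split => /=; last exact: measurable_snd.
  exact: (measurableT_comp measurable_snd measurable_fst).
have mGW : measurable_fun setT
    (fun p : P => G p * (block_density e (p.1.1, (p.1.2, p.2)))%:E)%E.
  exact: emeasurable_funM.
have GW0 (p : P) : (0 <= G p * (block_density e (p.1.1, (p.1.2, p.2)))%:E)%E.
  by rewrite mule_ge0// lee_fin block_density_ge0.
transitivity (\int[polar_measure k j]_p
    (G p * (block_density e (p.1.1, (p.1.2, p.2)))%:E))%E.
  rewrite (ge0_integral_polar_measure mGW GW0); apply: eq_integral => -[r [s t]] _ //=.
transitivity (\int[polar_measure k j]_(p in polar_domain k j)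
  ((\prod_(l | l != j) block_constant e l)%:E * (F p * polar_jacobian p)%:E))%E.
  rewrite (integral_mkcond (polar_domain k j)); apply: eq_integral => p _.
  rewrite /G !patchE; case: ifPn => [|_]; last by rewrite mul0e.
  by rewrite inE => pD; rewrite block_density_domain//= -!EFinM mulrCA.
rewrite ge0_integralZl_EFin//.
- by move=> p pD; rewrite lee_fin mulr_ge0// polar_jacobian_ge0.
- apply/measurable_EFinP; apply: measurable_funM => //.
  exact: (measurable_funS _ _ measurable_polar_jacobian).
Qed.

Lemma block_constant_gt0 l : 0 < block_constant (R := R) e l.
Proof.
rewrite /block_constant divr_gt0 ?ltr0n ?fact_gt0// mulr_gt0//.
  by rewrite mulr_gt0// exprn_gt0// pi_gt0.
by rewrite ltr0n prodn_gt0// => i; exact: fact_gt0.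
Qed.

Lemma Rintegral_block_point (F : P -> R) :
  measurable_fun (polar_domain k j) F ->
  \int[lebesgueC N]_(z in unit_ball N)
     (F (block_point j z) * block_monomial j e z) =
  (\prod_(l | l != j) block_constant e l) *
   \int[polar_measure k j]_(p in polar_domain k j) (F p * polar_jacobian p).
Proof.
move=> mF; apply: Rintegral_transfer => [|s].
  by apply: prodr_gt0 => l _; exact: block_constant_gt0.
have maxM (x y : R) : 0 <= y -> Num.max ((-1) ^+ s * (x * y)) 0 =
    Num.max ((-1) ^+ s * x) 0 * y.
  by move=> y0; rewrite maxr_pMl// mul0r mulrA.
under eq_integral do rewrite maxM ?block_monomial_ge0//.
rewrite (ge0_integral_block_point (F := fun p => Num.max ((-1) ^+ s * F p) 0)).
- congr (_ * _)%E; apply: eq_integral => p; rewrite inE => pD.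
  by rewrite maxM// polar_jacobian_ge0.
- apply: measurable_maxr => //; apply: measurable_funM => //.
- by move=> p; rewrite le_max lexx orbT.
Qed.

End block_point_integral.

(** * Monomials in block polar coordinates *)

Section monomial_polar.
Context {R : realType} {m : nat}.
Notation rvec := (vec (measurableTypeR R)).
Variables (k : 'I_m -> nat) (j : 'I_m).
Notation N := (\sum_l k l)%N.
Variables alpha beta : 'cV[nat]_N.
Hypothesis alphabeta : forall l, l != j -> submxcol alpha l = submxcol beta l.

Lemma monomial_blocks (gamma : 'cV[nat]_N) (z : 'cV[R[i]]_N) :
  monomial gamma z =
  \prod_l \prod_i submxcol z l i ord0 ^+ submxcol gamma l i ord0.
Proof.
rewrite /monomial big_blocks; apply: eq_bigr => l _.
by apply: eq_bigr => i _; rewrite !mxE.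
Qed.

Lemma mulr_conjc_normc (w : R[i]) : w * w^* = (Normc.normc w ^+ 2)%:C.
Proof.
case: w => x y; rewrite /= sqr_sqrtr ?addr_ge0 ?sqr_ge0//.
by apply/eqP; rewrite eq_complex/=; apply/andP; split; apply/eqP; ring.
Qed.

(** Powers of conjugates replace negative powers, so that the function is polynomial in [t] and its
    conjugate, hence measurable everywhere. On the torus the conjugate is the inverse and the
    exponent [alpha - beta] appears. *)
Definition angular_monomial (s : rvec (k j)) (t : vec R[i] (k j)) : R[i] :=
  (\prod_i (s : 'cV[R]_(k j)) i ord0 ^+
     (submxcol alpha j i ord0 + submxcol beta j i ord0))%:C *
  \prod_i ((t : 'cV[R[i]]_(k j)) i ord0 ^+ submxcol alpha j i ord0 *
     (((t : 'cV[R[i]]_(k j)) i ord0)^*) ^+ submxcol beta j i ord0).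

Let monomial_polar_coordinate (c x : R) (w : R[i]) a b :
  (c%:C * (w * x%:C)) ^+ a * ((c%:C * (w * x%:C)) ^+ b)^* =
  (x ^+ (a + b))%:C * (w ^+ a * (w^*) ^+ b) * (c ^+ a * c ^+ b)%:C.
Proof.
have -> : (((c%:C * (w * x%:C)) ^+ b)^*)%R = (c%:C * (w^* * x%:C)) ^+ b.
  rewrite rmorphXn/=; congr (_ ^+ _).
  by case: w => u v; apply/eqP; rewrite eq_complex/=; apply/andP; split; apply/eqP; ring.
rewrite [(c ^+ a * _)%:C]rmorphM/= !rmorphXn/= !exprMn exprD.
by ring.
Qed.

(** Off block [j] the two exponents coincide, so the product is a squared modulus without phases. On
    block [j] the radius has exponent the sum of both degrees. *)
Lemma monomial_polar (z : 'cV[R[i]]_N) :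
  monomial alpha z * (monomial beta z)^* =
  angular_monomial (modulus_part (submxcol z j)) (phase_part (submxcol z j)) *
  (cnorm (submxcol z j) ^+ (\sum_i submxcol alpha j i ord0 +
     \sum_i submxcol beta j i ord0))%:C *
  (block_monomial j (fun l => submxcol alpha l) z)%:C.
Proof.
rewrite !monomial_blocks rmorph_prod/= -big_split/= (bigD1 j)//=; congr (_ * _).
  rewrite /angular_monomial exprD -!prodrXr !rmorphM/= !rmorph_prod/= -!big_split/=.
  apply: eq_bigr => i _.
  by rewrite {1 2}(modulus_phaseE (submxcol z j)) monomial_polar_coordinate rmorphM.
rewrite /block_monomial rmorph_prod/=; apply: eq_bigr => l lj.
rewrite -alphabeta// !rmorph_prod/= -big_split/=; apply: eq_bigr => i _.
by rewrite rmorphXn/= -exprMn mulr_conjc_normc -rmorphXn/= -exprM.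
Qed.

Lemma angular_monomialE s t : torus (k j) t -> angular_monomial s t =
  (\prod_i (s : 'cV[R]_(k j)) i ord0 ^+
     (submxcol alpha j i ord0 + submxcol beta j i ord0))%:C *
  \prod_i (t : 'cV[R[i]]_(k j)) i ord0 ^
     ((submxcol alpha j i ord0)%:Z - (submxcol beta j i ord0)%:Z).
Proof.
move=> t1; congr (_ * _); apply: eq_bigr => i _.
have tu := t1 i.
have t0 : (t : 'cV[R[i]]_(k j)) i ord0 != 0 by rewrite -normr_gt0 tu.
rewrite expfzDr// -exprnN -exprnP; congr (_ * _).
rewrite -exprVn; congr (_ ^+ _).
apply: (mulfI t0); rewrite divff// mulr_conjc_normc.
have /eqP := tu; rewrite normr_normc => /eqP[->].
by rewrite expr1n.
Qed.

Lemma measurable_angular_monomial : measurable_fun setT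
  (fun p : rvec (k j) * vec R[i] (k j) => angular_monomial p.1 p.2).
Proof.
apply: measurable_funM_complex.
  apply: measurable_real_complex; apply: measurable_prod => i _.
  apply: measurable_funX.
  exact: (measurableT_comp (measurable_coord i) measurable_fst).
apply: measurable_prod_complex => i _.
have mt : measurable_fun setT
    (fun p : rvec (k j) * vec R[i] (k j) => (p.2 : 'cV[R[i]]_(k j)) i ord0).
  exact: (measurableT_comp (measurable_coord i) measurable_snd).
exact: (measurable_funM_complex (measurable_funX_complex _ mt)
  (measurable_funX_complex _ (measurable_conj mt))).
Qed.

End monomial_polar.

(** * The Toeplitz symbol in polar coordinates *)

Lemma Rintegral_scale (R : realType) d (T : measurableType d)
    (mu : {measure set T -> \bar R}) (D : set T) (f : T -> R) (c : R) :
  measurable D -> measurable_fun D f -> 0 <= c ->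
  \int[mu]_(x in D) (c * f x) = c * \int[mu]_(x in D) f x.
Proof.
move=> mD mf; rewrite le_eqVlt => /predU1P[<-|c0].
  rewrite mul0r /Rintegral integral0_eq// => x _; by rewrite mul0r.
apply: Rintegral_transfer => // s.
rewrite -ge0_integralZl_EFin ?(ltW c0)//.
- apply: eq_integral => x _; rewrite -EFinM; congr (_%:E).
  by rewrite maxr_pMr ?ltW// mulr0; congr Num.max; ring.
- by move=> x _; rewrite lee_fin le_max lexx orbT.
- by apply/measurable_EFinP; apply: measurable_maxr => //; apply: measurable_funM.
Qed.

(* [filterS] does not infer its filter through the alias [vec]. *)
Lemma ae_subset d (T : measurableType d) (R : realType)
    (mu : {measure set T -> \bar R}) (P Q : T -> Prop) :
  (forall x, P x -> Q x) ->
  {ae mu, forall x, P x} -> {ae mu, forall x, Q x}.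
Proof. by move=> PQ; apply: filterS. Qed.

Lemma Gamma_ge0 (R : realType) (x : R) : 0 <= Gamma x.
Proof. by apply: Rintegral_ge0 => t _; rewrite mulr_ge0 ?powR_ge0 ?expR_ge0. Qed.

Section toeplitz_integral.
Context {R : realType} {m : nat}.
Notation rvec := (vec (measurableTypeR R)).
Variables (k : 'I_m -> nat) (j : 'I_m).
Hypothesis hk : forall l, (0 < k l)%N.
Notation N := (\sum_l k l)%N.
Notation P := (rvec m * rvec (k j) * vec R[i] (k j))%type.
Variables alpha beta : 'cV[nat]_N.
Hypothesis alphabeta : forall l, l != j -> submxcol alpha l = submxcol beta l.
Variable kappa : 'I_m -> nat.
Hypothesis halpha : forall l, (\sum_i submxcol alpha l i ord0)%N = kappa l.
Hypothesis hbeta : forall l, (\sum_i submxcol beta l i ord0)%N = kappa l.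
Variable a : 'cV[R[i]]_N -> R[i].
Hypothesis ma : measurable_fun (unit_ball N) (a : vec R[i] N -> R[i]).
Variable g : 'cV[R]_m -> 'cV[R]_(k j) -> 'cV[R[i]]_(k j) -> R[i].
Hypothesis mg : measurable_fun (polar_domain k j)
  (fun p : P => g p.1.1 p.1.2 p.2).
Hypothesis a_eq_g : {ae lebesgueC N, forall z : 'cV[R[i]]_N,
  unit_ball N z -> a z =
  g (block_norms z) (modulus_part (submxcol z j)) (phase_part (submxcol z j))}.
Variable lambda : R.

Let e l := submxcol alpha l.

Let radial (x : R) : R := (1 - x ^+ 2) `^ lambda.

(** The integrand after removal of the monomial moduli of the blocks other than [j]; the power of
    [r_j] collects the degrees of both monomials on block [j]. *)
Let polar_symbol (p : P) : R[i] :=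
  g p.1.1 p.1.2 p.2 * angular_monomial alpha beta p.1.2 p.2 *
  (radial (rnorm p.1.1) * (p.1.1 : 'cV[R]_m) j ord0 ^+ (kappa j + kappa j))%:C.

Let ball_symbol (z : vec R[i] N) : R[i] :=
  a z * monomial alpha z * (monomial beta z)^* * (radial (cnorm z))%:C.

Let measurable_radial : measurable_fun setT (radial : measurableTypeR R -> R).
Proof.
apply: (measurableT_comp (measurable_powR _)).
by apply: measurable_funB => //; exact: measurable_funX.
Qed.

Lemma measurable_monomial (gamma : 'cV[nat]_N) :
  measurable_fun setT (monomial gamma : vec R[i] N -> R[i]).
Proof.
apply: measurable_prod_complex => i; apply: measurable_funX_complex.
exact: measurable_coord.
Qed.

Let measurable_ball_symbol : measurable_fun (unit_ball N) ball_symbol.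
Proof.
apply: measurable_funM_complex; last first.
  apply: measurable_funTS; apply: measurable_real_complex.
  exact: (measurableT_comp measurable_radial (@measurable_cnorm R N)).
apply: measurable_funM_complex; last first.
  apply: measurable_funTS; apply: measurable_conj; exact: measurable_monomial.
apply: measurable_funM_complex => //.
by apply: measurable_funTS; exact: measurable_monomial.
Qed.

Let measurable_polar_symbol : measurable_fun (polar_domain k j) polar_symbol.
Proof.
have m1 : measurable_fun setT (fun p : P => p.1.1).
  exact: (measurableT_comp measurable_fst measurable_fst).
apply: measurable_funM_complex; last first.
  apply: measurable_funTS; apply: measurable_real_complex.
  apply: measurable_funM.
    apply: (measurableT_comp measurable_radial).
    exact: (measurableT_comp (@measurable_rnorm R m) m1).
  by apply: measurable_funX; exact: (measurableT_comp (measurable_coord j) m1).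
apply: measurable_funM_complex => //; apply: measurable_funTS.
have m2 : measurable_fun setT (fun p : P => (p.1.2, p.2)).
  apply/measurable_fun_pairP; split => /=; last exact: measurable_snd.
  exact: (measurableT_comp measurable_snd measurable_fst).
exact: (measurableT_comp (@measurable_angular_monomial R m k j alpha beta) m2).
Qed.

Let ball_symbolE : {ae lebesgueC N, forall z : vec R[i] N, unit_ball N z ->
  ball_symbol z = polar_symbol (block_point j z) * (block_monomial j e z)%:C}.
Proof.
apply: ae_subset a_eq_g => z aE /aE {}aE.
rewrite /ball_symbol /polar_symbol /block_point/= aE rnorm_block_norms.
rewrite -(mulrA (g _ _ _)) (monomial_polar alphabeta) halpha hbeta.
rewrite [block_norms _ _ _]mxE [in RHS]rmorphM/=.
by rewrite -/e; ring.
Qed.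

(** Here [f] stands for the real or the imaginary part; only its measurability and compatibility
    with real factors enter. *)
Let integral_part (f : R[i] -> R) (mf : measurable_fun setT f)
    (fM : forall w (x : R), f (w * x%:C) = f w * x) :
  \int[lebesgueC N]_(z in unit_ball N) f (ball_symbol z) =
  (\prod_(l | l != j) block_constant e l) *
   \int[polar_measure k j]_(p in polar_domain k j)
     f (polar_symbol p * (polar_jacobian e p)%:C).
Proof.
have mB := @measurable_unit_ball R N.
have mF : measurable_fun (polar_domain k j) (fun p => f (polar_symbol p)).
  exact: (measurableT_comp mf measurable_polar_symbol).
transitivity (\int[lebesgueC N]_(z in unit_ball N)
    (f (polar_symbol (block_point j z)) * block_monomial j e z)).
  rewrite /Rintegral; congr fine; apply: ae_eq_integral => //.
  - by apply/measurable_EFinP; exact: (measurableT_comp mf measurable_ball_symbol).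
  - apply/measurable_EFinP; apply: measurable_funM; last first.
      by apply: measurable_funTS; exact: measurable_block_monomial.
    apply: (measurable_comp (g := block_point j) (@measurable_polar_domain R m k j) _ mF).
      by move=> _ [z zB <-]; exact/(block_point_domain j hk).
    by apply: measurable_funTS; exact: measurable_block_point.
  - by apply: ae_subset ball_symbolE => z zE /zE ->; rewrite fM.
rewrite (Rintegral_block_point hk e mF); congr (_ * _).
by apply: eq_Rintegral => p _; rewrite fM.
Qed.

Lemma integral_toeplitz_symbol :
  complex_integral (lebesgueC N) (unit_ball N) ball_symbol =
  (\prod_(l | l != j) block_constant e l)%:C *
  complex_integral (polar_measure k j) (polar_domain k j)
    (fun p : P => polar_symbol p * (polar_jacobian e p)%:C).
Proof.
rewrite /complex_integral.
rewrite (integral_part (f := @complex.Re R)); last 2 first.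
- exact: measurable_Re.
- by case=> x y u /=; rewrite mulr0 subr0.
rewrite (integral_part (f := @complex.Im R)); last 2 first.
- exact: measurable_Im.
- by case=> x y u /=; rewrite mulr0 add0r.
by apply/eqP; rewrite eq_complex/= !mul0r subr0 addr0 !eqxx.
Qed.

Lemma bergman_inner_ball_symbol :
  bergman_inner lambda (fun z => a z * monomial alpha z) (monomial beta) =
  (Gamma (N%:R + lambda + 1) / (pi ^+ N * Gamma (lambda + 1)))%:C *
  complex_integral (lebesgueC N) (unit_ball N) ball_symbol.
Proof.
have mB := @measurable_unit_ball R N.
rewrite /bergman_inner /complex_integral; set c := _ / _.
have c0 : 0 <= c by rewrite divr_ge0 ?Gamma_ge0// mulr_ge0 ?Gamma_ge0// exprn_ge0// pi_ge0.
have E z : a z * monomial alpha z * (monomial beta z)^* * (bergman_weight lambda z)%:C =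
    c%:C * ball_symbol z.
  by rewrite /bergman_weight -/c /ball_symbol rmorphM/= mulrCA.
under [X in X +i* _]eq_Rintegral do rewrite E.
under [X in _ +i* X]eq_Rintegral do rewrite E.
have ReM (x : R[i]) : complex.Re (c%:C * x) = c * complex.Re x.
  by case: x => u v /=; rewrite mul0r subr0.
have ImM (x : R[i]) : complex.Im (c%:C * x) = c * complex.Im x.
  by case: x => u v /=; rewrite mul0r addr0.
under [X in X +i* _]eq_Rintegral do rewrite ReM.
under [X in _ +i* X]eq_Rintegral do rewrite ImM.
rewrite (Rintegral_scale _ mB (measurable_ReT measurable_ball_symbol) c0).
rewrite (Rintegral_scale _ mB (measurable_ImT measurable_ball_symbol) c0).
by apply/eqP; rewrite eq_complex/= !mul0r subr0 addr0 !eqxx.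
Qed.

(** The [+ 1] in the exponent of [s] is the Jacobian of the moduli on block [j]. There the bare
    radial exponent [2 * k j - 1] meets [2 * kappa j] from the monomials, so all blocks end up with
    the same form. *)
Lemma polar_symbolE (p : P) : polar_domain k j p ->
  polar_symbol p * (polar_jacobian e p)%:C =
  g p.1.1 p.1.2 p.2 *
  (\prod_i (p.1.2 : 'cV[R]_(k j)) i ord0 ^+
    (submxcol alpha j i ord0 + submxcol beta j i ord0 + 1))%:C *
  (\prod_i (p.2 : 'cV[R[i]]_(k j)) i ord0 ^
    ((submxcol alpha j i ord0)%:Z - (submxcol beta j i ord0)%:Z)) *
  (radial (rnorm p.1.1) *
   \prod_l (p.1.1 : 'cV[R]_m) l ord0 ^+ (2 * k l + 2 * kappa l - 1))%:C.
Proof.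
move=> pD; rewrite /polar_symbol angular_monomialE; last by case: pD.
have -> : \prod_l (p.1.1 : 'cV[R]_m) l ord0 ^+ (2 * k l + 2 * kappa l - 1) =
    (\prod_l (p.1.1 : 'cV[R]_m) l ord0 ^+ block_exponent j e l) *
    (p.1.1 : 'cV[R]_m) j ord0 ^+ (kappa j + kappa j).
  rewrite (bigD1 j)//= [in RHS](bigD1 j)//= /block_exponent eqxx.
  rewrite mulrAC -exprD; congr (_ ^+ _ * _).
    rewrite addnn -mul2n addnBAC//.
    by rewrite (leq_trans _ (leq_pmulr _ (hk j))).
  apply: eq_bigr => l /negbTE lj; rewrite lj.
  by rewrite halpha.
have -> : \prod_i (p.1.2 : 'cV[R]_(k j)) i ord0 ^+
      (submxcol alpha j i ord0 + submxcol beta j i ord0 + 1) =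
    (\prod_i (p.1.2 : 'cV[R]_(k j)) i ord0 ^+
      (submxcol alpha j i ord0 + submxcol beta j i ord0)) *
    \prod_i (p.1.2 : 'cV[R]_(k j)) i ord0.
  by rewrite -big_split/=; apply: eq_bigr => i _; rewrite addn1 exprSr.
by rewrite /polar_jacobian !rmorphM/=; ring.
Qed.

End toeplitz_integral.

(** * Integrability of the Bergman weight *)

Section weight_integrable.
Context {R : realType}.
Notation leb := (@lebesgue_measure R).

(** Dominated by [c^-1] times the exponential density of rate [c], a probability density. *)
Lemma integral_expR_lty (c : R) : 0 < c ->
  (\int[leb]_x ((0 < x)%R%:R * expR (- (c * x)))%:E < +oo)%E.
Proof.
move=> c0.
have me : measurable_fun setT (exponential_pdf c : measurableTypeR R -> R).
  exact: (@measurable_exponential_pdf R c).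
have e0 x : (0 <= c^-1%:E * (exponential_pdf c x)%:E)%E.
  by rewrite -EFinM lee_fin mulr_ge0 ?invr_ge0 ?exponential_pdf_ge0 ?(ltW c0).
have f0 (x : R) : (0 <= ((0 < x)%R%:R * expR (- (c * x)))%:E)%E.
  by rewrite lee_fin mulr_ge0 ?expR_ge0.
have mf : measurable_fun setT (fun x : measurableTypeR R => ((0 < x)%R%:R * expR (- (c * x)))%:E).
  apply/measurable_EFinP; apply: measurable_funM.
    apply: measurable_natr_bool.
    by apply: measurable_fun_ltr => //; exact: measurable_cst.
  apply: (measurableT_comp (@measurable_expR R)); apply: measurable_funN.
  exact: measurable_funM.
have mg : measurable_fun setT (fun x : measurableTypeR R => c^-1%:E * (exponential_pdf c x)%:E)%E.
  by apply/measurable_EFinP; apply: measurable_funM.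
have fg x : (((0 < x)%R%:R * expR (- (c * x)))%:E <=
    c^-1%:E * (exponential_pdf c x)%:E)%E.
  rewrite -EFinM lee_fin; have [x0|x0] := ltP 0 x; last first.
    by rewrite mul0r mulr_ge0 ?invr_ge0 ?exponential_pdf_ge0 ?(ltW c0).
  by rewrite mul1r (exponential_pdfE _ (ltW x0)) mulrA mulVf ?(gt_eqF c0)// mul1r mulNr.
apply: (@le_lt_trans _ _ (\int[leb]_x (c^-1%:E * (exponential_pdf c x)%:E))%E).
  by apply: ge0_le_integral.
rewrite ge0_integralZl_EFin//.
- by rewrite integral_exponential_pdf// mule1 ltry.
- by move=> x _; rewrite lee_fin exponential_pdf_ge0 ?(ltW c0).
- by apply/measurable_EFinP.
- by rewrite invr_ge0 ltW.
Qed.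

(** With [x = 1 - expR (- t)] the integrand becomes [expR (- (lambda + 1) * t)] on the half-line,
    integrable because [lambda + 1] is positive. *)
Lemma integral_powR_onem_lty (lambda : R) : -1 < lambda ->
  (\int[leb]_x ((0 < x < 1)%R%:R * (1 - x) `^ lambda)%:E < +oo)%E.
Proof.
move=> l1.
pose F (x : R) := ((x < 1)%R%:R * (1 - x) `^ lambda)%:E.
have mF : measurable_fun setT F.
  apply/measurable_EFinP; apply: measurable_funM.
    apply: measurable_natr_bool.
    by apply: measurable_fun_ltr => //; exact: measurable_cst.
  by apply: (measurableT_comp (measurable_powR _)); exact: measurable_funB.
have F0 x : (0 <= F x)%E by rewrite lee_fin mulr_ge0 ?powR_ge0.
pose phi (t : R) := 1 - expR (- t).
have dp (t : R) : is_derive t (1%R : R) phi (expR (- t)).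
  by apply: is_derive_eq; rewrite add0r mul1r mulrN1 opprK.
have := @ge0_integration_by_substitution_bigcup R phi (fun t => expR (- t))
  (fun=> 0) (fun n => n.+1%:R) F dp.
have -> : \bigcup_n `]phi 0, phi n.+1%:R]%classic = [set x : R | 0 < x < 1].
  apply/seteqP; split => x /=.
    move=> [n _]/=; rewrite in_itv/= /phi oppr0 expR0 subrr => /andP[-> xn].
    by rewrite (le_lt_trans xn)// gtrBl expR_gt0.
  move=> /andP[x0 x1].
  (* [phi t] reaches [x] exactly at [t = - ln (1 - x)]. *)
  exists (Num.truncn (- ln (1 - x))) => //=.
  rewrite in_itv/= /phi oppr0 expR0 subrr x0/=.
  rewrite lerBrDr -lerBrDl -[leRHS](@lnK _ (1 - x)) ?posrE ?subr_gt0//.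
  by rewrite ler_expR lerNl ltW// truncnS_gt.
have -> : \bigcup_n `]0, n.+1%:R]%classic = [set x : R | 0 < x].
  apply/seteqP; split => x /=.
    by move=> [n _]/=; rewrite in_itv/= => /andP[].
  move=> x0; exists (Num.truncn x) => //=; rewrite in_itv/= x0/=.
  by rewrite ltW// truncnS_gt.
rewrite !integral_set_natr => H.
apply: (@le_lt_trans _ _ (\int[leb]_x (F x * (0 < x < 1)%R%:R%:E))%E).
  rewrite le_eqVlt; apply/orP; left; apply/eqP; apply: eq_integral => x _.
  rewrite /F -EFinM; congr (_%:E).
  by case: (0 < x) => /=; case: (x < 1); rewrite ?mul1r ?mul0r ?mulr1 ?mulr0.
rewrite H//.
- apply: le_lt_trans (integral_expR_lty (c := lambda + 1) _); last first.
    by rewrite -ltrBlDr sub0r.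
  rewrite le_eqVlt; apply/orP; left; apply/eqP; apply: eq_integral => t _.
  have [t0|t0] := ltP 0 t; last by rewrite mule0 mul0r.
  rewrite mule1 mul1r /F -EFinM /phi gtrBl expR_gt0 mul1r opprB addrC subrK.
  by rewrite -expRM -expRD; congr (expR _)%:E; ring.
- by move=> t; apply: continuous_comp; [exact: continuousN|exact: continuous_expR].
- by move=> n m nm; rewrite ler_nat.
- by move=> n x y _ _ xy; rewrite ltrD2l ltrN2 ltr_expR ltrN2.
Qed.

End weight_integrable.

Lemma holomorphic_monomial (R : realType) n (gamma : 'cV[nat]_n) :
  holomorphic_on_ball (monomial gamma : 'cV[R[i]]_n -> R[i]).
Proof.
move=> z _.
have dX i : differentiable ((fun w : 'cV[R[i]]_n => w i ord0 ^+ gamma i ord0) : _ -> R[i]^o) z.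
  case: (gamma i ord0) => [|e].
    rewrite (_ : (fun w => _) = cst 1); first exact: differentiable_cst.
    by apply/funext => w; rewrite expr0.
  rewrite (_ : (fun w => _) = (fun w : 'cV[R[i]]_n => w i ord0 : R[i]^o) ^+ e.+1).
    by apply: differentiableX; exact: differentiable_coord.
  by apply/funext => w; rewrite fctE.
suff H (s : seq 'I_n) : differentiable
    ((fun w : 'cV[R[i]]_n => \prod_(i <- s) w i ord0 ^+ gamma i ord0) : _ -> R[i]^o) z.
  exact: H.
elim: s => [|i s IH].
  have -> : (fun w : 'cV[R[i]]_n => \prod_(i <- [::]) w i ord0 ^+ gamma i ord0) = cst 1.
    by apply/funext => w; rewrite big_nil.
  exact: differentiable_cst.
have -> : (fun w : 'cV[R[i]]_n => \prod_(i <- i :: s) w i ord0 ^+ gamma i ord0) =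
  ((fun w : 'cV[R[i]]_n => w i ord0 ^+ gamma i ord0) : _ -> R[i]^o) *
  ((fun w : 'cV[R[i]]_n => \prod_(i <- s) w i ord0 ^+ gamma i ord0) : _ -> R[i]^o).
  by apply/funext => w; rewrite big_cons.
exact: differentiableM.
Qed.

Section bergman_space_facts.
Context {R : realType}.
Notation leb := (@lebesgue_measure R).
Variable n : nat.
Hypothesis n0 : (0 < n)%N.
Variable lambda : R.
Hypothesis hlambda : -1 < lambda.

Let mB := @measurable_unit_ball R n.

Let radial (x : R) : R := (1 - x ^+ 2) `^ lambda.

Let measurable_radial : measurable_fun setT (radial : measurableTypeR R -> R).
Proof.
apply: (measurableT_comp (measurable_powR _)).
by apply: measurable_funB => //; exact: measurable_funX.
Qed.

(** In [1 - x^2 = (1 + x)(1 - x)] the first factor lies between 1 and 2. The absolute value in the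
    exponent covers negative [lambda]. *)
Lemma powR_onem_sqr_le (x : R) : 0 < x < 1 ->
  (1 - x ^+ 2) `^ lambda <= 2 `^ `|lambda| * (1 - x) `^ lambda.
Proof.
move=> /andP[x0 x1].
rewrite (_ : 1 - x ^+ 2 = (1 + x) * (1 - x)); last by ring.
have x2 : 0 <= 1 + x by rewrite addr_ge0// ltW.
rewrite powRM// ?subr_ge0 ?(ltW x1)//; apply: ler_wpM2r; first exact: powR_ge0.
apply: (@le_trans _ _ ((1 + x) `^ `|lambda|)).
  by apply: ler_powR; rewrite ?lerDl ?(ltW x0)// ler_norm.
apply: ge0_ler_powR; rewrite ?nnegrE//.
by rewrite -[leRHS]/(1 + 1) lerD2l ltW.
Qed.

Lemma integral_ball_radial_lty :
  (\int[lebesgueC n]_(z in unit_ball n) (radial (cnorm z))%:E < +oo)%E.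
Proof.
pose h (x : measurableTypeR R) : R := (x < 1)%R%:R * radial x.
have mh : measurable_fun setT h.
  apply: measurable_funM => //; apply: measurable_natr_bool.
  by apply: measurable_fun_ltr => //; exact: measurable_cst.
have h0 x : 0 <= h x by rewrite mulr_ge0// powR_ge0.
pose q (x : measurableTypeR R) : R := (0 < x < 1)%R%:R * (1 - x) `^ lambda.
have q0 x : 0 <= q x by rewrite mulr_ge0// powR_ge0.
have mq : measurable_fun setT q.
  apply: measurable_funM.
    apply: measurable_natr_bool; apply: measurable_and.
      by apply: measurable_fun_ltr => //; exact: measurable_cst.
    by apply: measurable_fun_ltr => //; exact: measurable_cst.
  by apply: (measurableT_comp (measurable_powR _)); exact: measurable_funB.
(* The zero multi-index makes the monomial factor 1, leaving a one-dimensional integral whose only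
   possible singularity is at [x = 1]. *)
have E := ge0_integral_radial_gt0 (const_mx 0%N : 'cV[nat]_n) n0 mh h0.
rewrite (_ : (\int[lebesgueC n]_(z in unit_ball n) (radial (cnorm z))%:E)%E =
  (\int[lebesgueC n]_z (h (cnorm z) * \prod_i Normc.normc ((z : 'cV[R[i]]_n) i ord0)
     ^+ (2 * (const_mx 0%N : 'cV[nat]_n) i ord0))%:E)%E); last first.
  rewrite (integral_mkcond (unit_ball n)); apply: eq_integral => z _.
  rewrite patchE big1 ?mulr1; last by move=> i _; rewrite mxE muln0 expr0.
  rewrite /h; case: (ltP (cnorm z) 1) => z1; first by rewrite mem_set// mul1r.
  by rewrite memNset ?mul0r// /unit_ball/= => /(le_lt_trans z1); rewrite ltxx.
rewrite E; set C := (_ / _); set d := (2 * n + _ - 1)%N.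
have C0 : 0 <= C.
  by rewrite /C divr_ge0// mulr_ge0// mulr_ge0// exprn_ge0// pi_ge0.
have bound x : h x * ((0 < x)%R%:R * x ^+ d) <= 2 `^ `|lambda| * q x.
  rewrite /h /q; case: (ltP 0 x) => x0; last by rewrite !(mul0r, mulr0).
  case: (ltP x 1) => x1; rewrite ?(mul0r, mulr0)//= !mul1r.
  apply: le_trans (powR_onem_sqr_le _); last by rewrite x0.
  by rewrite ler_piMr ?powR_ge0// exprn_ile1// ltW.
have mhd : measurable_fun setT (fun x : measurableTypeR R =>
    (h x * ((0 < x)%R%:R * x ^+ d))%:E).
  apply/measurable_EFinP; apply: measurable_funM => //; apply: measurable_funM.
    apply: measurable_natr_bool.
    by apply: measurable_fun_ltr => //; exact: measurable_cst.
  exact: measurable_funX.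
have hd0 x : (0 <= (h x * ((0 < x)%R%:R * x ^+ d))%:E)%E.
  rewrite lee_fin mulr_ge0//; case: ltP => x0; rewrite ?mul0r// mul1r.
  by rewrite exprn_ge0// ltW.
apply: lte_mul_pinfty => //.
apply: (@le_lt_trans _ _ (\int[leb]_x ((2 `^ `|lambda|)%:E * (q x)%:E))%E).
  apply: ge0_le_integral => //.
    by apply/measurable_EFinP; apply: measurable_funM.
  by move=> x _; rewrite -EFinM lee_fin bound.
rewrite ge0_integralZl_EFin//.
- by apply: lte_mul_pinfty => //; exact: integral_powR_onem_lty.
- by move=> x _; rewrite lee_fin.
- by apply/measurable_EFinP.
Qed.

Definition bergman_constant : R :=
  Gamma (n%:R + lambda + 1) / (pi ^+ n * Gamma (lambda + 1)).

Lemma bergman_constant_ge0 : 0 <= bergman_constant.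
Proof. by rewrite divr_ge0 ?Gamma_ge0// mulr_ge0 ?Gamma_ge0// exprn_ge0// pi_ge0. Qed.

Lemma bergman_weight_ge0 (z : 'cV[R[i]]_n) : 0 <= bergman_weight lambda z.
Proof. by rewrite mulr_ge0 ?powR_ge0// bergman_constant_ge0. Qed.

Lemma measurable_bergman_weight :
  measurable_fun setT (bergman_weight lambda : vec R[i] n -> R).
Proof.
apply: measurable_funM; first exact: measurable_cst.
exact: (measurableT_comp measurable_radial (@measurable_cnorm R n)).
Qed.

Lemma integral_bergman_weight_lty :
  (\int[lebesgueC n]_(z in unit_ball n) (bergman_weight lambda z)%:E < +oo)%E.
Proof.
under eq_integral do rewrite EFinM.
rewrite ge0_integralZl_EFin//.
- by apply: lte_mul_pinfty integral_ball_radial_lty => //; rewrite ?lee_fin bergman_constant_ge0.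
- by move=> z _; rewrite ?lee_fin powR_ge0.
- apply/measurable_EFinP; apply: measurable_funTS.
  exact: (measurableT_comp measurable_radial (@measurable_cnorm R n)).
- exact: bergman_constant_ge0.
Qed.

End bergman_space_facts.

(** * The Bergman projection *)

Section complex_modulus.
Context {R : realType}.

Lemma Re_le_normc (w : R[i]) : `|complex.Re w| <= Normc.normc w.
Proof.
by case: w => x y; rewrite -sqrtr_sqr ler_wsqrtr// lerDl sqr_ge0.
Qed.

Lemma Im_le_normc (w : R[i]) : `|complex.Im w| <= Normc.normc w.
Proof.
by case: w => x y; rewrite -sqrtr_sqr ler_wsqrtr// lerDr sqr_ge0.
Qed.

Lemma normc_conj (w : R[i]) : Normc.normc (w^*)%R = Normc.normc w.
Proof. by case: w => x y /=; rewrite sqrrN. Qed.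

Lemma normc_le_cnorm n (z : 'cV[R[i]]_n) i : Normc.normc (z i ord0) <= cnorm z.
Proof.
rewrite -(@ler_pXn2r _ 2) ?nnegrE ?cnorm_ge0 ?normc_ge0// cnorm_sqr.
by rewrite (bigD1 i)//= lerDl sumr_ge0// => l _; exact: sqr_ge0.
Qed.

Lemma normc_monomial_le1 n (gamma : 'cV[nat]_n) (z : 'cV[R[i]]_n) :
  unit_ball n z -> Normc.normc (monomial gamma z) <= 1.
Proof.
rewrite /unit_ball/= => z1.
rewrite /monomial; elim/big_ind: _ => [|x y x1 y1|i _].
- by rewrite Normc.normc1.
- by rewrite Normc.normcM mulr_ile1 ?normc_ge0.
elim: (gamma i ord0) => [|e IH]; first by rewrite expr0 Normc.normc1.
rewrite exprS Normc.normcM mulr_ile1 ?normc_ge0//.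
exact: le_trans (normc_le_cnorm z i) (ltW z1).
Qed.

Lemma measurable_normc_on d (T : measurableType d) (D : set T) (f : T -> R[i]) :
  measurable_fun D f -> measurable_fun D (fun x => Normc.normc (f x)).
Proof.
apply: measurableT_comp.
by apply: measurable_normc; exact: measurable_id.
Qed.

End complex_modulus.

Section bergman_L2.
Context {R : realType}.
Variable n : nat.
Hypothesis n0 : (0 < n)%N.
Variable lambda : R.
Hypothesis hlambda : -1 < lambda.

Let mB := @measurable_unit_ball R n.
Let w := bergman_weight lambda : vec R[i] n -> R.

Let w0 z : 0 <= w z. Proof. exact: bergman_weight_ge0. Qed.

Let mw : measurable_fun (unit_ball n) w.
Proof. by apply: measurable_funTS; exact: measurable_bergman_weight. Qed.

(** The weight has finite mass on the ball, so essential boundedness suffices. This applies to the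
    monomials and to their products with the symbol. *)
Lemma bergman_L2_bounded (f : vec R[i] n -> R[i]) (M : R) :
  measurable_fun (unit_ball n) f ->
  {ae lebesgueC n, forall z, unit_ball n z -> Normc.normc (f z) <= M} ->
  bergman_L2 lambda f.
Proof.
move=> mf fM; split=> //.
have mf2 : measurable_fun (unit_ball n)
    (fun z => (Normc.normc (f z) ^+ 2 * bergman_weight lambda z)%:E).
  apply/measurable_EFinP; apply: measurable_funM => //.
  by apply: measurable_funX; exact: measurable_normc_on.
apply: (@le_lt_trans _ _
    (\int[lebesgueC n]_(z in unit_ball n) ((M ^+ 2)%:E * (w z)%:E))%E).
  apply: ae_ge0_le_integral => //.
  - by move=> z _; rewrite lee_fin mulr_ge0 ?sqr_ge0 ?w0.
  - by move=> z _; rewrite -EFinM lee_fin mulr_ge0 ?sqr_ge0 ?w0.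
  - by apply/measurable_EFinP; apply: measurable_funM.
  - apply: ae_subset fM => z fM zB; rewrite -EFinM lee_fin ler_wpM2r ?w0//.
    by rewrite lerXn2r ?nnegrE ?normc_ge0// ?(le_trans (normc_ge0 _) (fM zB))// fM.
rewrite ge0_integralZl_EFin//.
- apply: lte_mul_pinfty => //; first by rewrite lee_fin sqr_ge0.
  exact: integral_bergman_weight_lty.
- by move=> z _; rewrite lee_fin w0.
- by apply/measurable_EFinP.
- exact: sqr_ge0.
Qed.

Section inner.
Variable P : R[i] -> R.
Hypothesis mP : measurable_fun setT P.
Hypothesis P_le : forall v, `|P v| <= Normc.normc v.

(** Domination of [|u| |f|] by [|u|^2 + |f|^2], with [P] the real or the imaginary part. *)
Let integrable_inner (u f : vec R[i] n -> R[i]) :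
  bergman_L2 lambda u -> bergman_L2 lambda f ->
  (lebesgueC n).-integrable (unit_ball n)
    (fun z => (P (u z * (f z)^* * (w z)%:C))%:E).
Proof.
move=> [mu uoo] [mf foo].
have int2 (h : vec R[i] n -> R[i]) : bergman_L2 lambda h ->
    (lebesgueC n).-integrable (unit_ball n)
      (fun z => (Normc.normc (h z) ^+ 2 * w z)%:E).
  move=> [mh hoo]; apply/integrableP; split.
    apply/measurable_EFinP; apply: measurable_funM => //.
    by apply: measurable_funX; exact: measurable_normc_on.
  rewrite (eq_integral (fun z => (Normc.normc (h z) ^+ 2 * w z)%:E))// => z _.
  by rewrite gee0_abs// lee_fin mulr_ge0 ?sqr_ge0 ?w0.
have iuf := integrableD mB (int2 u (conj mu uoo)) (int2 f (conj mf foo)).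
apply: le_integrable iuf => //.
  apply/measurable_EFinP; apply: (measurableT_comp mP).
  apply: measurable_funM_complex; last exact: measurable_real_complex.
  by apply: measurable_funM_complex => //; exact: measurable_conj.
move=> z _ /=; rewrite lee_fin.
rewrite (le_trans (P_le _))// normcM_real ?w0// Normc.normcM normc_conj.
rewrite [leRHS]ger0_norm -?mulrDl; last first.
  by rewrite mulr_ge0 ?w0// addr_ge0 ?sqr_ge0.
apply: ler_wpM2r; first exact: w0.
move: (normc_ge0 (u z)) (normc_ge0 (f z)).
move: (Normc.normc (u z)) (Normc.normc (f z)) => x y x0 y0.
by nra.
Qed.

(** Unlike the transfer formulas, the difference of two integrals does require integrability,
    supplied by the square-integrable factors. *)
Lemma Rintegral_inner_sub (u v f : vec R[i] n -> R[i]) :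
  (forall x y, P (x - y) = P x - P y) ->
  bergman_L2 lambda u -> bergman_L2 lambda v -> bergman_L2 lambda f ->
  \int[lebesgueC n]_(z in unit_ball n)
    P ((u z - v z) * (f z)^* * (w z)%:C) =
  \int[lebesgueC n]_(z in unit_ball n) P (u z * (f z)^* * (w z)%:C) -
  \int[lebesgueC n]_(z in unit_ball n) P (v z * (f z)^* * (w z)%:C).
Proof.
move=> PB uL vL fL; rewrite -RintegralB//.
- by apply: eq_Rintegral => z _; rewrite -PB !mulrBl.
- exact: integrable_inner.
- exact: integrable_inner.
Qed.

End inner.

Lemma bergman_inner_sub (u v f : 'cV[R[i]]_n -> R[i]) :
  bergman_L2 lambda u -> bergman_L2 lambda v -> bergman_L2 lambda f ->
  bergman_inner lambda (fun z => u z - v z) f =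
  bergman_inner lambda u f - bergman_inner lambda v f.
Proof.
move=> uL vL fL; rewrite /bergman_inner /complex_integral.
rewrite (Rintegral_inner_sub (P := @complex.Re R) _ _ _ uL vL fL); last 3 first.
- exact: measurable_Re.
- exact: Re_le_normc.
- by case=> ? ? [].
rewrite (Rintegral_inner_sub (P := @complex.Im R) _ _ _ uL vL fL); last 3 first.
- exact: measurable_Im.
- exact: Im_le_normc.
- by case=> ? ? [].
by [].
Qed.

Lemma bergman_space_monomial (gamma : 'cV[nat]_n) :
  bergman_space lambda (monomial gamma).
Proof.
split; last exact: holomorphic_monomial.
apply: (bergman_L2_bounded (M := 1)).
  apply: measurable_funTS; apply: measurable_prod_complex => i.
  by apply: measurable_funX_complex; exact: measurable_coord.
by apply: aeW => z; exact: normc_monomial_le1.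
Qed.

Lemma bergman_inner_projection B (h f : 'cV[R[i]]_n -> R[i]) :
  bergman_projection lambda B -> bergman_L2 lambda h ->
  bergman_space lambda f ->
  bergman_inner lambda (B h) f = bergman_inner lambda h f.
Proof.
move=> hB hL fS; have [[BhL _] /(_ f fS)] := hB h hL.
rewrite bergman_inner_sub//; last by case: fS.
by move/eqP; rewrite subr_eq0 => /eqP.
Qed.

End bergman_L2.

(** * The constant and the conclusion *)

Lemma toeplitz_constant (R : realType) m (k : 'I_m -> nat) (j : 'I_m)
    (e : forall l, 'cV[nat]_(k l)) (kappa : 'I_m -> nat) (x y : R) :
  (forall l, (\sum_i e l i ord0)%N = kappa l) ->
  x / (pi ^+ (\sum_l k l) * y) * (\prod_(l | l != j) block_constant e l) =
  2 ^+ m.-1 * x * (\prod_(l | l != j) \prod_i (e l i ord0)`!)%N%:R /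
    (pi ^+ k j * y * (\prod_(l | l != j) (k l + kappa l - 1)`!)%N%:R).
Proof.
move=> ekappa.
rewrite (eq_bigr (fun l => 2 * pi ^+ k l * (\prod_i (e l i ord0)`!)%N%:R /
  (k l + kappa l - 1)`!%:R)); last by move=> l _; rewrite /block_constant ekappa.
rewrite !big_split/= prodr_const cardC1 card_ord -natr_prod prodrXr prodfV -natr_prod.
rewrite (bigD1 j)//= exprD !invfM.
set D := (\prod_(l | l != j) _`!)%N; set S := (\sum_(l | l != j) _)%N.
have D0 : D%:R != 0 :> R by rewrite pnatr_eq0 -lt0n prodn_gt0// => l; exact: fact_gt0.
have p0 p : (pi : R) ^+ p != 0 by rewrite expf_neq0// gt_eqF// pi_gt0.
(* [y] occurs only through its inverse; once that is generalised, [field] asks for no proof that [y]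
   is nonzero. *)
move: (y^-1) => y'; have := p0 S; have := p0 (k j).
move: (pi ^+ S) (pi ^+ k j) => P Q P0 Q0.
by field; rewrite P0 Q0 D0.
Qed.

Theorem theorem7p6 (R : realType) (m : nat) (k : 'I_m -> nat) (j : 'I_m)
    (hm : (2 <= m)%N) (hk : forall l, (0 < k l)%N)
    (a : 'cV[R[i]]_(\sum_l k l) -> R[i])
    (a_bounded : Linfty (lebesgueC (\sum_l k l)) (unit_ball (\sum_l k l)) a)
    (a_quasi : quasi_radial_quasi_homogeneous k j a)
    (g : 'cV[R]_m -> 'cV[R]_(k j) -> 'cV[R[i]]_(k j) -> R[i])
    (g_bounded : Linfty (polar_measure k j) (polar_domain k j)
       (fun p => g p.1.1 p.1.2 p.2))
    (g_homogeneous : forall r s t (eta : R[i]),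
       tau_ball m r -> pos_sphere (k j) s -> torus (k j) t -> `|eta| = 1 ->
       g r s (eta *: t) = g r s t)
    (a_eq_g : {ae lebesgueC (\sum_l k l), forall z : 'cV[R[i]]_(\sum_l k l),
       unit_ball (\sum_l k l) z ->
       forall (s : 'cV[R]_(k j)) (t : 'cV[R[i]]_(k j)),
         pos_sphere (k j) s -> torus (k j) t ->
         (forall i, submxcol z j i ord0 =
            (cnorm (submxcol z j))%:C * (t i ord0 * (s i ord0)%:C)) ->
         a z = g (block_norms z) s t})
    (lambda : R) (hlambda : -1 < lambda) (kappa : 'I_m -> nat)
    (B : ('cV[R[i]]_(\sum_l k l) -> R[i]) -> 'cV[R[i]]_(\sum_l k l) -> R[i])
    (hB : bergman_projection lambda B)
    (alpha beta : 'cV[nat]_(\sum_l k l))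
    (halpha : forall l, (\sum_i submxcol alpha l i ord0)%N = kappa l)
    (hbeta : forall l, (\sum_i submxcol beta l i ord0)%N = kappa l)
    (halphabeta : forall l, l != j -> submxcol alpha l = submxcol beta l) :
  bergman_inner lambda (toeplitz B a (monomial alpha)) (monomial beta) =
  (2 ^+ m.-1 * Gamma ((\sum_l k l)%N%:R + lambda + 1) *
     (\prod_(l | l != j) \prod_i (submxcol alpha l i ord0)`!)%N%:R /
   (pi ^+ k j * Gamma (lambda + 1) *
     (\prod_(l | l != j) (k l + kappa l - 1)`!)%N%:R))%:C *
  complex_integral (polar_measure k j) (polar_domain k j)
    (fun p : 'cV[R]_m * 'cV[R]_(k j) * 'cV[R[i]]_(k j) =>
       let: (r, s, t) := p in
       g r s t *
       (\prod_i s i ord0 ^+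
          (submxcol alpha j i ord0 + submxcol beta j i ord0 + 1))%:C *
       (\prod_i t i ord0 ^
          ((submxcol alpha j i ord0)%:Z - (submxcol beta j i ord0)%:Z)) *
       ((1 - rnorm r ^+ 2) `^ lambda *
        \prod_l r l ord0 ^+ (2 * k l + 2 * kappa l - 1))%:C).
Proof.
have n0 : (0 < \sum_l k l)%N by rewrite (bigD1 j)//= ltn_addr.
have [ma [M aM]] := a_bounded.
(* The property of [B] is available on square-integrable functions only. Monomials have modulus at
   most 1 on the ball, so the bound of [a] is inherited. *)
have hL : bergman_L2 lambda (fun z => a z * monomial alpha z).
  apply: (bergman_L2_bounded n0 hlambda (M := M)).
    apply: measurable_funM_complex => //; apply: measurable_funTS.
    exact: measurable_monomial.
  apply: ae_subset aM => z aM zB; rewrite Normc.normcM.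
  by rewrite (le_trans _ (aM zB))// ler_piMr ?normc_ge0// normc_monomial_le1.
rewrite /toeplitz (bergman_inner_projection hB hL); last first.
  exact: bergman_space_monomial.
(* The hypothesis covers every polar representation of block [j]; the choice [modulus_part],
   [phase_part] is measurable in [z]. *)
have a_eq : {ae lebesgueC (\sum_l k l), forall z : 'cV[R[i]]_(\sum_l k l),
    unit_ball (\sum_l k l) z -> a z =
    g (block_norms z) (modulus_part (submxcol z j)) (phase_part (submxcol z j))}.
  apply: ae_subset a_eq_g => z azg zB; apply: azg => //.
  - by have [[]] := (block_point_domain j hk z).2 zB.
  - exact: phase_part_torus.
  - by move=> i; exact: modulus_phaseE.
rewrite bergman_inner_ball_symbol//.
rewrite (integral_toeplitz_symbol hk halphabeta halpha hbeta ma (proj1 g_bounded) a_eq).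
rewrite mulrA -rmorphM/= (toeplitz_constant j _ _ halpha); congr (_ * _).
rewrite /complex_integral; congr (_ +i* _); apply: eq_Rintegral => -[[r s] t] pD;
  by rewrite (polar_symbolE hk beta halpha g lambda)//; rewrite inE in pD.
Qed.
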